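(* (Nonlocal Div-Curl Lemma) Let $N\ge 1$, $0<s<1<p<\infty$, $\frac1p+\frac1{p'}=1$. Let $\phi_n,\phi_0\in L^{p'}(\mathbb{R}^N\times\mathbb{R}^N)$ and $v_n,v_0\in W^{s,p}(\mathbb{R}^N)$, $n\in\mathbb{N}$, be such that $$\begin{cases} v_n\rightharpoonup v_0 & \text{weakly in } W^{s,p}(\mathbb{R}^N),\\ \phi_n\rightharpoonup\phi_0 & \text{weakly in } L^{p'}(\mathbb{R}^N\times\mathbb{R}^N),\\ d_{s,p}\phi_n\to d_{s,p}\phi_0 & \text{strongly in } W^{-s,p'}_{\text{loc}}(\mathbb{R}^N).\end{cases}$$ Then $\phi_n D_{s,p}v_n\to\phi_0 D_{s,p}v_0$ in the sense of distributions (on $\mathbb{R}^N\times\mathbb{R}^N$).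
   Context: $W^{s,p}(\mathbb{R}^N)$ is the space of $u\in L^p(\mathbb{R}^N)$ with $[u]_{s,p}:=\left(\iint_{\mathbb{R}^N\times\mathbb{R}^N}\frac{|u(x)-u(y)|^p}{|x-y|^{N+sp}}\,dx\,dy\right)^{1/p}<\infty$, normed by $\|u\|_{s,p}=(\|u\|_{L^p}^p+[u]_{s,p}^p)^{1/p}$; its dual is $W^{-s,p'}(\mathbb{R}^N)$. For $\Omega\subset\mathbb{R}^N$ open, $W^{s,p}_0(\Omega)$ is the closure of $C_c^\infty(\Omega)$ in $W^{s,p}(\mathbb{R}^N)$, and for $\Omega$ bounded and $f\in W^{-s,p'}(\mathbb{R}^N)$, $\|f\|_{-s,p',\Omega}:=\sup\{\langle f,u\rangle: u\in W^{s,p}_0(\Omega),\ [u]_{s,p}=1\}$. We say $f_n\to f$ in $W^{-s,p'}_{\text{loc}}(\mathbb{R}^N)$ (for $f_n,f\in W^{-s,p'}(\mathbb{R}^N)$) if $\|f_n-f\|_{-s,p',\Omega}\to0$ for every bounded open $\Omega\subset\mathbb{R}^N$. The $(s,p)$-gradient of $u\in W^{s,p}(\mathbb{R}^N)$ is $D_{s,p}u(x,y):=\frac{u(x)-u(y)}{|x-y|^{N/p+s}}\in L^p(\mathbb{R}^N\times\mathbb{R}^N)$. The $(s,p)$-divergence of $\phi\in L^{p'}(\mathbb{R}^N\times\mathbb{R}^N)$ is $d_{s,p}\phi(x):=\text{p.v.}\int_{\mathbb{R}^N}\frac{\phi(x,y)-\phi(y,x)}{|x-y|^{N/p+s}}\,dy$,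 which is the element of $W^{-s,p'}(\mathbb{R}^N)$ given by $\langle d_{s,p}\phi,u\rangle=\iint_{\mathbb{R}^N\times\mathbb{R}^N}\phi\,D_{s,p}u\,dx\,dy$ for all $u\in W^{s,p}(\mathbb{R}^N)$. *)

(* Defs.v *)
From HB Require Import structures.
From mathcomp Require Import all_boot all_order all_algebra.
From mathcomp Require Import all_classical all_reals all_analysis.
From mathcomp Require Import measurable_realfun ring.

Set Implicit Arguments.
Unset Strict Implicit.
Unset Printing Implicit Defensive.

Import Order.TTheory GRing.Theory Num.Theory.
Import numFieldNormedType.Exports.

Local Open Scope classical_set_scope.
Local Open Scope ring_scope.

(* The sigma-algebra of R^n is the product of the Borel sigma-algebras of the
   coordinates, as for n.-tuple T in the library. *)
Section rV_measurable.
Variables (R : realType) (n : nat).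

Let coord (i : 'I_n) (v : 'rV[R]_n) : R := v ord0 i.

Let rV_set0 : g_sigma_preimage coord set0.
Proof. exact: sigma_algebra0. Qed.

Let rV_setC A : g_sigma_preimage coord A -> g_sigma_preimage coord (~` A).
Proof. exact: sigma_algebraC. Qed.

Let rV_bigcup (F : (set 'rV[R]_n)^nat) :
  (forall i, g_sigma_preimage coord (F i)) ->
  g_sigma_preimage coord (\bigcup_i (F i)).
Proof. exact: sigma_algebra_bigcup. Qed.

HB.instance Definition _ :=
  @isMeasurable.Build default_measure_display 'rV[R]_n
    (g_sigma_preimage coord) rV_set0 rV_setC rV_bigcup.

End rV_measurable.

Lemma measurable_rV_coord (R : realType) n (i : 'I_n) :
  measurable_fun [set: 'rV[R]_n] (fun v => v ord0 i).
Proof.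
move=> _ Y mY; rewrite setTI; apply: sub_sigma_algebra => /=.
rewrite -bigcup_seq/=; exists i => /=; first by rewrite mem_index_enum.
by exists Y => //; rewrite setTI.
Qed.

Lemma measurable_fun_rVP d (T : measurableType d) (R : realType) n
    (f : T -> 'rV[R]_n) :
  measurable_fun [set: T] f <->
  forall i, measurable_fun [set: T] (fun x => f x ord0 i).
Proof.
split=> [mf i|mf].
  exact: (measurableT_comp (@measurable_rV_coord R n i) mf).
move=> _ A mA; rewrite setTI.
suff : g_sigma_preimage (fun (i : 'I_n) (v : 'rV[R]_n) => v ord0 i)
    `<=` [set B | measurable (f @^-1` B)] by exact.
apply: smallest_sub.
  split => /=.
  - by rewrite preimage_set0.
  - by move=> B mB; rewrite setTD preimage_setC; exact: measurableC.
  - by move=> F mF; rewrite preimage_bigcup; exact: bigcup_measurable.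
rewrite -bigcup_seq => B [i /= _] [C mC <-]; rewrite setTI.
by have := mf i measurableT _ mC; rewrite setTI.
Qed.

Section lebesgue_measure_rV.
Context {R : realType}.

Definition rV_cons n (z : measurableTypeR R * 'rV[R]_n) : 'rV[R]_n.+1 :=
  row_mx (z.1%:M : 'rV_1) z.2.

Definition rV_uncons n (v : 'rV[R]_n.+1) : measurableTypeR R * 'rV[R]_n :=
  (v ord0 ord0, rsubmx (v : 'rV_(1 + n))).

Lemma rV_consK n : cancel (@rV_cons n) (@rV_uncons n).
Proof.
move=> [x v]; rewrite /rV_uncons /rV_cons /= row_mxKr; congr (_, _).
have -> : ord0 = lshift n (@ord0 0) by exact/val_inj.
by rewrite [LHS]row_mxEl mxE eqxx mulr1n.
Qed.

Lemma rV_cons0 n z : @rV_cons n z ord0 ord0 = z.1.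
Proof. by have /(congr1 fst) := rV_consK z. Qed.

Lemma rV_consS n z i : @rV_cons n z ord0 (lift ord0 i) = z.2 ord0 i.
Proof.
have -> : lift ord0 i = rshift 1 i by exact/val_inj.
by rewrite [LHS]row_mxEr.
Qed.

Lemma measurable_rV_cons n : measurable_fun setT (@rV_cons n).
Proof.
apply/measurable_fun_rVP => i.
case: (unliftP ord0 i) => [j|] ->.
  under eq_fun do rewrite rV_consS.
  apply: (measurableT_comp (@measurable_rV_coord R n j)).
  exact: measurable_snd.
under eq_fun do rewrite rV_cons0.
exact: measurable_fst.
Qed.

Lemma measurable_rV_uncons n : measurable_fun setT (@rV_uncons n).
Proof.
apply/measurable_fun_pairP; split; first exact: measurable_rV_coord.
apply/measurable_fun_rVP => i.
rewrite [X in measurable_fun _ X]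
  (_ : _ = fun v : 'rV[R]_n.+1 => v ord0 (lift ord0 i)).
  exact: measurable_rV_coord.
apply/funext => v /=; rewrite mxE; congr (v _ _).
exact/val_inj.
Qed.

Section step.
Variables (n : nat) (mu : {sigma_finite_measure set 'rV[R]_n -> \bar R}).

Definition lebesgue_rV_step :=
  pushforward (lebesgue_measure \x mu)%E (@rV_cons n).

Let preimage_cons A : measurable A -> measurable (@rV_cons n @^-1` A).
Proof.
by move=> mA; rewrite -[X in measurable X]setTI; exact: measurable_rV_cons.
Qed.

Let step0 : lebesgue_rV_step set0 = 0%E.
Proof. by rewrite /lebesgue_rV_step /pushforward preimage_set0 measure0. Qed.

Let step_ge0 A : (0 <= lebesgue_rV_step A)%E.
Proof. by rewrite /lebesgue_rV_step /pushforward measure_ge0. Qed.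

Let step_sigma_additive : semi_sigma_additive lebesgue_rV_step.
Proof.
move=> F mF tF mUF; rewrite /lebesgue_rV_step /pushforward preimage_bigcup.
apply: measure_semi_sigma_additive.
- by move=> k; exact: preimage_cons.
- apply/trivIsetP => /= i j _ _ ij; rewrite -preimage_setI.
  by move/trivIsetP : tF => /(_ _ _ _ _ ij) ->//; rewrite preimage_set0.
- by rewrite -preimage_bigcup; exact: preimage_cons.
Qed.

HB.instance Definition _ := isMeasure.Build _ _ _ lebesgue_rV_step
  step0 step_ge0 step_sigma_additive.

Let step_sigma_finite : sigma_finite setT lebesgue_rV_step.
Proof.
have /sigma_finiteP[F [TF ndF Foo]] :=
  sigma_finiteT [the {sigma_finite_measure set (measurableTypeR R) -> \bar R}
                 of lebesgue_measure].
have /sigma_finiteP[G [TG ndG Goo]] := sigma_finiteT mu.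
exists (fun k => @rV_uncons n @^-1` (F k `*` G k)).
  apply/esym; rewrite -subTset => v _.
  have [k _ Fk] : (\bigcup_k F k) (rV_uncons v).1 by rewrite -TF.
  have [l _ Gl] : (\bigcup_k G k) (rV_uncons v).2 by rewrite -TG.
  exists (maxn k l) => //; split.
  - by move: Fk; exact/subsetPset/ndF/leq_maxl.
  - by move: Gl; exact/subsetPset/ndG/leq_maxr.
move=> k; have [mF Fk] := Foo k; have [mG Gk] := Goo k.
have mFG : measurable (F k `*` G k) by exact: measurableX.
split.
  by rewrite -[X in measurable X]setTI; exact: measurable_rV_uncons.
rewrite /lebesgue_rV_step /pushforward -comp_preimage.
have -> : @rV_uncons n \o @rV_cons n = id.
  by apply/funext => z; exact: rV_consK.
by rewrite preimage_id product_measure1E// lte_mul_pinfty// ge0_fin_numE.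
Qed.

HB.instance Definition _ :=
  Measure_isSigmaFinite.Build _ _ _ lebesgue_rV_step
    step_sigma_finite.

End step.

(* N-dimensional Lebesgue measure: R^0 is a point of mass 1 and R^n.+1 is
   R * R^n with the product measure; see [lebesgue_rV_box] below. *)
Fixpoint lebesgue_rV n : {sigma_finite_measure set 'rV[R]_n -> \bar R} :=
  match n with
  | 0 => [the {sigma_finite_measure set 'rV[R]_0 -> \bar R} of \d_(0 : 'rV[R]_0)]
  | n'.+1 => [the {sigma_finite_measure set 'rV[R]_n'.+1 -> \bar R} of
               lebesgue_rV_step (lebesgue_rV n')]
  end.

Lemma lebesgue_rV_box n (A : 'I_n -> set R) : (forall i, measurable (A i)) ->
  lebesgue_rV n [set v | forall i, A i (v ord0 i)] =
  (\prod_(i < n) lebesgue_measure (A i))%E.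
Proof.
elim: n A => [|n IH] A mA.
  by rewrite big_ord0 /= diracE mem_set//= => -[].
rewrite big_ord_recl -IH//= /lebesgue_rV_step /pushforward.
set B := [set v : 'rV[R]_n | forall i, A (lift ord0 i) (v ord0 i)].
rewrite (_ : _ @^-1` _ = A ord0 `*` B); last first.
  apply/seteqP; split => [[x v]/= Av|[x v]/= [Ax Bv] i].
    split; first by have := Av ord0; rewrite rV_cons0.
    by move=> i; have := Av (lift ord0 i); rewrite rV_consS.
  by case: (unliftP ord0 i) => [j|] ->; rewrite ?rV_consS ?rV_cons0//; exact: Bv.
rewrite product_measure1E//; first exact: mA.
rewrite (_ : B = \bigcap_(i in [set: 'I_n])
    ((fun v : 'rV[R]_n => v ord0 i) @^-1` A (lift ord0 i))); last first.
  by apply/seteqP; split => v Bv i; [move=> _; exact: Bv|exact: (Bv i I)].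
apply: fin_bigcap_measurable => // i _.
by rewrite -[X in measurable X]setTI; exact: measurable_rV_coord.
Qed.

End lebesgue_measure_rV.

Notation lebesgue_rV2 n := (lebesgue_rV n \x lebesgue_rV n)%E.

(* The norm of 'rV[R]_n in the library is the max norm; it is used here only
   through its topology and bounded sets. *)
Definition enorm (R : realType) n (x : 'rV[R]_n) : R :=
  Num.sqrt (\sum_(i < n) x ord0 i ^+ 2).

Section weak_convergence.
Context {R : realType} {T : Type}.

(* The (semi)normed space is the set V of functions T -> R with norm nrm. An
   element of the dual is represented by any extension of it to T -> R; by the
   bound, it takes the same value on two functions at distance 0. *)
Definition continuous_dual (V : set (T -> R)) (nrm : (T -> R) -> \bar R) :
    set ((T -> R) -> R) :=
  [set F | (forall a u v, V u -> V v ->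
              F (fun x => a * u x + v x) = a * F u + F v) /\
           exists C : R, forall u, V u -> (`|F u|%:E <= C%:E * nrm u)%E].

Definition weak_cvg (V : set (T -> R)) (nrm : (T -> R) -> \bar R)
    (u_ : nat -> T -> R) (u : T -> R) : Prop :=
  forall F, continuous_dual V nrm F -> F (u_ n) @[n --> \oo] --> F u.

End weak_convergence.

Definition Lp_weak_cvg d (T : measurableType d) (R : realType)
    (mu : {measure set T -> \bar R}) (p : R) : (nat -> T -> R) -> (T -> R) -> Prop :=
  weak_cvg [set f | f \in Lfun mu p%:E] (fun f => 'N[mu]_p%:E[EFin \o f])%E.

Section test_functions.
Context {R : realType} {V : normedModType R}.

(* In finite dimension, existence and continuity of all iterated directional
   derivatives up to order k amounts to being of class C^k. *)
Fixpoint Ck (k : nat) (f : V -> R) : Prop :=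
  continuous f /\
  match k with
  | 0 => True
  | k'.+1 => forall v, (forall x, derivable f x v) /\ Ck k' (fun x => 'D_v f x)
  end.

Definition test_function (Omega : set V) (f : V -> R) : Prop :=
  let supp := closure [set x | f x != 0] in
  [/\ forall k, Ck k f, compact supp & supp `<=` Omega].

End test_functions.

Section fractional_sobolev.
Context {R : realType} {N : nat}.
Implicit Types (s p : R) (u : 'rV[R]_N -> R) (phi : 'rV[R]_N * 'rV[R]_N -> R).
Implicit Types (F : ('rV[R]_N -> R) -> R) (Omega : set 'rV[R]_N).

Definition gagliardo s p u : \bar R :=
  ((\int[lebesgue_rV2 N]_z
     (`|u z.1 - u z.2| `^ p / enorm (z.1 - z.2) `^ (N%:R + s * p))%:E)
   `^ p^-1)%E.

Definition sobolev s p : set ('rV[R]_N -> R) :=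
  [set u | u \in Lfun (lebesgue_rV N) p%:E /\ (gagliardo s p u < +oo)%E].

Definition sobolev_norm s p u : \bar R :=
  (('N[lebesgue_rV N]_p%:E[EFin \o u] `^ p + gagliardo s p u `^ p) `^ p^-1)%E.

Definition sobolev0 s p Omega : set ('rV[R]_N -> R) :=
  [set u | sobolev s p u /\
    forall e : R, 0 < e -> exists2 f, test_function Omega f &
      (sobolev_norm s p (fun x => u x - f x)%R < e%:E)%E].

Definition sobolev_weak_cvg s p : (nat -> 'rV[R]_N -> R) -> ('rV[R]_N -> R) -> Prop :=
  weak_cvg (sobolev s p) (sobolev_norm s p).

(* W^{-s,p'}, indexed by p rather than by its conjugate exponent p' *)
Definition sobolev_dual s p : set (('rV[R]_N -> R) -> R) :=
  continuous_dual (sobolev s p) (sobolev_norm s p).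

(* The set of values is closed under negation, so the maximum with 0 only
   matters when it is empty (for Omega empty), where ereal_sup is -oo. *)
Definition sobolev_dual_norm s p Omega F : \bar R :=
  maxe 0%E (ereal_sup
    [set (F u)%:E | u in [set u | sobolev0 s p Omega u /\ gagliardo s p u = 1%E]]).

Definition sobolev_dual_loc_cvg s p (F_ : nat -> ('rV[R]_N -> R) -> R) F : Prop :=
  forall Omega, open Omega -> bounded_set Omega ->
    sobolev_dual_norm s p Omega (fun u => F_ n u - F u)%R @[n --> \oo] --> 0%E.

Definition sp_grad s p u (z : 'rV[R]_N * 'rV[R]_N) : R :=
  (u z.1 - u z.2) / enorm (z.1 - z.2) `^ (N%:R / p + s).

(* The (s,p)-divergence as a functional on W^{s,p}; [sp_div_dual] below shows
   that it belongs to W^{-s,p'} for phi in L^{p'}. *)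
Definition sp_div s p phi : ('rV[R]_N -> R) -> R :=
  fun u => \int[lebesgue_rV2 N]_z (phi z * sp_grad s p u z).

Definition distribution_cvg (f_ : nat -> 'rV[R]_N * 'rV[R]_N -> R)
    (f : 'rV[R]_N * 'rV[R]_N -> R) : Prop :=
  forall psi : 'rV[R]_N * 'rV[R]_N -> R, test_function setT psi ->
    (\int[lebesgue_rV2 N]_z (f_ n z * psi z)) @[n --> \oo] -->
    \int[lebesgue_rV2 N]_z (f z * psi z).

Lemma measurable_enorm : measurable_fun setT (@enorm R N).
Proof.
apply: (@measurableT_comp _ _ _ _ _ _ (@Num.sqrt R)).
  by apply: continuous_measurable_fun; exact: sqrt_continuous.
apply: measurable_sum => i; apply: measurable_funX.
exact: measurable_rV_coord.
Qed.

Lemma measurable_enormB :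
  measurable_fun setT (fun z : 'rV[R]_N * 'rV[R]_N => enorm (z.1 - z.2)).
Proof.
apply: (measurableT_comp measurable_enorm).
apply/measurable_fun_rVP => i.
rewrite [X in measurable_fun _ X](_ : _ =
  fun z : 'rV[R]_N * 'rV[R]_N => z.1 ord0 i - z.2 ord0 i); last first.
  by apply/funext => z; rewrite !mxE.
apply: measurable_funB.
- exact: (measurableT_comp (@measurable_rV_coord R N i) measurable_fst).
- exact: (measurableT_comp (@measurable_rV_coord R N i) measurable_snd).
Qed.

Lemma measurable_sp_grad s p u : measurable_fun setT u ->
  measurable_fun setT (sp_grad s p u).
Proof.
move=> mu; apply: measurable_funM.
  apply: measurable_funB.
  - exact: (measurableT_comp mu measurable_fst).
  - exact: (measurableT_comp mu measurable_snd).
under eq_fun do rewrite -powRN.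
exact: (measurableT_comp (measurable_powR _) measurable_enormB).
Qed.

Lemma Lnorm_sp_grad s p u : 0 < p ->
  ('N[lebesgue_rV2 N]_p%:E[EFin \o sp_grad s p u])%E = gagliardo s p u.
Proof.
move=> p0; rewrite unlock /Lnorm /gagliardo; congr (_ `^ _)%E.
apply: eq_integral => z _ /=.
rewrite /sp_grad; congr (_%:E).
rewrite normrM powRM// normfV (ger0_norm (powR_ge0 _ _)); congr (_ * _).
rewrite -[in LHS]powRN -powRrM mulNr powRN mulrDl divfK// gt_eqF//.
Qed.

Lemma gagliardo_le_norm s p u : 0 < p ->
  (gagliardo s p u <= sobolev_norm s p u)%E.
Proof.
move=> p0.
have g0 : (0 <= gagliardo s p u)%E by exact: poweR_ge0.
rewrite -[leLHS]poweRe1// -(mulfV (lt0r_neq0 p0)) poweRrM.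
apply: gt0_ler_poweR.
- by rewrite invr_ge0 ltW.
- by rewrite in_itv/= leey poweR_ge0.
- by rewrite in_itv/= leey adde_ge0 ?poweR_ge0.
- by rewrite leeDr ?poweR_ge0.
Qed.

Lemma sp_div_dual s p p' phi : 1 < p -> p^-1 + p'^-1 = 1 ->
  phi \in Lfun (lebesgue_rV2 N) p'%:E -> sobolev_dual s p (sp_div s p phi).
Proof.
move=> p1 pp' Lphi.
have p0 : 0 < p by apply: lt_trans p1.
have p'0 : 0 < p'.
  rewrite -invr_gt0 (_ : p'^-1 = 1 - p^-1); last by rewrite -pp' addrAC subrr add0r.
  by rewrite subr_gt0 invf_lt1.
have mphi : measurable_fun setT phi by exact/set_mem/(sub_Lfun_mfun Lphi).
have nphi : ('N[lebesgue_rV2 N]_p'%:E[EFin \o phi] < +oo)%E.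
  exact/set_mem/(sub_Lfun_finLfun Lphi).
have mu_ u : sobolev s p u -> measurable_fun setT u.
  by move=> [Lu _]; exact/set_mem/(sub_Lfun_mfun Lu).
have H u : sobolev s p u ->
    ('N[lebesgue_rV2 N]_1[EFin \o (phi \* sp_grad s p u)%R] <=
     'N[lebesgue_rV2 N]_p'%:E[EFin \o phi] * gagliardo s p u)%E.
  move=> su; rewrite -Lnorm_sp_grad//; apply: hoelder => //.
    by apply: measurable_sp_grad; exact: mu_.
  by rewrite addrC.
have I u : sobolev s p u ->
    (lebesgue_rV2 N).-integrable setT (EFin \o (phi \* sp_grad s p u)%R).
  move=> su; apply/integrableP; split.
    apply/measurable_EFinP; apply: measurable_funM => //.
    by apply: measurable_sp_grad; exact: mu_.
  rewrite -[ltLHS]Lnorm1; apply: le_lt_trans (H _ su) _.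
  by rewrite lte_mul_pinfty ?Lnorm_ge0 ?ge0_fin_numE ?Lnorm_ge0//; case: su.
split.
  move=> a u v su sv; rewrite /sp_div.
  under eq_Rintegral => z _.
    rewrite (_ : _ * _ =
      a * (phi \* sp_grad s p u) z + (phi \* sp_grad s p v) z); last first.
      rewrite /sp_grad /=; ring.
    over.
  rewrite RintegralD//=; first last.
  - exact: I.
  - exact: (integrableZl measurableT a (I _ su)).
  - by rewrite RintegralZl//; exact: I.
exists (fine ('N[lebesgue_rV2 N]_p'%:E[EFin \o phi])%E) => u su.
rewrite fineK ?ge0_fin_numE ?Lnorm_ge0//.
apply: le_trans (lee_wpmul2l (Lnorm_ge0 _ _ _) (gagliardo_le_norm s u p0)).
apply: le_trans (H _ su); rewrite Lnorm1 /sp_div EFin_normr_Rintegral//; last exact: I.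
apply: le_abse_integral => //.
by have /integrableP[] := I _ su.
Qed.

End fractional_sobolev.

(* Main.v *)
(* Write g(x) = psi(x, x) for the test function psi and split
   psi D w = D (g w) + K w, where the kernel of K carries a factor
   psi(x, y) - g(x) = O(min(1, |x - y|)) which makes K bounded on L^p, with only
   the values of w on a cube involved.  Apply this to w = v_n - v_0.  By Rellich,
   w tends to 0 in L^p on the cube, so K w tends to 0 strongly; the term with
   D (g w) is the value on g w of the difference of the divergences, hence tends
   to 0 because g w is bounded in W^{s,p} and lies in W^{s,p}_0 of a fixed ball.
   What remains is weak convergence tested against fixed functions.  Both Rellich
   and the membership of g w in W^{s,p}_0 come from one smooth quasi-interpolant
   at scale h, whose error is controlled by the part of the Gagliardo energy in
   the strip |x - y| < 3 h.  Norm boundedness of weakly convergent sequences is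
   proved by a gliding hump. *)
Require Import Defs.
From mathcomp Require Import all_boot all_order all_algebra.
From mathcomp Require Import all_classical all_reals all_analysis.
From mathcomp Require Import measurable_realfun ring lra.

Import Order.TTheory GRing.Theory Num.Theory.
Import numFieldNormedType.Exports.

Local Open Scope classical_set_scope.
Local Open Scope ring_scope.

(** The divergence is only known against gradients of functions of one variable, while a test
    function on the product space depends on both, so that psi D w is not admissible. The diagonal
    values of psi are the right substitute because the weight is singular on the diagonal only: the
    factor min(1, |x - y|) gained there turns the kernel of K, at the power p, into |x - y|^(p - N -
    sp) near the diagonal, integrable because s < 1, and |x - y|^(-N - sp) far away, integrable
    because s > 0. The energy is nonlocal, so w cannot simply be restricted to a cube. The identity
    D (g w) = psi D w - K w, read backwards, replaces an extension operator: psi lives on cube times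
    cube, K sees only values on the cube, hence estimates there control g w on the whole space. The
    interpolant at a point uses averages at distance up to 2 h; comparing it at two points at
    distance below h adds one more h, whence the strip of width 3 h. Boundedness is proved in L^p,
    where norming functionals are explicit, and applied to the gradients of v_n - v_0 and to phi_n -
    phi_0. *)

(** * Uniform boundedness through explicit functionals *)

Lemma geometric_increments_cvg {R : realType} (x : R^nat) (c : R) :
  (forall n, `|x n.+1 - x n| <= c * 3^-1 ^+ n) ->
  cvg (x @ \oo) /\
  forall n, `|limn x - x n| <= 3 / 2 * c * 3^-1 ^+ n.
Proof.
move=> xc.
have c0 : 0 <= c by have := le_trans (normr_ge0 _) (xc 0%N); rewrite expr0 mulr1.
(* The induction carries the exact partial sum of the geometric series; the bound without the
   subtracted term is not inductive. The factor 3/2 is 1 / (1 - 1/3). *)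
have H n j : `|x (n + j)%N - x n| <= 3 / 2 * c * (3^-1 ^+ n - 3^-1 ^+ (n + j)).
  elim: j => [|j IH]; first by rewrite addn0 !subrr normr0 mulr0.
  rewrite addnS (le_trans (ler_distD (x (n + j)%N) _ _))//.
  rewrite (le_trans (lerD (xc _) IH))// exprS; lra.
have H' n j : `|x (n + j)%N - x n| <= 3 / 2 * c * 3^-1 ^+ n.
  rewrite (le_trans (H n j))// ler_wpM2l ?mulr_ge0//.
  by rewrite gerBl exprn_ge0.
have cx : cvg (x @ \oo).
  apply/cauchy_cvgP/cauchy_exP => e e0.
  have : (fun n => 3 / 2 * c * 3^-1 ^+ n) @ \oo --> (0 : R).
    have -> : (fun n => 3 / 2 * c * 3^-1 ^+ n) = geometric (3 / 2 * c) (3^-1).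
      exact/funext.
    by apply: cvg_geometric; rewrite gtr0_norm// invf_lt1// ltr1n.
  move=> /cvgr0Pnorm_lt/(_ _ e0)[k _ /(_ _ (leqnn k))] ke.
  exists (x k), k => // n /= kn; rewrite -ball_normE/= distrC.
  rewrite -(subnKC kn); apply: le_lt_trans (H' _ _) _.
  by apply: le_lt_trans ke; exact: ler_norm.
split=> // n.
have : (fun j => `|x j - x n|) @ \oo --> `|limn x - x n|.
  by apply: cvg_norm; apply: cvgB => //; exact: cvg_cst.
move=> h; rewrite -(cvg_lim _ h)//; apply: limr_le.
  by apply/cvg_ex; exists (`|limn x - x n|).
by exists n => // j /= nj; rewrite -(subnKC nj).
Qed.

Section uniform_boundedness.
Context {R : realType} {T : Type}.
Variables (V : set (T -> R)) (nrm : (T -> R) -> \bar R).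

(* Gliding hump: the sign makes the partial sum at least [3^-k nrm (w k)] in
   absolute value on [w k], and the later terms cannot undo this. *)
Let humps (H : nat -> (T -> R) -> R) (w : nat -> T -> R) :=
  fix F k : (T -> R) -> R := match k with
  | 0 => fun=> 0
  | k'.+1 => fun u => F k' u +
      (if 0 <= F k' (w k') then 1 else -1) * (3^-1 ^+ k' * H k' u)
  end.

(** The limit functional is built by a scalar series converging pointwise on [V], so neither
    completeness of [V] nor a category argument enters; the norming functionals are assumed, which
    replaces Hahn-Banach. If the norms were unbounded, the functional [L] would be continuous with
    constant 3/2 and yet unbounded along the sequence. *)
Lemma weak_bounded_norm (u_ : nat -> T -> R) :
  (forall u, V u -> nrm u \is a fin_num) ->
  (forall n, V (u_ n)) ->
  (forall n, exists2 G, continuous_dual V nrm G &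
     (forall u, V u -> (`|G u|%:E <= nrm u)%E) /\
     ((G (u_ n))%:E = nrm (u_ n))%E) ->
  (forall F, continuous_dual V nrm F -> exists C, forall n, `|F (u_ n)| <= C) ->
  exists C : R, forall n, (nrm (u_ n) <= C%:E)%E.
Proof.
move=> nfin Vu norming ptw.
have /choice[G GP] : forall n, exists G, continuous_dual V nrm G /\
     (forall u, V u -> (`|G u|%:E <= nrm u)%E) /\
     ((G (u_ n))%:E = nrm (u_ n))%E.
  by move=> n; have [G ? ?] := norming n; exists G.
pose a n := fine (nrm (u_ n)).
have aE n : nrm (u_ n) = (a n)%:E by rewrite fineK// nfin.
have a0 n : 0 <= a n.
  rewrite -lee_fin -aE; have [_ [/(_ _ (Vu n)) h _]] := GP n.
  by apply: le_trans h; rewrite lee_fin.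
apply: contrapT => unb.
(* The growth 4^k is chosen to beat the weights 3^-k. The indices [i k] need not be increasing. *)
have /choice[i iP] : forall k, exists n, 4 ^+ k <= a n.
  move=> k; apply: contrapT => /forallNP ak; apply: unb; exists (4 ^+ k) => n.
  by rewrite aE lee_fin leNgt; apply/negP => /ltW; exact: ak.
pose w k := u_ (i k); pose H k := G (i k).
pose F := humps H w.
have HV k u : V u -> `|H k u| <= fine (nrm u).
  move=> uV; have [_ [/(_ _ uV) + _]] := GP (i k).
  by rewrite -{1}(fineK (nfin _ uV)).
have Hlin k b u v : V u -> V v -> H k (fun x => b * u x + v x) = b * H k u + H k v.
  by have [[lin _] _] := GP (i k) => uV vV; exact: lin.
have sgn (b : R) : `|if 0 <= b then 1 else -1 : R| = 1.
  by case: ifPn; rewrite ?normrN normr1.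
have FS u k : V u -> `|F k.+1 u - F k u| <= fine (nrm u) * 3^-1 ^+ k.
  move=> uV /=; rewrite addrAC subrr add0r normrM sgn mul1r normrM.
  have e3 : 0 <= 3^-1 ^+ k :> R by rewrite exprn_ge0.
  by rewrite (ger0_norm e3) [leRHS]mulrC ler_wpM2l// HV.
have Flin k b u v : V u -> V v -> F k (fun x => b * u x + v x) = b * F k u + F k v.
  move=> uV vV; elim: k => [|k /= ->]; first by rewrite /= mulr0 addr0.
  rewrite Hlin//; move: (if _ then _ else _) => c; ring.
pose L u := limn (fun k => F k u).
have Fcvg u (uV : V u) := geometric_increments_cvg _ _ (FS u ^~ uV).
have Ldual : continuous_dual V nrm L.
  split.
    move=> b u v uV vV; rewrite /L.
    under eq_fun do rewrite Flin//.
    have [[cu _] [cv _]] := (Fcvg u uV, Fcvg v vV).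
    by apply/cvg_lim => //; apply: cvgD => //; apply: cvgM => //; exact: cvg_cst.
  exists (3 / 2) => u uV; rewrite -(fineK (nfin _ uV)) -EFinM lee_fin.
  by have [_ /(_ 0%N)] := Fcvg u uV; rewrite /= subr0 expr0 mulr1.
have [C CP] := ptw _ Ldual.
(* The terms after the one of index [k] sum to at most 3/2 times 3^-(k+1), that is half of 3^-k,
   times the norm; half of the k-th hump survives, at least half of (4/3)^k. *)
have Lk k : 2^-1 * (4 / 3) ^+ k <= C.
  apply: le_trans (CP (i k)).
  have [_ /(_ k.+1)] := Fcvg _ (Vu (i k)); rewrite -/(L _) -/(a _) => Lt.
  have Fk : a (i k) * 3^-1 ^+ k <= `|F k.+1 (u_ (i k))|.
    have Hw : H k (w k) = a (i k).
      have [_ [_ e]] := GP (i k); apply: EFin_inj; rewrite -aE.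
      exact: e.
    rewrite /= -/(w k) Hw mulrC.
    case: ifPn => [F0|]; last rewrite -ltNge => F0.
      rewrite mul1r ger0_norm ?lerDr// addr_ge0// mulr_ge0//.
    rewrite mulN1r ltr0_norm; first by rewrite opprD opprK lerDr oppr_ge0 ltW.
    by rewrite subr_lt0 (lt_le_trans F0)// mulr_ge0.
  have : 4 ^+ k * 3^-1 ^+ k <= a (i k) * 3^-1 ^+ k.
    by rewrite ler_wpM2r.
  rewrite -exprMn => h.
  have := lerB_dist (F k.+1 (u_ (i k))) (L (u_ (i k))).
  rewrite distrC; move: Lt; rewrite exprS; lra.
have grow k : 1 + k%:R / 3 <= (4 / 3) ^+ k :> R.
  elim: k => [|k IH]; first by rewrite expr0 mul0r addr0.
  rewrite exprS -natr1; have : 0 <= k%:R :> R by []. lra.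
have [k] : exists k : nat, 6 * C < k%:R.
  exists (Num.bound `|6 * C|); apply: le_lt_trans (ler_norm _) _.
  exact: archi_boundP.
have := Lk k; have := grow k; lra.
Qed.
End uniform_boundedness.

(** * Pairing of L^p with its conjugate space *)

Section Lp_duality.
Context {d} {T : measurableType d} {R : realType}.
Variable mu : {measure set T -> \bar R}.
Implicit Types (f g : T -> R) (p q : R).

Lemma measurable_norm_powR f p : measurable_fun [set: T] f ->
  measurable_fun [set: T] (fun x => `|f x| `^ p).
Proof.
move=> mf; apply: (measurableT_comp (measurable_powR _)).
exact: measurableT_comp.
Qed.

Lemma LfunP_int p f : 0 < p -> f \in Lfun mu p%:E <->
  measurable_fun [set: T] f /\ (\int[mu]_x (`|f x| `^ p)%:E < +oo)%E.
Proof.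
move=> p0; have pV : p^-1 != 0 by rewrite invr_neq0// gt_eqF.
split=> [|[mf lf]].
  rewrite inE => /andP[/[!inE]/= mf lf]; split=> //; move: lf.
  by rewrite /finite_norm unlock => /(lty_poweRy pV).
by rewrite inE; apply/andP; split; rewrite inE//= /finite_norm unlock poweR_lty.
Qed.

Lemma Lfun_measurable p f : f \in Lfun mu p%:E -> measurable_fun [set: T] f.
Proof. by move=> Lf; exact/set_mem/(sub_Lfun_mfun Lf). Qed.

Lemma Lnorm_fin_num p f : f \in Lfun mu p%:E ->
  'N[mu]_p%:E[EFin \o f]%E \is a fin_num.
Proof.
by move=> Lf; rewrite ge0_fin_numE ?Lnorm_ge0//; exact/set_mem/(sub_Lfun_finLfun Lf).
Qed.

Lemma Lfun_lin p a f g : 1 <= p -> f \in Lfun mu p%:E -> g \in Lfun mu p%:E ->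
  (fun x => a * f x + g x) \in Lfun mu p%:E.
Proof.
move=> p1 Lf Lg.
by have [_ /(_ a f g Lf Lg)] := @Lfun_submod_closed _ _ _ mu p%:E p1.
Qed.

Lemma LfunB p f g : 1 <= p -> f \in Lfun mu p%:E -> g \in Lfun mu p%:E ->
  (fun x => f x - g x) \in Lfun mu p%:E.
Proof.
move=> p1 Lf Lg; rewrite (_ : (fun x => _) = (fun x => -1 * g x + f x)).
  exact: Lfun_lin.
by apply/funext => x; rewrite mulN1r addrC.
Qed.

Lemma Lfun_hoelder p q f g : 0 < p -> 0 < q -> p^-1 + q^-1 = 1 ->
  f \in Lfun mu p%:E -> g \in Lfun mu q%:E ->
  mu.-integrable setT (EFin \o (fun x => f x * g x)) /\
  (`|\int[mu]_x (f x * g x)|%:E <=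
   'N[mu]_p%:E[EFin \o f] * 'N[mu]_q%:E[EFin \o g])%E.
Proof.
move=> p0 q0 pq Lf Lg.
have mf := Lfun_measurable _ _ Lf; have mg := Lfun_measurable _ _ Lg.
have H := hoelder mu mf mg p0 q0 pq.
have I : mu.-integrable setT (EFin \o (fun x => f x * g x)).
  apply/integrableP; split; first exact/measurable_EFinP/measurable_funM.
  rewrite -[ltLHS]Lnorm1; apply: le_lt_trans H _.
  rewrite ltey_eq fin_numM// ?Lnorm_fin_num//.
split=> //; apply: le_trans H; rewrite Lnorm1 EFin_normr_Rintegral//.
by apply: le_abse_integral => //; have /integrableP[] := I.
Qed.

Lemma Lfun_pairing_dual p q g : 1 < p -> p^-1 + q^-1 = 1 -> 0 < q ->
  g \in Lfun mu q%:E ->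
  continuous_dual [set f | f \in Lfun mu p%:E]
    (fun f => 'N[mu]_p%:E[EFin \o f])%E (fun f => \int[mu]_x (f x * g x)).
Proof.
move=> p1 pq q0 Lg; have p0 : 0 < p by exact: lt_trans p1.
split.
  move=> a u v Lu Lv.
  have [Iu _] := Lfun_hoelder _ _ _ _ p0 q0 pq Lu Lg.
  have [Iv _] := Lfun_hoelder _ _ _ _ p0 q0 pq Lv Lg.
  under eq_Rintegral => x _ do rewrite mulrDl -mulrA.
  rewrite RintegralD//; last exact: (integrableZl measurableT a Iu).
  by rewrite RintegralZl.
exists (fine 'N[mu]_q%:E[EFin \o g])%E => u Lu.
rewrite fineK ?Lnorm_fin_num// muleC.
by have [] := Lfun_hoelder _ _ _ _ p0 q0 pq Lu Lg.
Qed.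

(** The extremal function of Hölder's inequality: with [n] the norm of [f], the function n^(1-p) f
    |f|^(p-2) has norm 1 in L^q and integrates against [f] to [n]. A function of norm 0 cannot be
    normalised and gets the zero functional. *)
Lemma Lnorm_norming p q f : 1 < p -> p^-1 + q^-1 = 1 -> 0 < q ->
  f \in Lfun mu p%:E ->
  exists2 G, continuous_dual [set f | f \in Lfun mu p%:E]
    (fun f => 'N[mu]_p%:E[EFin \o f])%E G &
  (forall u, u \in Lfun mu p%:E -> (`|G u|%:E <= 'N[mu]_p%:E[EFin \o u])%E) /\
  ((G f)%:E = 'N[mu]_p%:E[EFin \o f])%E.
Proof.
move=> p1 pq q0 Lf; have p0 : 0 < p by exact: lt_trans p1.
have mf := Lfun_measurable _ _ Lf.
have [f0|f0] := eqVneq 'N[mu]_p%:E[EFin \o f]%E 0%E.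
  exists (fun=> 0); first split.
  - by move=> *; rewrite mulr0 addr0.
  - by exists 0 => u _; rewrite normr0 mul0e.
  - by split=> [u _|]; rewrite ?normr0 ?Lnorm_ge0// f0.
set n := fine ('N[mu]_p%:E[EFin \o f])%E.
have nE : ('N[mu]_p%:E[EFin \o f] = n%:E)%E by rewrite fineK ?Lnorm_fin_num.
have n0 : 0 < n by rewrite -lte_fin -nE lt0e f0 Lnorm_ge0.
have int_np : (\int[mu]_x (`|f x| `^ p)%:E = (n `^ p)%:E)%E.
  by have := @powR_Lnorm _ _ _ mu (EFin \o f) p (lt0r_neq0 p0); rewrite nE => <-.
pose g x := n `^ (1 - p) * (f x * `|f x| `^ (p - 2)).
(* By this form of conjugacy the q-th power of |f|^(p-1) is |f|^p. *)
have q1 : (p - 1) * q = p.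
  have -> : q = (1 - p^-1)^-1 by rewrite -pq addrC addKr invrK.
  have p10 : p - 1 != 0 by rewrite subr_eq0 gt_eqF.
  by field; rewrite p10 lt0r_neq0.
have fpow b : 0 <= b -> b * b `^ (p - 2) = b `^ (p - 1).
  rewrite le_eqVlt => /predU1P[<-|b0].
    by rewrite mul0r powR0// subr_eq0 gt_eqF.
  rewrite -{1}(powRr1 (ltW b0)) -powRD; last by rewrite (gt_eqF b0) implybT.
  congr (_ `^ _); ring.
have mg : measurable_fun setT g.
  apply: measurable_funM => //; apply: measurable_funM => //.
  exact: measurable_norm_powR.
have gq : (\int[mu]_x (`|g x| `^ q)%:E = 1)%E.
  transitivity (\int[mu]_x ((n `^ (- p))%:E * (`|f x| `^ p)%:E))%E.
    apply: eq_integral => x _; rewrite -EFinM; congr (_%:E).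
    rewrite /g !normrM (ger0_norm (powR_ge0 _ _)).
    rewrite (ger0_norm (powR_ge0 `|f x| _)) fpow// powRM ?powR_ge0// -!powRrM q1.
    by rewrite -opprB mulNr q1.
  rewrite ge0_integralZl//=.
  - by rewrite int_np -EFinM -powRD ?addNr ?powRr0// (gt_eqF n0) implybT.
  - apply/measurable_EFinP.
    exact: measurable_norm_powR.
  - exact: powR_ge0.
have Lg : g \in Lfun mu q%:E.
  apply/(LfunP_int _ _ q0); split; first exact: mg.
  by rewrite gq ltry.
exists (fun u => \int[mu]_x (u x * g x)); first exact: (Lfun_pairing_dual p q g).
split=> [u Lu|].
  have [_ ] := Lfun_hoelder _ _ _ _ p0 q0 pq Lu Lg.
  have -> : 'N[mu]_q%:E[EFin \o g]%E = 1%E by rewrite unlock gq poweR1r.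
  by rewrite mule1.
rewrite nE; congr (_%:E).
transitivity (\int[mu]_x (n `^ (1 - p) * `|f x| `^ p)).
  apply: eq_Rintegral => x _; rewrite /g mulrCA; congr (_ * _).
  rewrite mulrA -expr2 -real_normK ?num_real// expr2 -mulrA fpow//.
  have [->|fx] := eqVneq `|f x| 0; first by rewrite mul0r powR0// gt_eqF.
  rewrite -{1}(powRr1 (normr_ge0 (f x))) -powRD; last by rewrite fx implybT.
  congr (_ `^ _); ring.
rewrite /Rintegral; under eq_integral do rewrite EFinM.
rewrite ge0_integralZl//=.
- rewrite int_np -EFinM/= -powRD; last by rewrite (gt_eqF n0) implybT.
  by rewrite subrK powRr1// ltW.
- apply/measurable_EFinP.
  exact: measurable_norm_powR.
- exact: powR_ge0.
Qed.

Lemma Lp_weak_bounded p q (u_ : nat -> T -> R) : 1 < p -> p^-1 + q^-1 = 1 -> 0 < q ->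
  (forall n, u_ n \in Lfun mu p%:E) ->
  (forall F, continuous_dual [set f | f \in Lfun mu p%:E]
    (fun f => 'N[mu]_p%:E[EFin \o f])%E F -> cvg (F (u_ n) @[n --> \oo])) ->
  exists C : R, forall n, ('N[mu]_p%:E[EFin \o u_ n] <= C%:E)%E.
Proof.
move=> p1 pq q0 Lu cF; apply: (weak_bounded_norm [set f | f \in Lfun mu p%:E]
  (fun f => 'N[mu]_p%:E[EFin \o f])%E u_ _ Lu).
- by move=> u; exact: Lnorm_fin_num.
- by move=> n; exact: (Lnorm_norming p q (u_ n)).
- move=> F /cF/cvg_seq_bounded[M [_ /(_ (M + 1))]].
  rewrite ltrDl ltr01 => /(_ isT) FM; exists (M + 1) => n; exact: FM.
Qed.

End Lp_duality.

(** The sum is at most twice the larger term. The constant is not sharp; it only has to depend on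
    [p] alone. *)
Lemma powRD_le {R : realType} (a b p : R) : 0 <= a -> 0 <= b -> 0 <= p ->
  (a + b) `^ p <= 2 `^ p * (a `^ p + b `^ p).
Proof.
move=> a0 b0 p0.
have H x y : 0 <= x -> x <= y -> (x + y) `^ p <= 2 `^ p * y `^ p.
  move=> x0 xy; have y0 := le_trans x0 xy; rewrite -powRM//.
  rewrite ge0_ler_powR ?nnegrE ?addr_ge0 ?mulr_ge0//.
  by rewrite mulr2n mulrDl mul1r lerD2r.
have [ab|/ltW ba] := leP a b.
  by rewrite (le_trans (H _ _ a0 ab))// ler_wpM2l ?powR_ge0// lerDr powR_ge0.
by rewrite addrC (le_trans (H _ _ b0 ba))// ler_wpM2l ?powR_ge0// lerDl powR_ge0.
Qed.

(** * Norms, cubes and measurability in R^N *)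

Section rV_geometry.
Context {R : realType} {N : nat}.
Local Notation X := ('rV[R]_N).
Implicit Types (x y : X) (r : R).

Lemma rV_norm_ltP x r : 0 < r ->
  reflect (forall i, `|x ord0 i| < r) (`|x| < r).
Proof.
move=> r0; apply: (iffP idP) => [xr i|xr].
  apply: le_lt_trans xr; rewrite [leRHS]mx_normrE.
  exact: (le_bigmax _ (fun ij => `|x ij.1 ij.2|) (ord0, i)).
rewrite [ltLHS]mx_normrE; apply/bigmax_ltP; split => // -[i j] _ /=.
by rewrite ord1.
Qed.

Lemma rV_normB_ltP x y r : 0 < r ->
  reflect (forall i, `|x ord0 i - y ord0 i| < r) (`|x - y| < r).
Proof.
move=> r0; apply: (iffP (rV_norm_ltP _ _ r0)) => H i; have := H i;
  by rewrite !mxE.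
Qed.

Lemma le_coord_norm x i : `|x ord0 i| <= `|x|.
Proof.
rewrite [leRHS]mx_normrE.
exact: (le_bigmax _ (fun ij => `|x ij.1 ij.2|) (ord0, i)).
Qed.

Lemma enorm_ge_norm x : `|x| <= enorm x.
Proof.
rewrite [leLHS]mx_normrE; apply/bigmax_leP; split.
  exact: sqrtr_ge0.
move=> [i j] _ /=; rewrite ord1 -sqrtr_sqr /enorm ler_wsqrtr//.
by rewrite (bigD1 j)//= lerDl sumr_ge0// => k _; rewrite sqr_ge0.
Qed.

Lemma enorm_le_norm x : enorm x <= N%:R * `|x|.
Proof.
rewrite -[leRHS]ger0_norm ?mulr_ge0// -sqrtr_sqr /enorm ler_wsqrtr//.
rewrite (@le_trans _ _ (\sum_(i < N) `|x| ^+ 2))//.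
  apply: ler_sum => i _; rewrite -real_normK ?num_real//.
  by rewrite lerXn2r ?nnegrE// le_coord_norm.
rewrite sumr_const card_ord -[leLHS]mulr_natl exprMn ler_wpM2r ?sqr_ge0//.
case: N => [|n]; first by rewrite expr0n.
by rewrite expr2 ler_peMl// ler1n.
Qed.

Lemma enormN x : enorm (- x) = enorm x.
Proof. by rewrite /enorm; congr Num.sqrt; apply: eq_bigr => i _; rewrite mxE sqrrN. Qed.

Definition cube x r : set X := [set y : X | `|x - y| < r].

Lemma lebesgue_rV_cube x r : 0 < r ->
  (lebesgue_rV N : {measure set X -> \bar R}) (cube x r) = ((2 * r) ^+ N)%:E.
Proof.
move=> r0.
have -> : cube x r = [set y | forall i, ball (x ord0 i) r (y ord0 i)].
  by apply/seteqP; split => y /(rV_normB_ltP _ _ _ r0).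
apply: etrans (@lebesgue_rV_box R N (fun i => ball (x ord0 i) r) _) _.
  by move=> i; exact: measurable_ball.
under eq_bigr do rewrite lebesgue_measure_ball ?ltW//.
by rewrite prodEFin prodr_const card_ord -[r *+ 2]mulr_natl.
Qed.

(** The sigma-algebra is generated by coordinates, not by open sets, so this needs second
    countability: an open set is the union of the balls with rational centre and radius 1/(k+1) that
    it contains. Balls of the max norm are boxes, hence measurable. *)
Lemma open_measurable_rV2 (U : set (X * X)) : open U -> measurable U.
Proof.
move=> oU; pose c (q : 'rV[rat]_N) : X := map_mx ratr q.
pose F (qk : 'rV[rat]_N * 'rV[rat]_N * nat) : set (X * X) :=
  ball (c qk.1.1, c qk.1.2) (qk.2.+1%:R^-1).
have bE (a : X) r : 0 < r -> ball a r = \bigcap_(i in [set: 'I_N])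
    ((fun v : X => v ord0 i) @^-1` ball (a ord0 i) r).
  move=> r0; apply/seteqP; split => y.
    rewrite (_ : ball a r = [set y | `|a - y| < r]) => [h i _|]; last by rewrite -ball_normE.
    rewrite /= -ball_normE; exact: (elimT (rV_normB_ltP a y r r0) h).
  move=> H; rewrite -ball_normE; apply: (introT (rV_normB_ltP a y r r0)) => i.
  by have := H i I; rewrite /= -ball_normE.
have mb (a : X) r : 0 < r -> measurable (ball a r).
  move=> r0; rewrite bE//; apply: fin_bigcap_measurable => // i _.
  rewrite -[X in measurable X]setTI.
  by apply: measurable_rV_coord => //; exact: measurable_ball.
have mF qk : measurable (F qk).
  rewrite (_ : F qk = ball (c qk.1.1) (qk.2.+1%:R^-1) `*` ball (c qk.1.2) (qk.2.+1%:R^-1)).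
    by apply: measurableX; exact: mb.
  by [].
have -> : U = \bigcup_qk (if `[< F qk `<=` U >] then F qk else set0).
  apply/seteqP; split => [z Uz|z [qk _]]; last by case: asboolP => // FU /FU.
  move: oU; rewrite openE => /(_ _ Uz) /nbhs_ballP[e /= e0 zeU].
  (* Half of [e], because a point of the rational ball reaches [z] through the centre, in two steps
     of one radius each. *)
  have [k ke] : exists k : nat, k.+1%:R^-1 < e / 2.
    exists (Num.truncn (e / 2)^-1); rewrite invf_plt ?posrE ?divr_gt0//.
    exact: truncnS_gt.
  have rk : 0 < k.+1%:R^-1 :> R by rewrite invr_gt0.
  have [q qz] : exists q : 'rV[rat]_N * 'rV[rat]_N,
      ball (c q.1, c q.2) (k.+1%:R^-1) z.
    have H (a : X) : exists q, `|c q - a| < k.+1%:R^-1.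
      have /choice[q qP] : forall i : 'I_N, exists q : rat, `|ratr q - a ord0 i| < k.+1%:R^-1.
        move=> i.
        have ak : a ord0 i - k.+1%:R^-1 < a ord0 i + k.+1%:R^-1.
          by rewrite ltrBlDr -addrA ltrDl addr_gt0.
        have [q] := rat_in_itvoo ak; rewrite in_itv/= => /andP[q1 q2]; exists q.
        by rewrite ltr_norml ltrBrDr ltrBlDr addrC q1 addrC.
      exists (\row_i q i); apply/(rV_normB_ltP _ _ _ rk) => i; rewrite !mxE; exact: qP.
    have [q1 h1] := H z.1; have [q2 h2] := H z.2.
    exists (q1, q2); split; rewrite -ball_normE/=; [exact: h1|exact: h2].
  exists (q, k) => //; case: asboolP => // -[]; apply: subset_trans zeU => w /= qw.
  apply: (@le_ball _ _ _ (k.+1%:R^-1 + k.+1%:R^-1)).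
    by rewrite (splitr e) lerD ?ltW.
  by apply: ball_triangle qw; apply: ball_sym.
apply: countable_bigcupT_measurable => [|qk]; first exact: countableP.
by case: asboolP.
Qed.

Lemma continuous_measurable_rV2 (f : X * X -> R) : continuous f ->
  measurable_fun setT f.
Proof.
move=> cf; apply: (measurability _ (RGenOpens.measurableE R)) => //.
move=> _ [_ [a [b ->] <-]]; rewrite setTI.
apply: open_measurable_rV2; exact: open_comp.
Qed.

(** Obtained from the case of pairs: [f] after the first projection is measurable there, and [f] is
    recovered by composing with the diagonal map. *)
Lemma continuous_measurable_rV (f : X -> R) : continuous f ->
  measurable_fun setT f.
Proof.
move=> cf.
have : measurable_fun setT (f \o (fst : X * X -> X)).
  apply: continuous_measurable_rV2 => z.
  by apply: continuous_comp; [exact: cvg_fst|exact: cf].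
move=> mf; apply: (@measurableT_comp _ _ _ _ _ _ _ _ (fun x : X => (x, x)) mf).
by apply/measurable_fun_pairP; split; exact: measurable_id.
Qed.

End rV_geometry.

(** * The truncated singular kernel *)

Lemma nneseries_geometric_le {R : realType} (c r : R) : 0 <= c -> 0 <= r < 1 ->
  (\sum_(0 <= k <oo) (c * r ^+ k)%:E <= (c / (1 - r))%:E)%E.
Proof.
move=> c0 /andP[r0 r1]; have r10 : 0 < 1 - r by rewrite subr_gt0.
apply: lime_le.
  by apply: is_cvg_nneseries => k _ _; rewrite lee_fin mulr_ge0// exprn_ge0.
apply: nearW => n; rewrite sumEFin lee_fin -mulr_sumr ler_wpM2l//.
rewrite -[leRHS]mul1r ler_pdivlMr// big_mkord mulrC -opprB mulNr -subrX1.
by rewrite opprB gerBl exprn_ge0.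
Qed.

(** The integer powers of 2 are split into two families indexed by [nat], for [1 <= a] and for
    [a < 1]; the exponent [k.+1] in the second avoids counting 1 twice. *)
Lemma dyadic_scale {R : realType} (a : R) : 0 < a ->
  exists k c, (c = 2 ^+ k \/ c = 2^-1 ^+ k.+1) /\ c <= a < 2 * c.
Proof.
move=> a0.
have big (b : R) : exists k : nat, b < 2 ^+ k.+1.
  exists (Num.truncn b); apply: lt_le_trans (truncnS_gt b) _.
  by rewrite -natrX ler_nat ltnW// ltn_expl.
have [a1|a1] := leP 1 a.
  have [k ak kmin] := ex_minnP (big a).
  exists k, (2 ^+ k); split; [by left|rewrite -exprS ak andbT].
  case: k ak kmin => [//|k] _ kmin.
  by rewrite leNgt; apply/negP => /kmin; rewrite ltnn.
have : exists k, 2^-1 ^+ k.+1 <= a.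
  have [k ak] := big a^-1; exists k.
  by rewrite exprVn invf_ple ?posrE ?exprn_gt0// ltW.
move=> ex; have [k ak kmin] := ex_minnP ex.
exists k, (2^-1 ^+ k.+1); split; [by right|].
rewrite ak/= exprS mulrA divff// mul1r.
case: k ak kmin => [//|k] _ kmin.
by rewrite ltNge; apply/negP => /kmin; rewrite ltnn.
Qed.

Lemma powRX {R : realType} (a r : R) k : 0 <= a -> (a ^+ k) `^ r = (a `^ r) ^+ k.
Proof.
move=> a0; rewrite -(powR_mulrn k a0) -powRrM mulrC powRrM.
by rewrite powR_mulrn// powR_ge0.
Qed.

Section truncated_kernel.
Context {R : realType} {N : nat}.
Local Notation X := ('rV[R]_N).
Variables (s p : R).
Hypotheses (s0 : 0 < s) (s1 : s < 1) (p1 : 1 < p).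

(** The common majorant of all kernels below. At [h = 1] it comes from the modulus of continuity of
    the test function, at scale [h] from the Lipschitz constant 1/h of the partition of unity. The
    max norm in the numerator is dominated by the Euclidean norm in the denominator. *)
Definition trunc_kernel h (z : X * X) : R :=
  (Num.min 1 (`|z.1 - z.2| / h)) `^ p / enorm (z.1 - z.2) `^ (N%:R + s * p).

Let p0 : 0 < p. Proof. exact: lt_trans p1. Qed.
Let D := N%:R + s * p.
Let D0 : 0 < D. Proof. by rewrite ltr_wpDl// mulr_gt0. Qed.

Lemma trunc_kernel_ge0 h z : 0 <= trunc_kernel h z.
Proof. by rewrite mulr_ge0 ?invr_ge0 ?powR_ge0. Qed.

Lemma trunc_kernelC h x y : trunc_kernel h (x, y) = trunc_kernel h (y, x).
Proof. by rewrite /trunc_kernel/= -[x - y]opprB normrN enormN. Qed.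

Lemma measurable_rV_dist : measurable_fun setT (fun z : X * X => `|z.1 - z.2|).
Proof.
apply: continuous_measurable_rV2 => z; apply: cvg_norm.
by apply: cvgB; [exact: cvg_fst|exact: cvg_snd].
Qed.

Lemma measurable_trunc_kernel h : measurable_fun setT (trunc_kernel h).
Proof.
apply: measurable_funM.
  apply: (measurableT_comp (measurable_powR _)).
  apply: measurable_minr; first exact: measurable_cst.
  by apply: measurable_funM => //; exact: measurable_rV_dist.
under eq_fun do rewrite -powRN.
exact: (measurableT_comp (measurable_powR _) measurable_enormB).
Qed.

(* Dominates the kernel on the shell [c h <= |x - y| < 2 c h]; its integral is
   geometric in dyadic [c], on either side of [c = 1]. *)
Let shell (h c : R) (x y : X) : R :=
  Num.min 1 (2 * c) `^ p * (c * h) `^ (- D) * \1_(cube x (2 * c * h)) y.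

Let trunc_kernel_shell h c x y : 0 < h -> 0 < c ->
  c * h <= `|x - y| < 2 * c * h -> trunc_kernel h (x, y) <= shell h c x y.
Proof.
move=> h0 c0 /andP[cxy xyc]; rewrite /shell indicE mem_set// mulr1.
rewrite /trunc_kernel/= -powRN; apply: ler_pM; rewrite ?powR_ge0//.
  apply: (ge0_ler_powR (ltW p0)); rewrite ?nnegrE.
  - by rewrite le_min ler01 divr_ge0// ltW.
  - by rewrite le_min ler01 mulr_ge0// ltW.
  - rewrite le_min ge_min lexx/= ge_min; apply/orP; right.
    by rewrite ler_pdivrMr// ltW.
have e0 : 0 < enorm (x - y).
  apply: lt_le_trans (enorm_ge_norm _); apply: lt_le_trans cxy; exact: mulr_gt0.
rewrite !powRN lef_pV2 ?posrE ?powR_gt0 ?mulr_gt0//.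
apply: (ge0_ler_powR (ltW D0)); rewrite ?nnegrE ?mulr_ge0 ?(ltW e0) ?(ltW c0) ?(ltW h0)//.
exact: le_trans cxy (enorm_ge_norm _).
Qed.

Lemma measurable_cube (x : X) r : measurable (cube x r).
Proof.
have := measurableT_comp measurable_rV_dist (pair1_measurable x).
move=> /(_ measurableT `]-oo, r[%classic (measurable_itv _)).
by rewrite setTI preimage_itvNyo; congr measurable; apply/seteqP; split => y.
Qed.

Let shell_ge0 h c x y : 0 <= shell h c x y.
Proof. by rewrite /shell !mulr_ge0 ?powR_ge0. Qed.

Let measurable_shell h c x : measurable_fun setT (EFin \o shell h c x).
Proof.
apply/measurable_EFinP; apply: measurable_funM => //.
by apply: measurable_indic; exact: measurable_cube.
Qed.

Let integral_shell h c x : 0 < h -> 0 < c ->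
  (\int[lebesgue_rV N]_y (shell h c x y)%:E =
   (4 ^+ N * h `^ (- (s * p)) * (Num.min 1 (2 * c) `^ p * c `^ (- (s * p))))%:E)%E.
Proof.
move=> h0 c0; rewrite /shell; under eq_integral do rewrite EFinM.
rewrite ge0_integralZl//; first last.
- by rewrite lee_fin mulr_ge0// powR_ge0.
- by apply/measurable_EFinP; apply: measurable_indic; exact: measurable_cube.
rewrite integral_indic//; last exact: measurable_cube.
rewrite setIT lebesgue_rV_cube ?mulr_gt0// -EFinM; congr (_%:E).
have pow (a : R) : 0 < a -> a `^ (- D) * a ^+ N = a `^ (- (s * p)).
  move=> a0; rewrite -powR_mulrn ?ltW// -powRD; last by rewrite (gt_eqF a0) implybT.
  by congr (_ `^ _); rewrite /D; ring.
rewrite -(pow h)// -(pow c)// powRM ?ltW//.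
rewrite (_ : 2 * (2 * c * h) = 4 * c * h); last by ring.
rewrite !exprMn; ring.
Qed.

(** Dyadic shells on both sides of |x - y| = h give two geometric series. The outer ratio 2^-(sp) is
    below 1 because s > 0, the inner ratio 2^-(p - sp) because s < 1. Scaling leaves exactly
    h^-(sp), since the volume h^N of a shell cancels the N in the exponent of the kernel. *)
Lemma integral_trunc_kernel : exists M : R, 0 < M /\ forall h x, 0 < h ->
  (\int[lebesgue_rV N]_y (trunc_kernel h (x, y))%:E <= (M * h `^ (- (s * p)))%:E)%E.
Proof.
pose r1 : R := 2 `^ (- (s * p)); pose r2 : R := 2^-1 `^ (p - s * p).
have sp0 : 0 < s * p by rewrite mulr_gt0.
have psp : 0 < p - s * p by rewrite subr_gt0 gtr_pMl.
have r10 : 0 <= r1 < 1.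
  rewrite powR_ge0/= /r1 powRN invf_lt1 ?powR_gt0//.
  by have := @gt0_ltr_powR R _ sp0 1 2; rewrite powR1; apply; rewrite ?nnegrE// ltr1n.
have r20 : 0 <= r2 < 1.
  rewrite powR_ge0/=.
  by have := @gt0_ltr_powR R _ psp 2^-1 1; rewrite powR1; apply; rewrite ?nnegrE// invf_lt1// ltr1n.
pose A : R := 4 ^+ N * 2^-1 `^ (- (s * p)).
exists (4 ^+ N / (1 - r1) + A / (1 - r2)).
split.
  rewrite addr_gt0// divr_gt0 ?mulr_gt0 ?exprn_gt0 ?powR_gt0// subr_gt0.
    by case/andP: r10.
  by case/andP: r20.
move=> h x h0; pose H := h `^ (- (s * p)).
pose c1 k : R := 2 ^+ k; pose c2 k : R := 2^-1 ^+ k.+1.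
have c10 k : 0 < c1 k by rewrite exprn_gt0.
have c20 k : 0 < c2 k by rewrite exprn_gt0.
(* One outer and one inner shell share the index [k], so that a single series over [nat] covers all
   distances. *)
pose t k y : \bar R := (EFin \o shell h (c1 k) x) y + (EFin \o shell h (c2 k) x) y.
have t0 k y : (0 <= t k y)%E by rewrite /t/= -EFinD lee_fin addr_ge0 ?shell_ge0.
have mt k : measurable_fun setT (t k) by apply: emeasurable_funD; exact: measurable_shell.
have wt y : ((trunc_kernel h (x, y))%:E <= \sum_(0 <= k <oo) t k y)%E.
  (* No shell contains the diagonal; there the kernel is 0, its numerator being the p-th power of
     0. *)
  have [xy|xy0] := eqVneq `|x - y| 0.
    rewrite {1}/trunc_kernel/= xy mul0r min_r// powR0 ?gt_eqF// mul0r.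
    exact: nneseries_ge0.
  have xy : 0 < `|x - y| / h by rewrite divr_gt0// lt0r xy0/=.
  have [k [c [cE]]] := dyadic_scale _ xy.
  rewrite ler_pdivlMr// ltr_pdivrMr// => ck.
  have c0 : 0 < c by case: cE => ->; rewrite exprn_gt0.
  apply: (@le_trans _ _ (t k y)).
    have sh := trunc_kernel_shell _ _ _ _ h0 c0 ck.
    rewrite /t/= -EFinD lee_fin; apply: le_trans sh _.
    by case: cE => ->; rewrite ?lerDl ?lerDr shell_ge0.
  rewrite (@nneseriesD1 _ _ k)// leeDl// nneseries_ge0//.
have It k : (\int[lebesgue_rV N]_y t k y = (4 ^+ N * H * r1 ^+ k)%:E + (A * H * r2 ^+ k)%:E)%E.
  rewrite ge0_integralD//; try by [move=> y _; rewrite lee_fin shell_ge0|exact: measurable_shell].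
  rewrite !integral_shell//; congr ((_%:E) + (_%:E))%E.
    congr (_ * _).
    rewrite min_l ?powR1 ?mul1r; last by rewrite -exprS exprn_ege1// ler1n.
    by rewrite /c1 /r1 powRX.
  have c2E : 2 * c2 k = 2^-1 ^+ k by rewrite /c2 exprS mulrA divff// mul1r.
  rewrite c2E min_r; last by rewrite exprn_ile1// invf_le1// ler1n.
  rewrite /c2 exprS powRM ?exprn_ge0// /r2 /A.
  have -> : (2^-1 `^ (p - s * p)) ^+ k =
      (2^-1 ^+ k) `^ p * (2^-1 ^+ k) `^ (- (s * p)) :> R.
    rewrite -powRD; last by rewrite expf_eq0 invr_eq0 pnatr_eq0 andbF implybT.
    by rewrite powRX.
  rewrite /H; ring.
apply: (@le_trans _ _ (\int[lebesgue_rV N]_y (\sum_(0 <= k <oo) t k y))%E).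
  apply: ge0_le_integral => //.
  - by move=> y _; rewrite lee_fin trunc_kernel_ge0.
  - apply/measurable_EFinP.
    exact: (measurableT_comp (measurable_trunc_kernel h) (pair1_measurable x)).
  - exact: ge0_emeasurable_sum.
rewrite integral_nneseries//.
under eq_eseriesr do rewrite It.
have H0 : 0 <= H by exact: powR_ge0.
have A0 : 0 <= A by rewrite mulr_ge0 ?exprn_ge0 ?powR_ge0.
rewrite nneseriesD; last 2 first.
- by move=> k _ _; rewrite lee_fin !mulr_ge0 ?exprn_ge0//; case/andP: r10.
- by move=> k _ _; rewrite lee_fin !mulr_ge0 ?exprn_ge0//; case/andP: r20.
rewrite mulrDl EFinD; apply: leeD.
- rewrite [X in (_ <= X%:E)%E]mulrAC.
  by apply: nneseries_geometric_le; rewrite ?mulr_ge0 ?exprn_ge0.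
- by rewrite [X in (_ <= X%:E)%E]mulrAC; apply: nneseries_geometric_le; rewrite ?mulr_ge0.
Qed.

Let measurable_EFin_trunc_kernel h : measurable_fun setT (fun z => (trunc_kernel h z)%:E).
Proof. by apply/measurable_EFinP; exact: measurable_trunc_kernel. Qed.

(** A Schur-type bound: by Tonelli the inner integral is that of the kernel alone, bounded uniformly
    in the other variable. Symmetry of the kernel treats [f z.2] like [f z.1], whence the factor
    2. *)
Lemma integral2_trunc_kernel : exists M : R, 0 < M /\ forall h (f : X -> \bar R),
  0 < h -> measurable_fun setT f -> (forall x, 0 <= f x)%E ->
  (\int[lebesgue_rV2 N]_z ((trunc_kernel h z)%:E * (f z.1 + f z.2)) <=
   (M * h `^ (- (s * p)))%:E * \int[lebesgue_rV N]_x f x)%E.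
Proof.
have [M [M0 MP]] := integral_trunc_kernel.
exists (2 * M); split; first exact: mulr_gt0.
move=> h f h0 mf f0.
have mf1 : measurable_fun setT (fun z : X * X => (trunc_kernel h z)%:E * f z.1)%E.
  by apply: emeasurable_funM => //; exact: measurableT_comp.
have mf2 : measurable_fun setT (fun z : X * X => (trunc_kernel h z)%:E * f z.2)%E.
  by apply: emeasurable_funM => //; exact: measurableT_comp.
have k0 z := trunc_kernel_ge0 h z.
under eq_integral => z _ do rewrite ge0_muleDr//.
rewrite ge0_integralD//; last 2 first.
- by move=> z _; rewrite mule_ge0// lee_fin.
- by move=> z _; rewrite mule_ge0// lee_fin.
have step : (\int[lebesgue_rV N]_x \int[lebesgue_rV N]_y
     ((trunc_kernel h (x, y))%:E * f x) <=
    (M * h `^ (- (s * p)))%:E * \int[lebesgue_rV N]_x f x)%E.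
  rewrite -ge0_integralZl//; last by rewrite lee_fin mulr_ge0 ?powR_ge0 ?ltW.
  apply: ge0_le_integral => //.
  - by move=> x _; apply: integral_ge0 => y _; rewrite mule_ge0// lee_fin.
  - apply: (@measurable_fun_fubini_tonelli_F _ _ _ _ _ (lebesgue_rV N) _ mf1) => z.
    by rewrite mule_ge0// lee_fin.
  - by apply: emeasurable_funM.
  move=> x _; under eq_integral do rewrite muleC.
  rewrite ge0_integralZl//.
  - by rewrite muleC; apply: lee_wpmul2r => //; exact: MP.
  - apply/measurable_EFinP.
    exact: (measurableT_comp (measurable_trunc_kernel h) (pair1_measurable x)).
  - by move=> y _; rewrite lee_fin.
rewrite (_ : 2 * M * _ = M * h `^ (- (s * p)) + M * h `^ (- (s * p))); last by ring.
have Mh0 : (0 <= (M * h `^ (- (s * p)))%:E)%E by rewrite lee_fin mulr_ge0 ?powR_ge0 ?ltW.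
rewrite EFinD ge0_muleDl//; apply: leeD.
- have f10 z : (0 <= (trunc_kernel h z)%:E * f z.1)%E by rewrite mule_ge0// lee_fin.
  rewrite (fubini_tonelli1 _ mf1 f10); exact: step.
- have f20 z : (0 <= (trunc_kernel h z)%:E * f z.2)%E by rewrite mule_ge0// lee_fin.
  rewrite (fubini_tonelli2 _ mf2 f20).
  apply: le_trans step; rewrite le_eqVlt; apply/orP; left; apply/eqP.
  by apply: eq_integral => y _; apply: eq_integral => x _; rewrite trunc_kernelC.
Qed.

End truncated_kernel.

(** * Calculus of functions of class C^k *)

Section Ck_calculus.
Context {R : realType} {V : normedModType R}.
Implicit Types (f g : V -> R) (k : nat).

Lemma Ck_continuous k f : Ck k f -> continuous f.
Proof. by case: k => [|k] []. Qed.

Lemma Ck_pred k f : Ck k.+1 f -> Ck k f.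
Proof.
elim: k f => [|k IH] f; first by case.
by move=> [cf Df]; split=> // v; have [dfv /IH] := Df v.
Qed.

Lemma Ck_cst k (c : R) : Ck k (fun _ : V => c).
Proof.
elim: k c => [|k IH] c.
  by split=> // x; exact: cvg_cst.
split=> [x|v]; first exact: cvg_cst.
split=> [x|]; first exact: derivable_cst.
have -> : (fun x => 'D_v (fun _ : V => c) x) = (fun=> 0).
  by apply/funext => x; exact: derive_cst.
exact: IH.
Qed.

Lemma CkD k f g : Ck k f -> Ck k g -> Ck k (fun x => f x + g x).
Proof.
elim: k f g => [|k IH] f g [cf Df] [cg Dg].
  by split=> // x; apply: cvgD; [exact: cf|exact: cg].
split=> [x|v]; first by apply: cvgD; [exact: cf|exact: cg].
have [df Cf] := Df v; have [dg Cg] := Dg v; split=> [x|].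
  exact: derivableD.
have -> : (fun x => 'D_v (fun x => f x + g x) x) = (fun x => 'D_v f x + 'D_v g x).
  by apply/funext => x; exact: deriveD.
exact: IH.
Qed.

Lemma CkM k f g : Ck k f -> Ck k g -> Ck k (fun x => f x * g x).
Proof.
elim: k f g => [|k IH] f g Cf Cg.
  have [cf _] := Cf; have [cg _] := Cg.
  by split=> // x; apply: cvgM; [exact: cf|exact: cg].
have [cf Df] := Cf; have [cg Dg] := Cg.
split=> [x|v]; first by apply: cvgM; [exact: cf|exact: cg].
have [df Cfv] := Df v; have [dg Cgv] := Dg v; split=> [x|].
  exact: derivableM.
have -> : (fun x => 'D_v (fun x => f x * g x) x) =
    (fun x => f x * 'D_v g x + g x * 'D_v f x).
  by apply/funext => x; exact: deriveM.
by apply: CkD; apply: IH => //; exact: Ck_pred.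
Qed.

Lemma CkZ k (c : R) f : Ck k f -> Ck k (fun x => c * f x).
Proof. by move=> Cf; apply: CkM => //; exact: Ck_cst. Qed.

Lemma CkB k f g : Ck k f -> Ck k g -> Ck k (fun x => f x - g x).
Proof.
move=> Cf Cg; rewrite (_ : (fun x => _) = (fun x => f x + (-1) * g x)).
  by apply: CkD => //; exact: CkZ.
by apply/funext => x; rewrite mulN1r.
Qed.

Lemma Ck_sum k (I : Type) (r : seq I) (F : I -> V -> R) :
  (forall i, Ck k (F i)) -> Ck k (fun x => \sum_(i <- r) F i x).
Proof.
move=> CF; elim: r => [|i r IH].
  by under eq_fun do rewrite big_nil; exact: Ck_cst.
by under eq_fun do rewrite big_cons; exact: CkD.
Qed.

Lemma Ck_prod k (I : Type) (r : seq I) (F : I -> V -> R) :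
  (forall i, Ck k (F i)) -> Ck k (fun x => \prod_(i <- r) F i x).
Proof.
move=> CF; elim: r => [|i r IH].
  by under eq_fun do rewrite big_nil; exact: Ck_cst.
by under eq_fun do rewrite big_cons; exact: CkM.
Qed.

(** The derivative of 1/f is -(1/f)(1/f) D f, a product of functions one order lower; hence the
    induction is on the statement for 1/f with [f] fixed. *)
Lemma CkV k f : (forall x, f x != 0) -> Ck k f -> Ck k (fun x => (f x)^-1).
Proof.
move=> f0; elim: k => [|k IH] Cf.
  by have [cf _] := Cf; split=> // x; apply: cvgV => //; exact: cf.
have [cf Df] := Cf; split=> [x|v]; first by apply: cvgV => //; exact: cf.
have [df Cfv] := Df v; split=> [x|]; first exact: derivableV.
have CV : Ck k (fun x => (f x)^-1) by apply: IH; exact: Ck_pred.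
have -> : (fun x => 'D_v (fun x => (f x)^-1) x) =
    (fun x => -1 * ((f x)^-1 * (f x)^-1 * 'D_v f x)).
  apply/funext => x; rewrite (deriveV (f0 x) (df x)) mulN1r -mulNr.
  by congr (_ * _); rewrite -expr2 exprVn.
by apply: CkZ; apply: CkM => //; exact: CkM.
Qed.

End Ck_calculus.

(** For an affine [L] with linear part [L0] the difference quotients of the composite coincide with
    those of [f] in direction [L0 v], so no chain rule or differentiability is involved and the
    statement iterates. *)
Lemma Ck_comp_affine {R : realType} {V W : normedModType R} k (f : W -> R)
    (L L0 : V -> W) : continuous L ->
  (forall (h : R) v x, L (h *: v + x) = h *: L0 v + L x) ->
  Ck k f -> Ck k (fun x => f (L x)).
Proof.
move=> cL LE; elim: k f => [|k IH] f [cf Df].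
  by split=> // x; apply: continuous_comp; [exact: cL|exact: cf].
split=> [x|v]; first by apply: continuous_comp; [exact: cL|exact: cf].
have sh x : (fun h : R => h^-1 *: (((fun x => f (L x)) \o shift x) (h *: v) - f (L x))) =
   (fun h : R => h^-1 *: ((f \o shift (L x)) (h *: L0 v) - f (L x))).
  by apply/funext => h /=; rewrite LE.
have [df Cf] := Df (L0 v); split=> [x|].
  by have := df (L x); rewrite /derivable sh.
have -> : (fun x => 'D_v (fun x => f (L x)) x) = (fun x => 'D_(L0 v) f (L x)).
  by apply/funext => x; rewrite /derive sh.
exact: (IH (fun y => 'D_(L0 v) f y)).
Qed.

(** * A smooth step on the line *)

Section smooth_step.
Context {R : realType}.
Implicit Types (x : R) (k n : nat).

(** [Ck] quantifies over all directions, even on the line; this reduces them to the direction 1. *)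
Lemma derivable1_all (f : R -> R) x v : derivable f x 1 ->
  derivable f x v /\ 'D_v f x = v * 'D_1 f x.
Proof.
move=> /derivable1_diffP df; split; first exact: diff_derivable.
by rewrite !deriveE// -[X in 'd f x X](mulr1 v) -[v * 1]/(v *: 1) linearZ.
Qed.

(* [flat 0] is smooth and supported in the half-line; the derivatives of each
   [flat k] stay in the span of the family. *)
Definition flat k x : R := if 0 < x then x^-1 ^+ k * expR (- x^-1) else 0.

(** From exp(y) >= y^(k+1) / (k+1)! at y = 1/x: one power more than needed to compensate
    [x^-1 ^+ k], so that a factor [x] is left and the function tends to 0 at the origin. *)
Lemma flat_bound k x : `|flat k x| <= k.+1`!%:R * `|x|.
Proof.
rewrite /flat; case: ifPn => [x0|_]; last by rewrite normr0 mulr_ge0.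
have x10 : 0 < x^-1 by rewrite invr_gt0.
rewrite ger0_norm ?mulr_ge0 ?exprn_ge0 ?expR_ge0 ?(ltW x10)// (gtr0_norm x0).
rewrite expRN ler_pdivrMr ?expR_gt0//.
have := expR_ge1Dxn k (ltW x10).
have F0 : 0 < (k.+1`!)%:R :> R by rewrite ltr0n fact_gt0.
move=> h; have {}h : x^-1 ^+ k.+1 / (k.+1`!)%:R <= expR x^-1.
  by apply: le_trans h; rewrite lerDr.
have : k.+1`!%:R * x * (x^-1 ^+ k.+1 / k.+1`!%:R) <= k.+1`!%:R * x * expR x^-1.
  by rewrite ler_wpM2l ?mulr_ge0// ltW.
apply: le_trans; rewrite le_eqVlt; apply/orP; left; apply/eqP.
rewrite exprS; field; rewrite lt0r_neq0//= lt0r_neq0//.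
Qed.

Lemma is_derive_flat k x :
  is_derive x 1 (flat k) (flat k.+2 x - k%:R * flat k.+1 x).
Proof.
have [x0|x0|<-] := ltgtP 0 x.
- apply: (@near_eq_is_derive _ _ _ (fun x => x^-1 ^+ k * expR (- x^-1))).
    near=> y; rewrite /flat ifT//.
    near: y; exact: lt_nbhsr.
  have xn0 : x != 0 by rewrite gt_eqF.
  have dV : is_derive x 1 (fun y : R => y^-1) (- x ^- 2).
    rewrite -[- _](mulr1 (- x ^- 2)).
    exact: (@is_deriveV R id x 1 1 xn0).
  have dk : is_derive x 1 (fun y : R => y^-1 ^+ k) (k%:R * x^-1 ^+ k.-1 * - x ^- 2).
    rewrite (_ : (fun y : R => y^-1 ^+ k) = (fun y : R => y^-1) ^+ k).
      exact: (@is_deriveX _ _ (fun y : R => y^-1) k x 1 _ dV).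
    by rewrite exprfctE.
  have de : is_derive x 1 (fun y : R => expR (- y^-1)) (expR (- x^-1) * x ^- 2).
    have dN : is_derive x 1 (fun y : R => - y^-1) (x ^- 2).
      rewrite -[x ^- 2]opprK; exact: is_deriveN.
    exact: (is_derive1_comp _ dN).
  have dm := is_deriveM dk de.
  apply: is_derive_eq dm _.
  rewrite /flat x0 -[_ *: _]/(_ * _) -[X in _ + X]/(_ * _).
  case: k {dk} => [|k]; rewrite ?exprS/=; field => //.
- have fx n : flat n x = 0 by rewrite /flat ltNge (ltW x0).
  rewrite !fx mulr0 subr0.
  apply: (@near_eq_is_derive _ _ _ (cst 0)).
  near=> y; rewrite /flat ltNge ifF// ; apply/negbF; apply: ltW.
  near: y; exact: lt_nbhsl.
- have f0 n : flat n 0 = 0 by rewrite /flat ltxx.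
  rewrite !f0 mulr0 subr0.
  have : (fun h : R => h^-1 *: ((flat k \o shift 0) (h *: 1) - flat k 0)) @ 0^' --> (0 : R).
    apply/cvgr0Pnorm_lt => e e0.
    have F0 : 0 < (k.+2`!)%:R :> R by rewrite ltr0n fact_gt0.
    near=> h.
    have h0 : h != 0 by near: h; exact: nbhs_dnbhs_neq.
    rewrite f0 subr0/= addr0 -[h *: 1]/(h * 1) mulr1 -[_ *: _]/(_ * _).
    (* At the origin the difference quotient is again a member of the family; for negative [h] both
       sides are 0. *)
    have -> : h^-1 * flat k h = flat k.+1 h.
      by rewrite /flat; case: ifPn; rewrite ?mulr0// exprS mulrA.
    apply: le_lt_trans (flat_bound _ _) _.
    rewrite mulrC -ltr_pdivlMr//; near: h.
    by apply: dnbhs0_lt; rewrite divr_gt0.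
  move=> c0; apply: DeriveDef; first by apply/cvg_ex; exists 0.
  exact: cvg_lim c0.
Unshelve. all: by end_near. Qed.

Lemma Ck_flat n k : Ck n (flat k).
Proof.
have D k' x := derivable1_all _ x _ (@ex_derive _ _ _ _ _ _ _ (is_derive_flat k' x)).
have c k' : continuous (flat k').
  move=> x; apply/differentiable_continuous/derivable1_diffP.
  exact: (@ex_derive _ _ _ _ _ _ _ (is_derive_flat k' x)).
elim: n k => [|n IH] k; first by split.
split=> // v; split=> [x|]; first by have [] := D v k x.
have -> : (fun x => 'D_v (flat k) x) =
    (fun x => v * (flat k.+2 x - k%:R * flat k.+1 x)).
  apply/funext => x; have [_ ->] := D v k x; congr (_ * _).
  exact: (@derive_val _ _ _ _ _ _ _ (is_derive_flat k x)).
by apply: CkZ; apply: CkB => //; exact: CkZ.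
Qed.

Lemma flat0_ge0 x : 0 <= flat 0 x.
Proof. by rewrite /flat; case: ifP => // _; rewrite expr0 mul1r expR_ge0. Qed.

Lemma flat0_gt0 x : 0 < x -> 0 < flat 0 x.
Proof. by move=> x0; rewrite /flat x0 expr0 mul1r expR_gt0. Qed.

Lemma flat0_le0 x : x <= 0 -> flat 0 x = 0.
Proof. by move=> x0; rewrite /flat ltNge x0. Qed.

(** The denominator never vanishes, since [x] and [1 - x] are not both nonpositive. *)
Definition smooth_step x : R := flat 0 x / (flat 0 x + flat 0 (1 - x)).

Let denom_gt0 x : 0 < flat 0 x + flat 0 (1 - x).
Proof.
have [x0|x0] := ltP 0 x.
  by rewrite ltr_pwDl ?flat0_gt0 ?flat0_ge0.
by rewrite ltr_wpDl ?flat0_gt0 ?flat0_ge0// subr_gt0 (le_lt_trans x0).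
Qed.

Lemma Ck_smooth_step n : Ck n smooth_step.
Proof.
apply: CkM; first exact: Ck_flat.
apply: CkV => [x|]; first by rewrite gt_eqF.
apply: CkD; first exact: Ck_flat.
apply: (Ck_comp_affine _ (flat 0) (fun x => 1 - x) (fun v => - v)); last exact: Ck_flat.
  by move=> x; apply: cvgB; [exact: cvg_cst|exact: cvg_id].
move=> h v x; rewrite scalerN opprD; ring.
Qed.

Lemma smooth_step_le0 x : x <= 0 -> smooth_step x = 0.
Proof. by move=> x0; rewrite /smooth_step flat0_le0// mul0r. Qed.

Lemma smooth_step_ge1 x : 1 <= x -> smooth_step x = 1.
Proof.
move=> x1; rewrite /smooth_step (flat0_le0 (1 - x)) ?subr_le0// addr0 divff//.
by rewrite gt_eqF// flat0_gt0// (lt_le_trans ltr01).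
Qed.

Lemma smooth_step_itv x : 0 <= smooth_step x <= 1.
Proof.
rewrite divr_ge0 ?flat0_ge0 ?(ltW (denom_gt0 x))//=.
by rewrite ler_pdivrMr// mul1r lerDl flat0_ge0.
Qed.

End smooth_step.

(** * Quantitative bounds on test functions *)

Section test_function_bounds.
Context {R : realType} {V : normedModType R}.
Implicit Types (f g : V -> R) (Omega : set V).

Lemma lipschitz_line f (w : V) (C : R) : (forall x, derivable f x w) ->
  (forall x, `|'D_w f x| <= C) ->
  forall a t, `|f (t *: w + a) - f a| <= C * `|t|.
Proof.
move=> df Cf a t; pose h (r : R) := f (r *: w + a).
have dh r : is_derive r (1 : R) h ('D_w f (r *: w + a)).
  have E : (fun e : R => e^-1 *: ((h \o shift r) (e *: (1 : R)) - h r)) =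
      (fun e : R => e^-1 *: ((f \o shift (r *: w + a)) (e *: w) - f (r *: w + a))).
    apply/funext => e; rewrite /h/= -[e *: (1 : R)]/(e * 1) mulr1.
    by rewrite scalerDl addrA.
  apply: DeriveDef; last by rewrite /derive E.
  by have := df (r *: w + a); rewrite /derivable E.
have ch : continuous h.
  move=> r; apply/differentiable_continuous/derivable1_diffP.
  exact: (@ex_derive _ _ _ _ _ _ _ (dh r)).
have MV b c : b <= c -> `|h c - h b| <= C * `|c - b|.
  move=> bc.
  have [z _ ->] := @MVT_segment R h (fun r => 'D_w f (r *: w + a)) b c bc
    (fun r _ => dh r) (continuous_subspaceT ch).
  by rewrite normrM ler_wpM2r.
have -> : f a = h 0 by rewrite /h scale0r add0r.
have [t0|/ltW t0] := leP 0 t.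
  by have := MV _ _ t0; rewrite subr0.
by have := MV _ _ t0; rewrite distrC sub0r normrN.
Qed.

Lemma test_function_continuous Omega f : test_function Omega f -> continuous f.
Proof. by case=> /(_ 0%N)/Ck_continuous. Qed.

(** Stated for two functions so as to apply to a derivative [f] of the function [g] whose support is
    known to be compact. *)
Lemma compact_support_bounded f g : continuous f ->
  compact (closure [set x | g x != 0]) ->
  (forall x, ~ closure [set x | g x != 0] x -> f x = 0) ->
  exists2 C : R, 0 < C & forall x, `|f x| <= C.
Proof.
move=> cf cS fS.
have cfS : compact (f @` closure [set x | g x != 0]).
  by apply: continuous_compact => //; exact: continuous_subspaceT.
have [M [_ MP]] := compact_bounded cfS.
exists (`|M| + 1); first by rewrite ltr_pwDr.
move=> x; have [Sx|Sx] := pselect (closure [set x | g x != 0] x).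
  by apply: MP; [rewrite ltr_pwDr// ler_norm|exists x].
by rewrite fS// normr0 addr_ge0.
Qed.

Lemma test_function_bounded Omega f : test_function Omega f ->
  exists2 C : R, 0 < C & forall x, `|f x| <= C.
Proof.
move=> tf; have cf := test_function_continuous _ _ tf.
case: tf => _ cS _; apply: (compact_support_bounded f f) => // x.
apply: contra_notP => /eqP fx; exact: subset_closure.
Qed.

Lemma test_function_lipschitz_line Omega f (w : V) : test_function Omega f ->
  exists2 C : R, 0 < C & forall a t, `|f (t *: w + a) - f a| <= C * `|t|.
Proof.
move=> [Cf cS _]; have [_ /(_ w)[df cD]] := Cf 1%N.
have DS x : ~ closure [set x | f x != 0] x -> 'D_w f x = 0.
  move=> Sx.
  (* The complement of the support is open, so there [f] vanishes near [x] and its derivative is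
     that of a constant. *)
  have : \forall y \near x, f y = 0.
    have oS : open (~` closure [set x | f x != 0]).
      by apply: closed_openC; exact: closed_closure.
    move: oS; rewrite openE => /(_ _ Sx); apply: filterS => y /= Sy.
    by apply: contra_notP Sy => /eqP fy; exact: subset_closure.
  move=> /(@near_eq_derive _ _ _ f (cst 0) x w) ->; exact: derive_cst.
have [C C0 CP] := compact_support_bounded (fun x => 'D_w f x) f (proj1 cD) cS DS.
by exists C => // a t; exact: (lipschitz_line f w C df CP a t).
Qed.

Lemma test_functionM Omega f g : test_function Omega f -> (forall k, Ck k g) ->
  test_function Omega (fun x => f x * g x).
Proof.
move=> [Cf cS SO] Cg.
have sub : closure [set x | f x * g x != 0] `<=` closure [set x | f x != 0].
  by apply: closureS => x /=; apply: contra_neq => ->; rewrite mul0r.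
split; first by move=> k; exact: CkM.
- exact: (subclosed_compact (@closed_closure _ _) cS).
- exact: subset_trans SO.
Qed.

End test_function_bounds.

(** The path from [y] to [x] moves one coordinate at a time; each of the [N] moves is at most the
    max norm of the difference. *)
Lemma rV_lipschitz {R : realType} {N : nat} (F : 'rV[R]_N -> R) (C : R) : 0 <= C ->
  (forall i a t, `|F (t *: delta_mx ord0 i + a) - F a| <= C * `|t|) ->
  forall x y, `|F x - F y| <= N%:R * C * `|x - y|.
Proof.
move=> C0 FC x y.
have H (r : seq 'I_N) (c : 'I_N -> R) :
    `|F (\sum_(i <- r) c i *: delta_mx ord0 i + y) - F y| <= \sum_(i <- r) C * `|c i|.
  elim: r => [|i r IH]; first by rewrite !big_nil add0r subrr normr0.
  rewrite !big_cons -addrA.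
  apply: le_trans (ler_distD (F (\sum_(i <- r) c i *: delta_mx ord0 i + y)) _ _) _.
  exact: lerD.
have xE : x = \sum_i (x - y) ord0 i *: delta_mx ord0 i + y.
  by rewrite -row_sum_delta subrK.
rewrite {1}xE; apply: le_trans (H _ _) _.
apply: (@le_trans _ _ (\sum_(i < N) C * `|x - y|)).
  by apply: ler_sum => i _; rewrite ler_wpM2l// le_coord_norm.
by rewrite sumr_const card_ord -[leLHS]mulr_natl mulrA.
Qed.

(** * Test functions of two variables near the diagonal *)

Section diagonal_splitting.
Context {R : realType} {N : nat}.
Local Notation X := ('rV[R]_N).
Variable psi : X * X -> R.
Hypothesis tpsi : test_function setT psi.

Lemma test_function_pair_bounds : exists L C : R, [/\ (0 < L) && (0 < C),
  forall x y, psi (x, y) != 0 -> `|x| < L /\ `|y| < L,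
  forall z, `|psi z| <= C,
  forall x y y', `|psi (x, y) - psi (x, y')| <= C * Num.min 1 `|y - y'| &
  forall x x' y, `|psi (x, y) - psi (x', y)| <= C * Num.min 1 `|x - x'| ].
Proof.
have [C0 C00 C0P] := test_function_bounded _ _ tpsi.
have /choice[C1 C1P] : forall i : 'I_N, exists C1 : R, 0 < C1 /\
    forall a t, `|psi (t *: (delta_mx ord0 i, 0) + a) - psi a| <= C1 * `|t|.
  move=> i; have [C ? ?] := test_function_lipschitz_line _ _ (delta_mx ord0 i, 0) tpsi.
  by exists C.
have /choice[C2 C2P] : forall i : 'I_N, exists C1 : R, 0 < C1 /\
    forall a t, `|psi (t *: (0, delta_mx ord0 i) + a) - psi a| <= C1 * `|t|.
  move=> i; have [C ? ?] := test_function_lipschitz_line _ _ (0, delta_mx ord0 i) tpsi.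
  by exists C.
pose C := \sum_i (C1 i + C2 i).
have CC i : C1 i + C2 i <= C.
  rewrite /C (bigD1 i)//= lerDl sumr_ge0// => j _.
  by rewrite addr_ge0// ltW//; [have [] := C1P j|have [] := C2P j].
have C10 i : 0 < C1 i by have [] := C1P i.
have C20 i : 0 < C2 i by have [] := C2P i.
have Cge0 : 0 <= C by rewrite sumr_ge0// => i _; rewrite addr_ge0// ltW.
have lip1 x x' y : `|psi (x, y) - psi (x', y)| <= N%:R * C * `|x - x'|.
  apply: (@rV_lipschitz _ _ (fun x => psi (x, y)) C) => // i a t.
  have [_ /(_ (a, y) t)] := C1P i.
  have -> : t *: (delta_mx ord0 i, 0) + (a, y) = (t *: delta_mx ord0 i + a, y).
    by congr (_, _) => /=; rewrite scaler0 add0r.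
  move=> h; apply: le_trans h _; rewrite ler_wpM2r//.
  by rewrite (le_trans _ (CC i))// lerDl ltW.
have lip2 x y y' : `|psi (x, y) - psi (x, y')| <= N%:R * C * `|y - y'|.
  apply: (@rV_lipschitz _ _ (fun y => psi (x, y)) C) => // i a t.
  have [_ /(_ (x, a) t)] := C2P i.
  have -> : t *: (0, delta_mx ord0 i) + (x, a) = (x, t *: delta_mx ord0 i + a).
    by congr (_, _) => /=; rewrite scaler0 add0r.
  move=> h; apply: le_trans h _; rewrite ler_wpM2r//.
  by rewrite (le_trans _ (CC i))// lerDr ltW.
have [M [_ MP]] : bounded_set (closure [set z | psi z != 0]).
  by apply: compact_bounded; case: tpsi.
(* Two values bounded by [C0] differ by at most [2 * C0]; the other summand is the Lipschitz
   constant. *)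
pose D := 2 * C0 + N%:R * C.
have minP (a b t : R) : `|a| <= C0 -> `|b| <= C0 -> `|a - b| <= N%:R * C * t ->
    0 <= t -> `|a - b| <= D * Num.min 1 t.
  move=> aC bC abt t0; have NC0 : 0 <= N%:R * C by rewrite mulr_ge0.
  rewrite /Num.min; case: ifPn => _.
    rewrite mulr1 (le_trans (ler_normB _ _))// /D.
    by apply: (le_trans (lerD aC bC)); rewrite mulr2n mulrDl mul1r lerDl.
  by apply: (le_trans abt); rewrite ler_wpM2r// /D lerDr mulr_ge0// ltW.
(* The support lies within [|M| + 1]; the next unit makes the bound strict. *)
exists (`|M| + 2), D; split.
- by rewrite ltr_wpDl//= ltr_pwDl ?mulr_gt0// mulr_ge0.
- move=> x y xy.
  have : `|(x, y)| <= `|M| + 1.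
    by apply: MP; [rewrite ltr_pwDr// ler_norm|exact: subset_closure].
  rewrite prod_normE ge_max/= => /andP[x1 y1].
  by split; [apply: le_lt_trans x1 _|apply: le_lt_trans y1 _]; rewrite ltrD2l ltr1n.
- move=> z; rewrite (le_trans (C0P z))// /D.
  have NC0 : 0 <= N%:R * C by rewrite mulr_ge0.
  by move: C00 NC0; lra.
- by move=> x y y'; apply: minP.
- by move=> x x' y; apply: minP.
Qed.

(** The support is only known to lie in the closed ball of radius [L]; the extra 1 puts it inside an
    open ball. *)
Lemma test_function_diagonal (L : R) :
  (forall x y, psi (x, y) != 0 -> `|x| < L /\ `|y| < L) ->
  test_function (ball (0 : X) (L + 1)) (fun x => psi (x, x)).
Proof.
move=> psiL; have [Cpsi _ _] := tpsi.
have subL : closure [set x | psi (x, x) != 0] `<=` [set x : X | `|x| <= L].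
  have cl : closed [set x : X | `|x| <= L].
    apply: (closed_comp (D := [set r | r <= L])) => [x _|]; first exact: norm_continuous.
    exact: closed_le.
  rewrite ((closure_id [set x : X | `|x| <= L]).1 cl).
  by apply: closureS => x /= /psiL[/ltW].
split.
- move=> k; apply: (Ck_comp_affine k psi (fun x => (x, x)) (fun x => (x, x))) => //.
  move=> x A /nbhs_ballP[e e0 eA]; apply/nbhs_ballP; exists e => // y xy.
  by apply: eA; split.
- apply: bounded_closed_compact; last exact: closed_closure.
  exists L; split; first exact: num_real.
  by move=> M LM x /subL /= xL; rewrite (le_trans xL)// ltW.
- move=> x /subL /= xL; rewrite -ball_normE/= sub0r normrN (le_lt_trans xL)//.
  by rewrite ltrDl.
Qed.

End diagonal_splitting.

(** * A smooth partition of unity on a grid *)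

Section partition_of_unity.
Context {R : realType}.
Implicit Types (t u : R).

(* The translates of [hat] by integers telescope to [1]. *)
Definition hat t : R := smooth_step (t + 1) - smooth_step t.

Lemma Ck_hat n : Ck n hat.
Proof.
apply: (CkB n (fun t => smooth_step (t + 1)) smooth_step); last exact: Ck_smooth_step.
apply: (Ck_comp_affine n smooth_step (fun x : R => x + 1) (fun v : R => v));
  last exact: Ck_smooth_step.
  by move=> x; apply: cvgD; [exact: cvg_id|exact: cvg_cst].
by move=> h v x; rewrite addrA.
Qed.

Lemma hat_le1 t : `|hat t| <= 1.
Proof.
have /andP[a0 a1] := smooth_step_itv (t + 1); have /andP[b0 b1] := smooth_step_itv t.
by rewrite ler_norml /hat; lra.
Qed.

Lemma hat_support t : hat t != 0 -> -1 < t < 1.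
Proof.
apply: contra_neqT; rewrite negb_and -!leNgt => /orP[t1|t1]; rewrite /hat.
  by rewrite !smooth_step_le0 ?subrr//; lra.
by rewrite !smooth_step_ge1 ?subrr//; lra.
Qed.

(** The finite sum telescopes to a difference of two steps. The bounds on [u] say that the first
    step has already reached 1 and that the last has not left 0. *)
Lemma hat_sum m u : 0 <= u -> u + 1 <= m%:R -> \sum_(j < m) hat (u - j%:R) = 1.
Proof.
move=> u0 um.
have H k : \sum_(j < k) hat (u - j%:R) = smooth_step (u + 1) - smooth_step (u + 1 - k%:R).
  elim: k => [|k IH]; first by rewrite big_ord0 subr0 subrr.
  rewrite big_ord_recr/= IH /hat -natr1.
  rewrite (_ : u + 1 - (k%:R + 1) = u - k%:R); last by ring.
  rewrite (_ : u - k%:R + 1 = u + 1 - k%:R); ring.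
rewrite H smooth_step_ge1 ?smooth_step_le0 ?subr0//; last by rewrite lerDr.
by rewrite subr_le0.
Qed.

Lemma hat_lipschitz : exists2 C : R, 0 < C &
  forall t u, `|hat t - hat u| <= C * `|t - u|.
Proof.
have tf : test_function setT hat.
  split=> //; first exact: Ck_hat.
  have sub : closure [set t | hat t != 0] `<=` (`[-1, 1]%classic : set R).
    have cI : closed (`[-1, 1]%classic : set R) by exact: interval_closed.
    rewrite ((closure_id _).1 cI).
    apply: closureS => x /= /hat_support /andP[x1 x2].
    by rewrite in_itv/= !ltW.
  exact: (subclosed_compact (@closed_closure _ _) (@segment_compact _ (-1) 1) sub).
have [C C0 CP] := test_function_lipschitz_line _ _ (1 : R) tf.
exists C => // t u; have := CP u (t - u).
by rewrite -[_ *: _]/(_ * _) mulr1 subrK.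
Qed.

(** One factor is exchanged at a time, all other factors being at most 1 in absolute value. *)
Lemma prod_lipschitz (I : Type) (r : seq I) (a b : I -> R) (e : I -> R) :
  (forall i, `|a i| <= 1) -> (forall i, `|b i| <= 1) ->
  (forall i, `|a i - b i| <= e i) ->
  `|\prod_(i <- r) a i - \prod_(i <- r) b i| <= \sum_(i <- r) e i.
Proof.
move=> a1 b1 ab.
have pb1 (s : seq I) (c : I -> R) : (forall i, `|c i| <= 1) -> `|\prod_(i <- s) c i| <= 1.
  move=> c1; elim: s => [|i s IH]; first by rewrite big_nil normr1.
  by rewrite big_cons normrM mulr_ile1.
elim: r => [|i r IH]; first by rewrite !big_nil subrr normr0.
rewrite !big_cons.
set A := \prod_(j <- r) a j; set B := \prod_(j <- r) b j.
have -> : a i * A - b i * B = (a i - b i) * A + b i * (A - B) by ring.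
apply: (le_trans (ler_normD _ _)); apply: lerD; rewrite normrM.
  by rewrite (le_trans _ (ab i))// ler_piMr// pb1.
by rewrite (le_trans _ IH)// ler_piMl.
Qed.

Context {N : nat}.
Local Notation X := ('rV[R]_N).
Variables (h : R) (m M : nat).
Hypothesis h0 : 0 < h.
Local Notation J := {ffun 'I_N -> 'I_m}.
Implicit Types (j : J) (x y : X).

(** Coordinate of [x] relative to the cell [j], in units of [h]. Indices start at 0, so [M] shifts
    the grid to have cells on both sides of the origin. *)
Let pos i j x : R := x ord0 i / h + M%:R - (j i)%:R.

Definition bump j x : R := \prod_(i < N) hat (pos i j x).

(** The box where all relative positions are in [0, 1). Half-open sides make distinct cells
    disjoint. *)
Definition cell j : set X :=
  [set x : X | forall i,
    (`[h * ((j i)%:R - M%:R), h * ((j i)%:R + 1 - M%:R)[%classic : set R) (x ord0 i)].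

Let cellP j x i : cell j x -> 0 <= pos i j x < 1.
Proof.
move=> /(_ i) /=; rewrite in_itv/= /pos => /andP[a b].
have {}a : (j i)%:R - M%:R <= x ord0 i / h by rewrite ler_pdivlMr// mulrC.
have {}b : x ord0 i / h < (j i)%:R + 1 - M%:R by rewrite ltr_pdivrMr// mulrC.
by lra.
Qed.

Lemma Ck_bump n j : Ck n (bump j).
Proof.
apply: Ck_prod => i.
apply: (Ck_comp_affine n hat (pos i j) (fun v : X => v ord0 i / h)).
- move=> x; have c : (fun y : X => y ord0 i) @ x --> x ord0 i by exact: coord_continuous.
  exact: (cvgB (cvgD (cvgM c (cvg_cst _)) (cvg_cst _)) (cvg_cst _)).
- by move=> e v x; rewrite /pos !mxE -[e *: (v ord0 i / h)]/(e * (v ord0 i / h)); ring.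
- exact: Ck_hat.
Qed.

Lemma bump_le1 j x : `|bump j x| <= 1.
Proof. by rewrite normr_prod prodr_ile1// => i _; rewrite normr_ge0 hat_le1. Qed.

(** A sum over multi-indices of products is the product of the one-dimensional sums, each equal to
    1. The margin of one cell in the condition on [M] keeps every coordinate inside the range where
    the telescoping is complete. *)
Lemma bump_sum (L : R) x : L / h + 1 <= M%:R -> m = (2 * M)%N -> `|x| < L ->
  \sum_j bump j x = 1.
Proof.
move=> LM mM xL; rewrite /bump.
rewrite -(@bigA_distr_bigA _ _ _ _ _ _ _ (fun i (k : 'I_m) => hat (x ord0 i / h + M%:R - k%:R))).
rewrite big1// => i _; apply: hat_sum.
  have : - (L / h) <= x ord0 i / h.
    rewrite -mulNr ler_pM2r ?invr_gt0// lerNl (le_trans _ (ltW xL))//.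
    by rewrite (le_trans _ (le_coord_norm x i))// -[leRHS]normrN ler_norm.
  lra.
have : x ord0 i / h <= L / h.
  rewrite ler_pM2r ?invr_gt0// (le_trans _ (ltW xL))//.
  by rewrite (le_trans _ (le_coord_norm x i))// ler_norm.
rewrite mM natrM; lra.
Qed.

(** Relative positions lie in (-1, 1) for [x] and in [0, 1) for the cell, so they differ by less
    than 2. *)
Lemma bump_near j x : bump j x != 0 -> cell j `<=` cube x (2 * h).
Proof.
move=> bx y jy; apply/(rV_normB_ltP _ _ _ (mulr_gt0 _ h0)) => // i.
have /hat_support/andP[x1 x2] : hat (pos i j x) != 0.
  by apply: contra_neq bx => e; rewrite /bump (bigD1 i)//= e mul0r.
have /andP[y1 y2] := cellP j y i jy.
have : `|pos i j x - pos i j y| < 2 by rewrite ltr_norml; lra.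
rewrite /pos (_ : _ - _ = (x ord0 i - y ord0 i) / h); last by ring.
by rewrite normrM (gtr0_norm (x := h^-1)) ?invr_gt0// ltr_pdivrMr.
Qed.

Lemma bump_lipschitz (C : R) : (forall t u, `|hat t - hat u| <= C * `|t - u|) ->
  forall j x y, `|bump j x - bump j y| <= N%:R * C * (`|x - y| / h).
Proof.
move=> CP j x y.
have C0 : 0 <= C by have := le_trans (normr_ge0 _) (CP 1 0); rewrite subr0 normr1 mulr1.
apply: (le_trans (@prod_lipschitz _ _ _ _ (fun=> C * (`|x - y| / h)) _ _ _)).
- by move=> i; exact: hat_le1.
- by move=> i; exact: hat_le1.
- move=> i; apply: le_trans (CP _ _) _; rewrite ler_wpM2l//.
  rewrite /pos (_ : _ - _ = (x ord0 i - y ord0 i) / h); last by ring.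
  rewrite normrM (gtr0_norm (x := h^-1)) ?invr_gt0// ler_pM2r ?invr_gt0//.
  by have := le_coord_norm (x - y) i; rewrite !mxE.
by rewrite sumr_const card_ord -[leLHS]mulr_natl mulrA.
Qed.

Lemma measurable_cell j : measurable (cell j).
Proof.
rewrite (_ : cell j = \bigcap_(i in [set: 'I_N]) ((fun v : X => v ord0 i) @^-1`
    `[h * ((j i)%:R - M%:R), h * ((j i)%:R + 1 - M%:R)[%classic)); last first.
  by apply/seteqP; split => x xj i; [move=> _; exact: xj|exact: (xj i I)].
apply: fin_bigcap_measurable => // i _.
rewrite -[X in measurable X]setTI; exact: measurable_rV_coord.
Qed.

Lemma lebesgue_cell j :
  (lebesgue_rV N : {measure set X -> \bar R}) (cell j) = (h ^+ N)%:E.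
Proof.
apply: etrans (@lebesgue_rV_box R N
  (fun i => `[h * ((j i)%:R - M%:R), h * ((j i)%:R + 1 - M%:R)[%classic) _) _ => //.
transitivity (\prod_(i < N) (h%:E : \bar R))%E; last by rewrite prodEFin prodr_const card_ord.
apply: eq_bigr => i _; rewrite lebesgue_measure_itv/= lte_fin ltr_pM2l//.
by rewrite ltrD2r ltrDl ltr01 -EFinB; congr (_%:E); ring.
Qed.

Lemma trivIset_cell : trivIset setT cell.
Proof.
apply/trivIsetP => j k _ _ /eqP jk; apply/seteqP; split => // x [xj xk].
exfalso; apply: jk; apply/ffunP => i; apply/val_inj => /=.
have /andP[a b] := cellP j x i xj; have /andP[c d] := cellP k x i xk.
have ab : (j i)%:R < (k i).+1%:R :> R by rewrite -natr1; move: a d; rewrite /pos; lra.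
have cd : (k i)%:R < (j i).+1%:R :> R by rewrite -natr1; move: b c; rewrite /pos; lra.
by apply/eqP; move: ab cd; rewrite !ltr_nat !ltnS eqn_leq => -> ->.
Qed.

End partition_of_unity.

(** * Averages over cells *)

Lemma indic_Lfun {d} {T : measurableType d} {R : realType}
    (mu : {measure set T -> \bar R}) (A : set T) (q : R) : 0 < q ->
  measurable A -> (mu A < +oo)%E ->
  (\1_A : T -> R) \in Lfun mu q%:E /\
  ('N[mu]_q%:E[EFin \o (\1_A : T -> R)] = mu A `^ q^-1)%E.
Proof.
move=> q0 mA Aoo.
have I : (\int[mu]_x (`|\1_A x| `^ q)%:E = mu A)%E.
  transitivity (\int[mu]_x (\1_A x)%:E)%E; last by rewrite integral_indic// setIT.
  apply: eq_integral => x _; congr (_%:E); rewrite indicE.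
  by case: (_ \in _); rewrite ?normr1 ?powR1// normr0 powR0// gt_eqF.
split; last by rewrite unlock /= I.
by apply: (LfunP_int mu q _ q0).2; split; [exact: measurable_indic|rewrite I].
Qed.

Section local_means.
Context {R : realType} {N : nat}.
Local Notation X := ('rV[R]_N).
Local Notation mu := (lebesgue_rV N : {measure set X -> \bar R}).
Variables (p q : R).
Hypotheses (p1 : 1 < p) (q0 : 0 < q) (pq : p^-1 + q^-1 = 1).
Variables (J : finType) (h : R) (Q : J -> set X).
Hypotheses (h0 : 0 < h) (mQ : forall j, measurable (Q j))
  (muQ : forall j, mu (Q j) = (h ^+ N)%:E) (tQ : trivIset setT Q).
Variable v : X -> R.
Hypothesis Lv : v \in Lfun mu p%:E.

Let p0 : 0 < p. Proof. exact: lt_trans p1. Qed.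
Let mv : measurable_fun setT v. Proof. exact: Lfun_measurable Lv. Qed.

(** The factor is the inverse of the common measure of the cells, so this is the average when [A] is
    one of them. *)
Definition cell_mean (u : X -> R) (A : set X) : R :=
  (h ^+ N)^-1 * \int[mu]_(x in A) u x.

Let hN0 : 0 < h ^+ N. Proof. exact: exprn_gt0. Qed.

Lemma Lfun_integrable_set (A : set X) : measurable A -> (mu A < +oo)%E ->
  mu.-integrable A (EFin \o v).
Proof.
move=> mA Aoo; apply/(integrable_mkcond _ mA).
have [LA _] := indic_Lfun mu A q q0 mA Aoo.
have [+ _] := Lfun_hoelder mu p q _ _ p0 q0 pq Lv LA.
apply: eq_integrable => // x _; rewrite /= patchE indicE.
by case: ifPn => _; rewrite ?mulr1 ?mulr0.
Qed.

Let osc x y : \bar R := (`|v x - v y|)%:E.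

Let mosc x : measurable_fun setT (osc x).
Proof.
apply/measurable_EFinP; apply: measurableT_comp => //.
by apply: measurable_funB => //; exact: measurable_cst.
Qed.

Let mean_osc x j :
  (`|v x - cell_mean v (Q j)|%:E <= ((h ^+ N)^-1)%:E * \int[mu]_(y in Q j) osc x y)%E.
Proof.
have Qoo : (mu (Q j) < +oo)%E by rewrite muQ ltry.
have Iv := Lfun_integrable_set (Q j) (mQ j) Qoo.
have Ic : mu.-integrable (Q j) (EFin \o (fun=> v x)).
  apply/integrableP; split; first exact: measurable_cst.
  by rewrite integral_cst//= muQ -EFinM ltry.
have -> : v x - cell_mean v (Q j) = (h ^+ N)^-1 * \int[mu]_(y in Q j) (v x - v y).
  rewrite RintegralB// Rintegral_cst// muQ/= /cell_mean mulrBr mulrCA mulVf ?mulr1//.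
  by rewrite gt_eqF.
rewrite normrM gtr0_norm ?invr_gt0// EFinM lee_pmul2l//; last by rewrite lte_fin invr_gt0.
have IB : mu.-integrable (Q j) (EFin \o (fun y => v x - v y)).
  exact: (integrableB (mQ j) Ic Iv).
rewrite EFin_normr_Rintegral//; apply: le_abse_integral => //.
by have /integrableP[] := IB.
Qed.

(** Hölder's inequality against the indicator of the cube, whose norm in L^q is the volume to the
    power 1/q. *)
Let osc_jensen x (r : R) : 0 < r ->
  (\int[mu]_(y in cube x r) osc x y <=
   (((2 * r) ^+ N) `^ q^-1)%:E *
   (\int[mu]_(y in cube x r) (`|v x - v y| `^ p)%:E) `^ p^-1)%E.
Proof.
move=> r0; have mC := measurable_cube x r.
have Coo : (mu (cube x r) < +oo)%E by rewrite lebesgue_rV_cube// ltry.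
have [_ NC] := indic_Lfun mu (cube x r) q q0 mC Coo.
have m1 : measurable_fun setT (\1_(cube x r) : X -> R) by exact: measurable_indic.
pose f y := (v x - v y) * \1_(cube x r) y.
have mf : measurable_fun setT f.
  by apply: measurable_funM => //; apply: measurable_funB => //; exact: measurable_cst.
have := hoelder mu mf m1 p0 q0 pq.
rewrite NC lebesgue_rV_cube// poweR_EFin muleC Lnorm1.
have -> : (\int[mu]_y `|(EFin \o (f \* \1_(cube x r))%R) y| =
    \int[mu]_(y in cube x r) osc x y)%E.
  rewrite [RHS]integral_mkcond; apply: eq_integral => y _.
  rewrite /= patchE /f /osc indicE; case: ifPn => _.
    by rewrite !mulr1.
  by rewrite !mulr0 normr0.
suff -> : 'N[mu]_p%:E[EFin \o f]%E =
  ((\int[mu]_(y in cube x r) (`|v x - v y| `^ p)%:E) `^ p^-1)%E by [].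
rewrite unlock; congr (_ `^ _)%E.
rewrite [RHS]integral_mkcond; apply: eq_integral => y _.
rewrite /= patchE /f indicE; case: ifPn => _; first by rewrite mulr1.
by rewrite mulr0 normr0 powR0 ?gt_eqF.
Qed.

(** The loss in passing from averages over cells of volume h^N to the p-th power mean over the cube
    of side 6 h. *)
Definition mean_cst : R := ((h ^+ N)^-1 * ((2 * (3 * h)) ^+ N) `^ q^-1) `^ p.

(** Used with the values of the partition of unity at [x], where [beta] is 1, and with their
    differences between two points, where [beta] is a Lipschitz bound. The number of cells does not
    enter the constant: those with nonzero coefficient are disjoint and all lie in one cube. *)
Lemma mean_approx (b : J -> R) (beta : R) x : 0 <= beta ->
  (forall j, `|b j| <= beta) ->
  (forall j, b j != 0 -> Q j `<=` cube x (3 * h)) ->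
  ((`|\sum_j b j * (v x - cell_mean v (Q j))| `^ p)%:E <=
   (beta `^ p * mean_cst)%:E *
   \int[mu]_(y in cube x (3 * h)) (`|v x - v y| `^ p)%:E)%E.
Proof.
move=> beta0 bb bQ; have h30 : 0 < 3 * h by rewrite mulr_gt0.
set G := (\int[mu]_(y in _) _)%E.
have G0 : (0 <= G)%E by apply: integral_ge0 => y _; rewrite lee_fin powR_ge0.
have mC := measurable_cube x (3 * h).
(* Only cells with nonzero coefficient are known to lie in the cube; the others are discarded before
   integrating. *)
pose s := [seq j <- enum J | b j != 0].
have us : uniq s by rewrite filter_uniq ?enum_uniq.
have K0 : 0 <= (h ^+ N)^-1 by rewrite invr_ge0 ltW.
have S1 : ((`|\sum_j b j * (v x - cell_mean v (Q j))|)%:E <=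
    (beta * (h ^+ N)^-1)%:E * \int[mu]_(y in cube x (3 * h)) osc x y)%E.
  have -> : \sum_j b j * (v x - cell_mean v (Q j)) =
      \sum_(j <- s) b j * (v x - cell_mean v (Q j)).
    rewrite big_filter big_enum_cond/= [LHS](bigID (fun j => b j != 0))/= addrC big1 ?add0r//.
    by move=> j; rewrite negbK => /eqP ->; rewrite mul0r.
  apply: (@le_trans _ _ (\sum_(j <- s) (beta * (h ^+ N)^-1)%:E * \int[mu]_(y in Q j) osc x y)%E).
    apply: (@le_trans _ _ (\sum_(j <- s) (`|b j * (v x - cell_mean v (Q j))|)%:E)%E).
      by rewrite sumEFin lee_fin ler_norm_sum.
    apply: lee_sum => j _; rewrite normrM EFinM EFinM -muleA.
    by apply: lee_pmul; rewrite ?lee_fin//; exact: mean_osc.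
  rewrite -ge0_sume_distrr; last by move=> j _; apply: integral_ge0 => y _; rewrite lee_fin.
  apply: lee_wpmul2l; first by rewrite lee_fin mulr_ge0.
  (* Disjointness turns the sum of integrals into one integral over a union contained in the
     cube. *)
  rewrite -(ge0_integral_bigsetU mu mQ us).
  - apply: ge0_subset_integral => //.
    + by apply: bigsetU_measurable => j _; exact: mQ.
    + exact: measurable_funS (mosc x).
    + by move=> y _; rewrite lee_fin.
    + by rewrite -bigcup_seq => y [j /=]; rewrite mem_filter => /andP[/bQ + _] => /[apply].
  - by apply: sub_trivIset tQ.
  - exact: measurable_funS (mosc x).
  - by move=> y _; rewrite lee_fin.
have S2 := le_trans S1 (lee_wpmul2l _ (osc_jensen x _ h30)).
have {}S2 : ((`|\sum_j b j * (v x - cell_mean v (Q j))|)%:E <=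
   (beta * ((h ^+ N)^-1 * ((2 * (3 * h)) ^+ N) `^ q^-1))%:E * G `^ p^-1)%E.
  by rewrite (mulrA beta) EFinM -muleA; apply: S2; rewrite lee_fin mulr_ge0.
rewrite -poweR_EFin.
have -> : ((beta `^ p * mean_cst)%:E * G =
    ((beta * ((h ^+ N)^-1 * ((2 * (3 * h)) ^+ N) `^ q^-1))%:E * G `^ p^-1) `^ p)%E.
  rewrite poweRM ?poweR_ge0 ?lee_fin ?mulr_ge0 ?powR_ge0//.
  rewrite -poweRrM mulVf ?gt_eqF// poweRe1// poweR_EFin powRM ?mulr_ge0 ?powR_ge0//.
apply: gt0_ler_poweR => //.
- exact: ltW.
- by rewrite in_itv/= leey lee_fin normr_ge0.
- by rewrite in_itv/= leey mule_ge0 ?poweR_ge0// lee_fin !mulr_ge0 ?powR_ge0.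
Qed.

End local_means.

(** * Quasi-interpolation at scale h *)

Section quasi_interpolation.
Context {R : realType} {N : nat}.
Local Notation X := ('rV[R]_N).
Local Notation mu := (lebesgue_rV N : {measure set X -> \bar R}).
Variables (s p q : R).
Hypotheses (s0 : 0 < s) (s1 : s < 1) (p1 : 1 < p) (q0 : 0 < q)
  (pq : p^-1 + q^-1 = 1).

Let p0 : 0 < p. Proof. exact: lt_trans p1. Qed.
Let D := N%:R + s * p.
Let D0 : 0 <= D. Proof. by rewrite addr_ge0// mulr_ge0// ltW. Qed.

Lemma sp_grad_powR (u : X -> R) z : `|sp_grad s p u z| `^ p =
  `|u z.1 - u z.2| `^ p / enorm (z.1 - z.2) `^ (N%:R + s * p).
Proof.
rewrite /sp_grad normrM powRM// normfV (ger0_norm (powR_ge0 _ _)); congr (_ * _).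
rewrite -[in LHS]powRN -powRrM mulNr powRN mulrDl divfK// gt_eqF//.
Qed.

Definition strip (r : R) : set (X * X) := [set z : X * X | `|z.1 - z.2| < r].

Lemma measurable_strip r : measurable (strip r).
Proof.
have := @measurable_rV_dist R N measurableT `]-oo, r[%classic (measurable_itv _).
by rewrite setTI preimage_itvNyo.
Qed.

Definition near_energy (r : R) (u : X -> R) : \bar R :=
  (\int[lebesgue_rV2 N]_(z in strip r) (`|sp_grad s p u z| `^ p)%:E)%E.

Section oscillation.
Variables (v : X -> R) (H : R).
Hypotheses (mv : measurable_fun setT v) (H0 : 0 < H).

Definition osc_integral x : \bar R :=
  (\int[lebesgue_rV N]_(y in cube x H) (`|v x - v y| `^ p)%:E)%E.

Let F (z : X * X) : \bar R := ((fun z => (`|v z.1 - v z.2| `^ p)%:E) \_ (strip H)) z.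

Let F0 z : (0 <= F z)%E.
Proof. by rewrite /F patchE; case: ifPn => // _; rewrite lee_fin powR_ge0. Qed.

Let mdiff : measurable_fun setT (fun z : X * X => (`|v z.1 - v z.2| `^ p)%:E).
Proof.
apply/measurable_EFinP/measurable_norm_powR; apply: measurable_funB.
  exact: (measurableT_comp mv measurable_fst).
exact: (measurableT_comp mv measurable_snd).
Qed.

Let mF : measurable_fun setT F.
Proof.
apply/(measurable_restrictT _ (measurable_strip H)).
exact: measurable_funS mdiff.
Qed.

Let oscE x : osc_integral x = fubini_F (lebesgue_rV N) F x.
Proof.
rewrite /osc_integral /fubini_F [LHS]integral_mkcond; apply: eq_integral => y _.
by rewrite /F !patchE.
Qed.

Lemma osc_integral_ge0 x : (0 <= osc_integral x)%E.
Proof. by apply: integral_ge0 => y _; rewrite lee_fin powR_ge0. Qed.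

Lemma measurable_osc_integral : measurable_fun setT osc_integral.
Proof.
rewrite (_ : osc_integral = fubini_F (lebesgue_rV N) F); last exact/funext.
exact: measurable_fun_fubini_tonelli_F.
Qed.

(** On the strip the Euclidean distance is at most N H, so the difference to the power p is at most
    (N H)^(N + sp) times the energy density. On the diagonal both sides are 0. *)
Lemma integral_osc_le : (\int[lebesgue_rV N]_x osc_integral x <=
  ((N%:R * H) `^ (N%:R + s * p))%:E * near_energy H v)%E.
Proof.
have -> : (\int[lebesgue_rV N]_x osc_integral x = \int[lebesgue_rV2 N]_z F z)%E.
  rewrite (_ : osc_integral = fubini_F (lebesgue_rV N) F); last exact/funext.
  exact: (esym (fubini_tonelli1 _ mF F0)).
have mg : measurable_fun (strip H) (fun z => (`|sp_grad s p v z| `^ p)%:E).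
  apply/measurable_funTS/measurable_EFinP/measurable_norm_powR.
  exact: measurable_sp_grad.
rewrite -integral_mkcond /near_energy -ge0_integralZl//; last 2 first.
- exact: measurable_strip.
- by rewrite lee_fin powR_ge0.
apply: ge0_le_integral.
- exact: measurable_strip.
- by move=> z _; rewrite lee_fin powR_ge0.
- exact: measurable_funTS mdiff.
- by apply: emeasurable_funM => //; exact: measurable_cst.
move=> z zH; rewrite -EFinM lee_fin sp_grad_powR.
have [e0|e0] := eqVneq (enorm (z.1 - z.2)) 0.
  have -> : `|v z.1 - v z.2| = 0.
    have : `|z.1 - z.2| <= 0 by rewrite -e0 enorm_ge_norm.
    by rewrite normr_le0 subr_eq0 => /eqP ->; rewrite subrr normr0.
  by rewrite powR0 ?gt_eqF// mul0r mulr0.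
have ep : 0 < enorm (z.1 - z.2) by rewrite lt0r e0 sqrtr_ge0.
rewrite mulrCA ler_peMr ?powR_ge0// ler_pdivlMr ?powR_gt0// mul1r.
apply: ge0_ler_powR; rewrite ?nnegrE ?mulr_ge0// ?(ltW ep) ?(ltW H0)//.
by rewrite (le_trans (enorm_le_norm _))// ler_wpM2l// ltW.
Qed.

End oscillation.

(** Count of powers of [h]: -Np from the averages, N(p - 1) from Hölder's inequality and N + sp from
    the kernel leave sp. *)
Lemma mean_cst_scale h : 0 < h -> @mean_cst R N p q h * (N%:R * (3 * h)) `^ (N%:R + s * p) =
  (6 ^+ N) `^ (p - 1) * (N%:R * 3) `^ (N%:R + s * p) * h `^ (s * p).
Proof.
move=> h0; rewrite /mean_cst.
have hN : 0 < h ^+ N by rewrite exprn_gt0.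
have qp : q^-1 * p = p - 1.
  have -> : q^-1 = 1 - p^-1 by rewrite -pq addrC addKr.
  by rewrite mulrBl mul1r mulVf// gt_eqF.
have -> : ((h ^+ N)^-1 * ((2 * (3 * h)) ^+ N) `^ q^-1) `^ p =
    (h ^+ N) `^ (- p) * ((6 ^+ N) `^ (p - 1) * (h ^+ N) `^ (p - 1)).
  rewrite powRM ?powR_ge0 ?invr_ge0 ?(ltW hN)// -powRrM qp; congr (_ * _).
    by rewrite -powR_inv1 ?(ltW hN)// -powRrM mulN1r.
  have -> : (2 * (3 * h)) ^+ N = 6 ^+ N * h ^+ N.
    by rewrite -exprMn; congr (_ ^+ _); ring.
  by rewrite powRM ?exprn_ge0// ltW.
have -> : (N%:R * (3 * h)) `^ (N%:R + s * p) =
    (N%:R * 3) `^ (N%:R + s * p) * (h ^+ N * h `^ (s * p)).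
  rewrite (mulrA N%:R) [LHS]powRM ?mulr_ge0 ?(ltW h0)//; congr (_ * _).
  rewrite powRD; last by rewrite (gt_eqF h0) implybT.
  by rewrite powR_mulrn// ltW.
have : (h ^+ N) `^ (- p) * (h ^+ N) `^ (p - 1) * h ^+ N = 1.
  rewrite -[X in _ * X](powRr1 (ltW hN)) -!powRD ?(gt_eqF hN) ?implybT//.
  by rewrite (_ : _ + _ = 0) ?powRr0//; ring.
move: ((h ^+ N) `^ (- p)) ((h ^+ N) `^ (p - 1)) => a b; move: (h ^+ N) => c abc.
move: ((6 ^+ N) `^ (p - 1)) ((N%:R * 3) `^ (N%:R + s * p)) (h `^ (s * p)) => u w t.
by rewrite -[RHS]mul1r -abc; ring.
Qed.

Lemma sp_gradB (u w : X -> R) z :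
  sp_grad s p (fun x => u x - w x) z = sp_grad s p u z - sp_grad s p w z.
Proof. by rewrite /sp_grad; ring. Qed.

Lemma in_cube0 L (x : X) : cube 0 L x <-> `|x| < L.
Proof. by rewrite /cube /= sub0r normrN. Qed.

(* The right-hand sides vanish with h for fixed v (density of smooth functions)
   and are small uniformly in v of bounded energy (compactness). *)
Lemma quasi_interpolation (L : R) : 0 < L -> exists2 C : R, 0 < C & forall h, 0 < h ->
  exists (J : finType) (Q : J -> set X) (a : J -> X -> R),
  [/\ forall j k, Ck k (a j), forall j x, `|a j x| <= 1,
    forall j, measurable (Q j) /\ mu (Q j) = (h ^+ N)%:E &
    forall v, v \in Lfun mu p%:E ->
      let r x := v x - \sum_j cell_mean h v (Q j) * a j x in
      (\int[mu]_(x in cube 0 L) (`|r x| `^ p)%:E <=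
        (C * h `^ (s * p))%:E * near_energy (3 * h) v)%E /\
      (\int[lebesgue_rV2 N]_(z in cube 0 L `*` cube 0 L) (`|sp_grad s p r z| `^ p)%:E <=
        C%:E * near_energy (3 * h) v)%E ].
Proof.
move=> L0.
have [M [M0 MP]] := @integral2_trunc_kernel R N s p s0 s1 p1.
have [Ce Ce0 CeP] := @hat_lipschitz R.
pose A := (6 ^+ N) `^ (p - 1) * (N%:R * 3) `^ D : R.
have A0 : 0 <= A by rewrite mulr_ge0 ?powR_ge0.
(* One constant for both regimes below: 1 for points at distance at least [h], the Lipschitz factor
   for closer ones. In [C], [A] serves the L^p estimate and the rest the energy estimate. *)
pose B := 1 + (N%:R * Ce) `^ p.
have B0 : 0 < B by rewrite ltr_pwDl ?powR_ge0.
have NCe0 : 0 <= N%:R * Ce by rewrite mulr_ge0// ltW.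
pose C := A + 2 `^ p * (1 + B * M * A) : R.
exists C; first by rewrite ltr_wpDl// mulr_gt0 ?powR_gt0// ltr_pwDl// !mulr_ge0// ltW.
move=> h h0.
(* [K.+1] cells on each side of the origin cover the cube of radius [L] with the margin required by
   [bump_sum]. *)
pose K : nat := Num.truncn (L / h + 1); pose m := (2 * K.+1)%N.
have LK : L / h + 1 <= K.+1%:R by exact/ltW/truncnS_gt.
pose J : finType := {ffun 'I_N -> 'I_m}.
pose a (j : J) := bump h m K.+1 j; pose Q (j : J) := cell h m K.+1 j.
exists J, Q, a.
have mQ j : measurable (Q j) by exact: measurable_cell.
have muQ j : mu (Q j) = (h ^+ N)%:E by exact: lebesgue_cell.
have sum1 x : cube 0 L x -> \sum_j a j x = 1.
  by move=> /in_cube0; exact: bump_sum.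
split=> //; [by move=> j k; exact: Ck_bump|by move=> j x; exact: bump_le1|].
move=> v Lv r; have mv := Lfun_measurable mu p _ Lv.
pose kappa := @mean_cst R N p q h.
have k0 : 0 <= kappa by exact: powR_ge0.
have h30 : 0 < 3 * h by rewrite mulr_gt0.
pose G := osc_integral v (3 * h).
have G0 x : (0 <= G x)%E by exact: osc_integral_ge0.
have mG : measurable_fun setT G by exact: measurable_osc_integral.
have T0 : (0 <= near_energy (3 * h) v)%E.
  by apply: integral_ge0 => z _; rewrite lee_fin powR_ge0.
have kG : (kappa%:E * \int[mu]_x G x <= (A * h `^ (s * p))%:E * near_energy (3 * h) v)%E.
  have := lee_wpmul2l _ (integral_osc_le v (3 * h) mv h30).
  by move=> /(_ kappa%:E); rewrite lee_fin => /(_ k0); rewrite muleA -EFinM mean_cst_scale.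
have mI : measurable_fun setT (fun x => \sum_j cell_mean h v (Q j) * a j x).
  apply: measurable_sum => j; apply: measurable_funM; first exact: measurable_cst.
  by apply: continuous_measurable_rV; exact: (Ck_continuous 0 _ (Ck_bump h m K.+1 0 j)).
have mr : measurable_fun setT r by exact: measurable_funB.
have rG x : cube 0 L x -> ((`|r x| `^ p)%:E <= kappa%:E * G x)%E.
  move=> xL.
  have -> : r x = \sum_j a j x * (v x - cell_mean h v (Q j)).
    under eq_bigr do rewrite mulrBr; rewrite big_split/= sumrN -mulr_suml sum1// mul1r.
    by congr (_ - _); apply: eq_bigr => j _; rewrite mulrC.
  have := mean_approx p q p1 q0 pq J h Q h0 mQ muQ (trivIset_cell _ _ _ h0) v Lv (a ^~ x) 1 x.
  rewrite powR1 mul1r; apply=> // [j|j ax]; first exact: bump_le1.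
  apply: subset_trans (bump_near _ _ _ h0 j x ax) _ => y; rewrite /cube/= => xy.
  by apply: lt_le_trans xy _; rewrite ler_pM2r// ler_nat.
have mCL : measurable (cube (0 : X) L) by exact: measurable_cube.
have mrp : measurable_fun setT (fun x => (`|r x| `^ p)%:E).
  exact/measurable_EFinP/measurable_norm_powR.
have mkG : measurable_fun setT (fun x => (kappa%:E * G x)%E).
  by apply: emeasurable_funM => //; exact: measurable_cst.
have kG0 x : (0 <= kappa%:E * G x)%E by rewrite mule_ge0// lee_fin.
split.
  apply: (@le_trans _ _ (kappa%:E * \int[mu]_x G x)%E); last first.
    apply: le_trans kG _; apply: lee_wpmul2r => //.
    rewrite lee_fin ler_wpM2r ?powR_ge0// /C lerDl mulr_ge0 ?powR_ge0//.
    by rewrite addr_ge0// !mulr_ge0// ltW.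
  rewrite -ge0_integralZl//.
  apply: (@le_trans _ _ (\int[mu]_(x in cube 0 L) (kappa%:E * G x))%E).
    apply: ge0_le_integral => //.
    - exact: measurable_funTS.
    - exact: measurable_funTS.
  by apply: ge0_subset_integral => // x _; exact: kG0.
pose E (z : X * X) := enorm (z.1 - z.2) `^ D.
have E0 z : 0 <= (E z)^-1 by rewrite invr_ge0 powR_ge0.
(* Both points are in the region where the partition sums to 1, so the differences of its members
   sum to 0 and the constant [v x] may be subtracted from all averages. *)
have kern_le x y : `|x - y| < h -> cube 0 L x -> cube 0 L y ->
    ((`|(\sum_j cell_mean h v (Q j) * a j x) - \sum_j cell_mean h v (Q j) * a j y| `^ p)%:E <=
     ((N%:R * Ce * (`|x - y| / h)) `^ p * kappa)%:E * G x)%E.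
  move=> xyh xL yL.
  have -> : \sum_j cell_mean h v (Q j) * a j x - \sum_j cell_mean h v (Q j) * a j y =
      - \sum_j (a j x - a j y) * (v x - cell_mean h v (Q j)).
    under [in RHS]eq_bigr do rewrite mulrBr; rewrite big_split/= sumrN -mulr_suml.
    rewrite [X in X * _](_ : _ = 0); last by rewrite big_split/= sumrN !sum1// subrr.
    rewrite mul0r add0r opprK -sumrB; apply: eq_bigr => j _; ring.
  rewrite normrN.
  have := mean_approx p q p1 q0 pq J h Q h0 mQ muQ (trivIset_cell _ _ _ h0) v Lv
    (fun j => a j x - a j y) (N%:R * Ce * (`|x - y| / h)) x.
  apply=> [|j|j axy].
  - by rewrite mulr_ge0// divr_ge0// ltW.
  - exact: bump_lipschitz.
  (* A coefficient may be nonzero because of [y] alone; then the cell is within 2 h of [y], hence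
     within 3 h of [x]. *)
  - have [ax|ax] := eqVneq (a j x) 0; last first.
      apply: subset_trans (bump_near _ _ _ h0 j x ax) _ => w; rewrite /cube/= => xw.
      by apply: lt_le_trans xw _; rewrite ler_pM2r// ler_nat.
    have {}axy : a j y != 0 by apply: contra_neq axy => ->; rewrite ax subrr.
    apply: subset_trans (bump_near _ _ _ h0 j y axy) _ => w; rewrite /cube/= => yw.
    rewrite -(subrKA y) (le_lt_trans (ler_normD _ _))//.
    by rewrite (_ : 3 * h = h + 2 * h) ?ltrD//; ring.
pose W (z : X * X) := (trunc_kernel s p h z)%:E.
have W0 z : (0 <= W z)%E by rewrite lee_fin trunc_kernel_ge0.
pose P := (fun z => (`|sp_grad s p v z| `^ p)%:E) \_ (strip (3 * h)).
have P0 z : (0 <= P z)%E by rewrite /P patchE; case: ifPn => // _; rewrite lee_fin powR_ge0.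
pose S (z : X * X) := (W z * (G z.1 + G z.2))%E.
have S0 z : (0 <= S z)%E by rewrite mule_ge0// adde_ge0.
have B1 : 1 <= B by rewrite lerDl powR_ge0.
have Bk : (kappa%:E <= (B * kappa)%:E)%E by rewrite lee_fin ler_peMl.
have ptw z : (cube (0 : X) L `*` cube (0 : X) L) z -> ((`|sp_grad s p r z| `^ p)%:E <=
    (2 `^ p)%:E * (P z + (B * kappa)%:E * S z))%E.
  case: z => x y [/= xL yL].
  rewrite sp_grad_powR -/D -/(E (x, y)) /=.
  have split2 (b c : R) : 0 <= b -> 0 <= c -> `|r x - r y| <= b + c ->
      ((`|r x - r y| `^ p / E (x, y))%:E <=
      (2 `^ p)%:E * ((b `^ p / E (x, y))%:E + (c `^ p / E (x, y))%:E))%E.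
    move=> b0 c0 bc; rewrite -EFinD -EFinM lee_fin -mulrDl mulrA ler_wpM2r//.
    apply: le_trans (powRD_le _ _ _ b0 c0 (ltW p0)).
    by apply: ge0_ler_powR; rewrite ?nnegrE ?addr_ge0// ltW.
  (* For close points [v] and its interpolant are treated apart: the former gives the near energy,
     the latter the Lipschitz gain |x - y| / h, which is the truncated numerator. *)
  have [xyh|xyh] := ltP `|x - y| h.
    apply: le_trans (split2 `|v x - v y|
      `|(\sum_j cell_mean h v (Q j) * a j x) - \sum_j cell_mean h v (Q j) * a j y| _ _ _) _ => //.
      rewrite /r opprD addrACA -opprD; exact: ler_normB.
    apply: lee_wpmul2l; first by rewrite lee_fin powR_ge0.
    apply: leeD.
      rewrite /P patchE mem_set; first by rewrite sp_grad_powR.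
      by rewrite /strip/=; apply: lt_trans xyh _; rewrite ltr_pMl// ltr1n.
    apply: (@le_trans _ _ (((N%:R * Ce * (`|x - y| / h)) `^ p * kappa)%:E * G x *
        ((E (x, y))^-1)%:E)%E).
      by rewrite EFinM; apply: lee_wpmul2r; [rewrite lee_fin|exact: kern_le].
    have xh0 : 0 <= `|x - y| / h by rewrite divr_ge0// ltW.
    rewrite muleAC -EFinM powRM//.
    rewrite (_ : _ * _ / _ = (N%:R * Ce) `^ p * kappa * trunc_kernel s p h (x, y)); last first.
      rewrite /trunc_kernel/= min_r; last by rewrite ler_pdivrMr// mul1r ltW.
      by rewrite -/D -/(E (x, y)); ring.
    rewrite EFinM -muleA; apply: lee_pmul.
    - by rewrite lee_fin mulr_ge0 ?powR_ge0.
    - by rewrite mule_ge0// lee_fin trunc_kernel_ge0.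
    - by rewrite lee_fin ler_wpM2r// /B lerDr.
    - by apply: lee_wpmul2l; [exact: W0|rewrite leeDl].
  (* For distant points there is no cancellation to exploit: the error is estimated at each point
     separately, and the truncated kernel equals the full one. *)
  apply: le_trans (split2 `|r x| `|r y| _ _ (ler_normB _ _)) _ => //.
  apply: lee_wpmul2l; first by rewrite lee_fin powR_ge0.
  have WE : W (x, y) = ((E (x, y))^-1)%:E.
    by rewrite /W /trunc_kernel/= min_l ?powR1 ?mul1r// ler_pdivlMr// mul1r.
  apply: (@le_trans _ _ (kappa%:E * S (x, y))%E); last first.
    apply: le_trans (lee_wpmul2r (S0 _) Bk) _.
    by rewrite leeDr.
  have aux w : cube 0 L w ->
      ((`|r w| `^ p / E (x, y))%:E <= ((E (x, y))^-1)%:E * (kappa%:E * G w))%E.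
    by move=> wL; rewrite mulrC EFinM; apply: lee_wpmul2l; [rewrite lee_fin|exact: rG].
  have -> : (kappa%:E * S (x, y) = ((E (x, y))^-1)%:E * (kappa%:E * G x) +
      ((E (x, y))^-1)%:E * (kappa%:E * G y))%E.
    rewrite /S WE muleCA (ge0_muleDr _ (G0 x) (G0 y)).
    by rewrite (ge0_muleDr _ (kG0 x) (kG0 y)).
  by apply: leeD; exact: aux.
have mW : measurable_fun setT W.
  by apply/measurable_EFinP; exact: measurable_trunc_kernel.
have mS : measurable_fun setT S.
  apply: emeasurable_funM => //; apply: emeasurable_funD.
    exact: (measurableT_comp mG measurable_fst).
  exact: (measurableT_comp mG measurable_snd).
have mP : measurable_fun setT P.
  apply/(measurable_restrictT _ (measurable_strip _)).
  apply/measurable_funTS/measurable_EFinP/measurable_norm_powR.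
  exact: measurable_sp_grad.
have Bk0 : (0 <= (B * kappa)%:E)%E by rewrite lee_fin mulr_ge0// ltW.
have PS0 z : (0 <= (2 `^ p)%:E * (P z + (B * kappa)%:E * S z))%E.
  by rewrite mule_ge0 ?lee_fin ?powR_ge0// adde_ge0// mule_ge0.
have mBS : measurable_fun setT (fun z => (B * kappa)%:E * S z)%E.
  by apply: emeasurable_funM => //; exact: measurable_cst.
have mPBS : measurable_fun setT (fun z => P z + (B * kappa)%:E * S z)%E.
  exact: emeasurable_funD.
have mPS : measurable_fun setT (fun z => (2 `^ p)%:E * (P z + (B * kappa)%:E * S z))%E.
  by apply: emeasurable_funM => //; exact: measurable_cst.
have mCC : measurable (cube (0 : X) L `*` cube (0 : X) L) by exact: measurableX.
apply: (@le_trans _ _ (\int[lebesgue_rV2 N]_z ((2 `^ p)%:E * (P z + (B * kappa)%:E * S z)))%E).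
  apply: (@le_trans _ _ (\int[lebesgue_rV2 N]_(z in cube (0 : X) L `*` cube (0 : X) L)
      ((2 `^ p)%:E * (P z + (B * kappa)%:E * S z)))%E).
    apply: ge0_le_integral.
    - exact: mCC.
    - by move=> z _; rewrite lee_fin powR_ge0.
    - apply/measurable_funTS/measurable_EFinP/measurable_norm_powR.
      exact: measurable_sp_grad.
    - exact: measurable_funTS.
    - exact: ptw.
  by apply: ge0_subset_integral => // z _; exact: PS0.
have PS1 z : (0 <= P z + (B * kappa)%:E * S z)%E by rewrite adde_ge0// mule_ge0.
rewrite ge0_integralZl//.
rewrite ge0_integralD//; last by move=> z _; rewrite mule_ge0.
rewrite ge0_integralZl//.
have -> : (\int[lebesgue_rV2 N]_z P z = near_energy (3 * h) v)%E.
  by rewrite /near_energy [RHS]integral_mkcond.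
have SI := MP h G h0 mG G0.
(* The h^-(sp) of the kernel cancels the h^(sp) of the L^p estimate, which is why the energy bound
   has a constant independent of [h]. *)
have hsp : h `^ (- (s * p)) * h `^ (s * p) = 1.
  by rewrite -powRD ?addNr ?powRr0// (gt_eqF h0) implybT.
have {}SI : ((B * kappa)%:E * \int[lebesgue_rV2 N]_z S z <=
    (B * M * A)%:E * near_energy (3 * h) v)%E.
  apply: le_trans (lee_wpmul2l Bk0 SI) _.
  rewrite muleA -EFinM (_ : B * kappa * _ = B * M * h `^ (- (s * p)) * kappa); last by ring.
  rewrite EFinM -muleA.
  have BM0 : (0 <= (B * M * h `^ (- (s * p)))%:E)%E.
    by rewrite lee_fin mulr_ge0 ?powR_ge0// mulr_ge0// ltW.
  apply: le_trans (lee_wpmul2l BM0 kG) _.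
  rewrite muleA -EFinM (_ : _ * (A * _) = B * M * A)//.
  by rewrite -[RHS]mulr1 -hsp; ring.
have p20 : (0 <= (2 `^ p)%:E :> \bar R)%E by rewrite lee_fin powR_ge0.
have BMA0 : 0 <= B * M * A by rewrite !mulr_ge0// ltW.
apply: le_trans (lee_wpmul2l p20 (leeD (lexx _) SI)) _.
rewrite -[X in (X + _)%E]mul1e -ge0_muleDl ?lee_fin// muleA -EFinD -EFinM.
by apply: lee_wpmul2r => //; rewrite lee_fin /C lerDr.
Qed.

End quasi_interpolation.

(** * Gagliardo energy of Sobolev functions *)

Section sobolev_functions.
Context {R : realType} {N : nat}.
Local Notation X := ('rV[R]_N).
Local Notation mu := (lebesgue_rV N : {measure set X -> \bar R}).
Local Notation mu2 := (lebesgue_rV2 N).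
Variables (s p : R).
Hypotheses (s0 : 0 < s) (p1 : 1 < p).

Let p0 : 0 < p. Proof. exact: lt_trans p1. Qed.

Lemma sobolevP (u : X -> R) : sobolev s p u <->
  u \in Lfun mu p%:E /\ sp_grad s p u \in Lfun mu2 p%:E.
Proof.
split=> [[Lu gu]|[Lu Lgu]]; split=> //.
  have mu_ := Lfun_measurable _ _ _ Lu.
  rewrite inE; apply/andP; split; rewrite inE/=; first exact: measurable_sp_grad.
  by rewrite /finite_norm Lnorm_sp_grad.
rewrite -Lnorm_sp_grad// -ge0_fin_numE ?Lnorm_ge0//.
exact: Lnorm_fin_num.
Qed.

Lemma gagliardo_fin (u : X -> R) : sobolev s p u -> gagliardo s p u \is a fin_num.
Proof. by case=> _ gu; rewrite ge0_fin_numE// poweR_ge0. Qed.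

Lemma gagliardo_powE (u : X -> R) :
  (gagliardo s p u `^ p = \int[mu2]_z (`|sp_grad s p u z| `^ p)%:E)%E.
Proof. by rewrite -Lnorm_sp_grad// poweR_Lnorm ?gt_eqF. Qed.

Lemma near_energy_le (r : R) (u : X -> R) : measurable_fun setT u ->
  (near_energy s p r u <= gagliardo s p u `^ p)%E.
Proof.
move=> mu_; rewrite gagliardo_powE; apply: ge0_subset_integral => //.
- exact: measurable_strip.
- apply/measurable_EFinP/measurable_norm_powR; exact: measurable_sp_grad.
Qed.

Lemma near_energy_small (u : X -> R) (e : R) : sobolev s p u -> 0 < e ->
  exists2 h : R, 0 < h <= 1 & (near_energy s p (3 * h) u < e%:E)%E.
Proof.
move=> /sobolevP[_ Lg] e0.
have mg := Lfun_measurable _ _ _ Lg.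
pose F := fun z => (`|sp_grad s p u z| `^ p)%:E.
have mF : measurable_fun setT F by apply/measurable_EFinP/measurable_norm_powR.
have IF : mu2.-integrable setT F by apply: Lfun_integrable => //; exact: ltW.
pose f (k : nat) z := (F \_ (strip (3 * k.+1%:R^-1))) z.
have F0 z : (0 <= F z)%E by rewrite lee_fin powR_ge0.
have lim0 : (\int[mu2]_z f k z)%E @[k --> \oo] --> (\int[mu2]_z (cst 0 z))%E.
  apply: (@dominated_cvg _ _ _ mu2 setT measurableT f (cst 0%E) F) => //.
  - move=> k; apply/(measurable_restrictT _ (measurable_strip _)).
    exact: measurable_funTS.
  - move=> z _.
    have [e0z|d0] := eqVneq (`|z.1 - z.2|) 0.
      have Fz : F z = 0%E.
        rewrite /F /sp_grad; move: e0z => /eqP; rewrite normr_eq0 subr_eq0 => /eqP ->.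
        by rewrite subrr mul0r normr0 powR0// gt_eqF.
      rewrite (_ : f ^~ z = cst 0%E); first exact: cvg_cst.
      by apply/funext => k; rewrite /f patchE; case: ifPn.
    have dp : 0 < `|z.1 - z.2| by rewrite lt0r d0/=.
    apply: cvg_near_cst.
    near=> k; rewrite /f patchE memNset// /strip/=; apply/negP; rewrite -leNgt.
    rewrite ler_pdivrMr// mulrC -ler_pdivrMr//.
    apply: (@le_trans _ _ (k%:R : R)); last by rewrite ler_nat.
    by near: k; exact: nbhs_infty_ger.
  - by move=> k z _; rewrite /f patchE; case: ifPn => _; rewrite ?gee0_abs ?abse0.
move: lim0; rewrite integral0 => /fine_cvgP[fin /cvgr0Pnorm_lt/(_ _ e0) lte].
have [k _ /(_ _ (leqnn k)) [kfin ke]] := filterI fin lte.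
exists k.+1%:R^-1; first by rewrite invr_gt0 ltr0n/= invf_le1// ler1n.
rewrite /near_energy integral_mkcond -(fineK kfin) lte_fin.
exact: le_lt_trans (ler_norm _) ke.
Unshelve. all: by end_near. Qed.

Lemma gagliardoZ (c : R) (u : X -> R) : measurable_fun setT u ->
  (gagliardo s p (fun x => (c * u x)%R) = `|c|%:E * gagliardo s p u)%E.
Proof.
move=> mu_; rewrite -!Lnorm_sp_grad// unlock.
have -> : (\int[mu2]_z `|(EFin \o sp_grad s p (fun x => (c * u x)%R)) z| `^ p =
    (`|c| `^ p)%:E * \int[mu2]_z (`|sp_grad s p u z| `^ p)%:E)%E.
  rewrite -ge0_integralZl//.
  - apply: eq_integral => z _; rewrite -EFinM /= -powRM// -normrM.
    by congr (`|_| `^ _)%:E; rewrite /sp_grad; ring.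
  - apply/measurable_EFinP/measurable_norm_powR; exact: measurable_sp_grad.
rewrite poweRM ?lee_fin ?powR_ge0//.
  by rewrite poweR_EFin -powRrM mulfV ?gt_eqF// powRr1.
by apply: integral_ge0 => z _; rewrite lee_fin powR_ge0.
Qed.

Lemma Lnorm_powE d (T : measurableType d) (nu : {measure set T -> \bar R}) (f : T -> R) :
  ('N[nu]_p%:E[EFin \o f] `^ p = \int[nu]_z (`|f z| `^ p)%:E)%E.
Proof. by rewrite poweR_Lnorm ?gt_eqF. Qed.

Lemma integral_powD_le d (T : measurableType d) (nu : {measure set T -> \bar R})
    (A : set T) (f g : T -> R) : measurable A ->
  measurable_fun setT f -> measurable_fun setT g ->
  (\int[nu]_(z in A) (`|f z + g z| `^ p)%:E <=
   (2 `^ p)%:E * (\int[nu]_(z in A) (`|f z| `^ p)%:E + \int[nu]_(z in A) (`|g z| `^ p)%:E))%E.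
Proof.
move=> mA mf mg.
have mfp : measurable_fun A (fun z => (`|f z| `^ p)%:E).
  exact/measurable_funTS/measurable_EFinP/measurable_norm_powR.
have mgp : measurable_fun A (fun z => (`|g z| `^ p)%:E).
  exact/measurable_funTS/measurable_EFinP/measurable_norm_powR.
have f0 z : (0 <= (`|f z| `^ p)%:E)%E by rewrite lee_fin powR_ge0.
have g0 z : (0 <= (`|g z| `^ p)%:E)%E by rewrite lee_fin powR_ge0.
have p20 : (0 <= (2 `^ p)%:E :> \bar R)%E by rewrite lee_fin powR_ge0.
have fg0 z : (0 <= (`|f z| `^ p)%:E + (`|g z| `^ p)%:E)%E by rewrite adde_ge0.
rewrite -ge0_integralD// -ge0_integralZl//; last exact: emeasurable_funD.
apply: ge0_le_integral.
- exact: mA.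
- by move=> z _; rewrite lee_fin powR_ge0.
- exact/measurable_funTS/measurable_EFinP/measurable_norm_powR/measurable_funD.
- by apply: emeasurable_funM; [exact: measurable_cst|exact: emeasurable_funD].
- move=> z _; rewrite -EFinD -EFinM lee_fin.
  apply: le_trans (powRD_le _ _ _ (normr_ge0 _) (normr_ge0 _) (ltW p0)).
  by apply: ge0_ler_powR; rewrite ?nnegrE ?addr_ge0 ?ler_normD// ltW.
Qed.

End sobolev_functions.

(** * Cutoff by the diagonal values of the test function *)

Section cutoff.
Context {R : realType} {N : nat}.
Local Notation X := ('rV[R]_N).
Local Notation mu := (lebesgue_rV N : {measure set X -> \bar R}).
Local Notation mu2 := (lebesgue_rV2 N).
Variables (s p q : R).
Hypotheses (s0 : 0 < s) (s1 : s < 1) (p1 : 1 < p) (q0 : 0 < q)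
  (pq : p^-1 + q^-1 = 1).
Variables (psi : X * X -> R) (L C : R).
Hypotheses (tpsi : test_function setT psi) (L0 : 0 < L) (C0 : 0 < C)
  (psiL : forall x y, psi (x, y) != 0 -> `|x| < L /\ `|y| < L)
  (psiC : forall z, `|psi z| <= C)
  (psi2 : forall x y y', `|psi (x, y) - psi (x, y')| <= C * Num.min 1 `|y - y'|)
  (psi1 : forall x x' y, `|psi (x, y) - psi (x', y)| <= C * Num.min 1 `|x - x'|).

Let p0 : 0 < p. Proof. exact: lt_trans p1. Qed.
Let g (x : X) := psi (x, x).

(** The operator K applied to [w]. Each value of [w] is multiplied by a difference of [psi] in which
    a single variable moves. *)
Definition cutoff_remainder (w : X -> R) (z : X * X) : R :=
  ((psi z - g z.1) * w z.1 - (psi z - g z.2) * w z.2) /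
  enorm (z.1 - z.2) `^ (N%:R / p + s).

Lemma cutoff_split w z : psi z * sp_grad s p w z =
  sp_grad s p (fun x => g x * w x) z + cutoff_remainder w z.
Proof. by rewrite /sp_grad /cutoff_remainder; ring. Qed.

Let mpsi : measurable_fun setT psi.
Proof.
by apply: continuous_measurable_rV2; exact: (test_function_continuous _ _ tpsi).
Qed.

Let mg : measurable_fun setT g.
Proof.
apply: (measurableT_comp mpsi).
by apply/measurable_fun_pairP; split; exact: measurable_id.
Qed.

Let cube_large x : ~ cube (0 : X) L x -> forall y, psi (x, y) = 0 /\ psi (y, x) = 0.
Proof.
move=> xL y; split; apply: contra_notP xL => /eqP /psiL [? ?]; exact/in_cube0.
Qed.

Lemma measurable_cutoff_remainder w : measurable_fun setT w ->
  measurable_fun setT (cutoff_remainder w).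
Proof.
move=> mw; rewrite (_ : cutoff_remainder w = fun z => psi z * sp_grad s p w z -
    sp_grad s p (fun x => g x * w x) z).
  apply: measurable_funB; first by apply: measurable_funM => //; exact: measurable_sp_grad.
  by apply: measurable_sp_grad; exact: measurable_funM.
by apply/funext => z; rewrite cutoff_split [in RHS]addrC addKr.
Qed.

(** The two moduli of continuity produce [trunc_kernel] at scale 1, to which the Schur-type bound
    applies. The constant is that bound times C^p from the moduli and 2^p from splitting the p-th
    power of a sum. *)
Lemma cutoff_remainder_le : exists2 K : R, 0 < K & forall w, measurable_fun setT w ->
  (\int[mu2]_z (`|cutoff_remainder w z| `^ p)%:E <=
   K%:E * \int[mu]_(x in cube (0 : X) L) (`|w x| `^ p)%:E)%E.
Proof.
have [M [M0 MP]] := @integral2_trunc_kernel R N s p s0 s1 p1.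
exists ((2 * C) `^ p * M); first by rewrite mulr_gt0// powR_gt0// mulr_gt0.
move=> w mw; pose f := (fun x => (`|w x| `^ p)%:E) \_ (cube (0 : X) L).
have f0 x : (0 <= f x)%E by rewrite /f patchE; case: ifPn => // _; rewrite lee_fin powR_ge0.
have mf : measurable_fun setT f.
  apply/(measurable_restrictT _ (measurable_cube _ _)).
  exact/measurable_funTS/measurable_EFinP/measurable_norm_powR.
have := MP 1 f ltr01 mf f0; rewrite powR1 mulr1 => MPf.
have CC0 : (0 <= ((2 * C) `^ p)%:E)%E by rewrite lee_fin powR_ge0.
rewrite [X in (_ <= _ * X)%E]integral_mkcond -/f EFinM -muleA.
apply: le_trans (lee_wpmul2l CC0 MPf).
have mT : measurable_fun setT (fun z => ((trunc_kernel s p 1 z)%:E * (f z.1 + f z.2))%E).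
  apply: emeasurable_funM.
    by apply/measurable_EFinP; exact: measurable_trunc_kernel.
  apply: emeasurable_funD.
    exact: (measurableT_comp mf measurable_fst).
  exact: (measurableT_comp mf measurable_snd).
have T0 z : (0 <= (trunc_kernel s p 1 z)%:E * (f z.1 + f z.2))%E.
  by rewrite mule_ge0 ?adde_ge0// lee_fin trunc_kernel_ge0.
rewrite -ge0_integralZl//.
apply: ge0_le_integral.
- exact: measurableT.
- by move=> z _; rewrite lee_fin powR_ge0.
- by apply/measurable_EFinP/measurable_norm_powR; exact: measurable_cutoff_remainder.
- by apply: emeasurable_funM => //; exact: measurable_cst.
case=> x y _.
pose w1 x := `|w x| * \1_(cube (0 : X) L) x.
have w10 a : 0 <= w1 a by rewrite mulr_ge0.
have fE a : f a = (w1 a `^ p)%:E.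
  rewrite /f patchE /w1 indicE; case: ifPn => _; first by rewrite mulr1.
  by rewrite mulr0 powR0 ?gt_eqF.
rewrite !fE -EFinD -!EFinM lee_fin.
have m0 : 0 <= Num.min 1 `|x - y| by rewrite le_min ler01/=.
have num : `|(psi (x, y) - g x) * w x - (psi (x, y) - g y) * w y| <=
    C * Num.min 1 `|x - y| * (w1 x + w1 y).
  rewrite (le_trans (ler_normB _ _))// mulrDr; apply: lerD; rewrite normrM /w1 indicE.
    (* Outside the cube [psi] vanishes along the whole line through [x], in particular on the
       diagonal, so the coefficient of [w x] is 0. *)
    have [xL|xL] := pselect (cube (0 : X) L x).
      by rewrite mem_set// mulr1 ler_wpM2r// distrC psi2.
    have [exy _] := cube_large _ xL y; have [exx _] := cube_large _ xL x.
    by rewrite /g exy exx subrr normr0 mul0r !mulr_ge0// ltW.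
  have [yL|yL] := pselect (cube (0 : X) L y).
    by rewrite mem_set// mulr1 ler_wpM2r// psi1.
  have [_ exy] := cube_large _ yL x; have [_ exx] := cube_large _ yL y.
  by rewrite /g exy exx subrr normr0 mul0r !mulr_ge0// ltW.
rewrite /cutoff_remainder normrM [leLHS]powRM// normfV (ger0_norm (powR_ge0 _ _)).
have De : (N%:R / p + s) * p = N%:R + s * p by rewrite mulrDl divfK// gt_eqF.
rewrite -[in leLHS]powRN -powRrM mulNr powRN De.
rewrite /trunc_kernel/= divr1.
apply: (@le_trans _ _ ((C * Num.min 1 `|x - y| * (w1 x + w1 y)) `^ p /
    enorm (x - y) `^ (N%:R + s * p))).
  rewrite ler_wpM2r ?invr_ge0 ?powR_ge0//; apply: ge0_ler_powR; rewrite ?nnegrE//.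
  - exact: ltW.
  - by rewrite !mulr_ge0 ?addr_ge0// ltW.
have E0 : 0 <= (enorm (x - y) `^ (N%:R + s * p))^-1 by rewrite invr_ge0 powR_ge0.
have C0' := ltW C0.
rewrite (powRM _ (mulr_ge0 C0' m0) (addr_ge0 (w10 x) (w10 y))) (powRM _ C0' m0).
rewrite (powRM _ (ler0n R 2) C0').
have := powRD_le _ _ _ (w10 x) (w10 y) (ltW p0).
have : 0 <= C `^ p * Num.min 1 `|x - y| `^ p * (enorm (x - y) `^ (N%:R + s * p))^-1.
  by rewrite !mulr_ge0 ?powR_ge0.
move: (enorm _ `^ _)^-1 (C `^ p) (Num.min _ _ `^ p) => e a b abe.
move=> /(ler_wpM2l abe) h.
rewrite (_ : a * b * _ * e = a * b * e * (w1 x + w1 y) `^ p); last by ring.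
by apply: le_trans h _; rewrite le_eqVlt; apply/orP; left; apply/eqP; ring.
Qed.

Let gL x : ~ cube (0 : X) L x -> g x = 0.
Proof. by move=> xL; apply: contra_notP xL => /eqP /psiL [? ?]; exact/in_cube0. Qed.

Let mB : measurable (cube (0 : X) L). Proof. exact: measurable_cube. Qed.

Let mBB : measurable (cube (0 : X) L `*` cube (0 : X) L). Proof. exact: measurableX. Qed.

Lemma cutoff_int_le r : measurable_fun setT r ->
  (\int[mu]_x (`|g x * r x| `^ p)%:E <=
   (C `^ p)%:E * \int[mu]_(x in cube (0 : X) L) (`|r x| `^ p)%:E)%E.
Proof.
move=> mr; rewrite [X in (_ <= _ * X)%E]integral_mkcond.
have mrp : measurable_fun setT ((fun x => (`|r x| `^ p)%:E) \_ (cube (0 : X) L)).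
  apply/(measurable_restrictT _ mB).
  exact/measurable_funTS/measurable_EFinP/measurable_norm_powR.
have r0 x : (0 <= ((fun x => (`|r x| `^ p)%:E) \_ (cube (0 : X) L)) x)%E.
  by rewrite patchE; case: ifPn => // _; rewrite lee_fin powR_ge0.
rewrite -ge0_integralZl//; last by rewrite lee_fin powR_ge0.
apply: ge0_le_integral.
- exact: measurableT.
- by move=> x _; rewrite lee_fin powR_ge0.
- by apply/measurable_EFinP/measurable_norm_powR; exact: measurable_funM.
- by apply: emeasurable_funM; [exact: measurable_cst|exact: mrp].
move=> x _; rewrite patchE; case: ifPn => [xL|/negP xL].
  rewrite -EFinM lee_fin normrM powRM// ler_wpM2r ?powR_ge0//.
  by apply: ge0_ler_powR; rewrite ?nnegrE ?psiC// ltW.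
by rewrite gL ?mul0r ?normr0 ?powR0 ?mule0 ?gt_eqF// => /mem_set.
Qed.

(** The splitting identity solved for D (g r): [psi] restricts the first term to cube times cube,
    and the remainder is already controlled on the cube. Thus only local information on [r] bounds a
    global energy. *)
Lemma cutoff_grad_le : exists2 K : R, 0 < K & forall r, measurable_fun setT r ->
  (\int[mu2]_z (`|sp_grad s p (fun x => g x * r x) z| `^ p)%:E <= K%:E *
   (\int[mu2]_(z in cube (0 : X) L `*` cube (0 : X) L) (`|sp_grad s p r z| `^ p)%:E +
    \int[mu]_(x in cube (0 : X) L) (`|r x| `^ p)%:E))%E.
Proof.
have [K K0 KP] := cutoff_remainder_le.
exists (2 `^ p * (C `^ p + K)); first by rewrite mulr_gt0 ?powR_gt0// addr_gt0 ?powR_gt0.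
move=> r mr.
have mDr := measurable_sp_grad s p mr.
have mrem := measurable_cutoff_remainder r mr.
have -> : sp_grad s p (fun x => g x * r x) =
    (fun z => psi z * sp_grad s p r z + - cutoff_remainder r z).
  by apply/funext => z; rewrite cutoff_split addrK.
have m1 : measurable_fun setT (fun z => psi z * sp_grad s p r z) by exact: measurable_funM.
have m2 : measurable_fun setT (fun z => - cutoff_remainder r z).
  exact: measurableT_comp.
apply: le_trans (integral_powD_le p p1 _ _ _ setT _ _ measurableT m1 m2) _.
rewrite EFinM -muleA; apply: lee_wpmul2l; first by rewrite lee_fin powR_ge0.
set I1 := (\int[mu2]_(z in _ `*` _) _)%E; set I2 := (\int[mu]_(x in _) _)%E.
have I10 : (0 <= I1)%E by apply: integral_ge0 => z _; rewrite lee_fin powR_ge0.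
have I20 : (0 <= I2)%E by apply: integral_ge0 => z _; rewrite lee_fin powR_ge0.
have Cp0 : (0 <= (C `^ p)%:E)%E by rewrite lee_fin powR_ge0.
have K0' : (0 <= K%:E)%E by rewrite lee_fin ltW.
rewrite EFinD ge0_muleDl//; apply: leeD.
  apply: (@le_trans _ _ ((C `^ p)%:E * I1)%E); last first.
    by apply: lee_wpmul2l => //; rewrite leeDl.
  rewrite /I1 [X in (_ <= _ * X)%E]integral_mkcond.
  have mrp : measurable_fun setT ((fun z => (`|sp_grad s p r z| `^ p)%:E) \_
      (cube (0 : X) L `*` cube (0 : X) L)).
    apply/(measurable_restrictT _ mBB).
    exact/measurable_funTS/measurable_EFinP/measurable_norm_powR.
  have r0 z : (0 <= ((fun z => (`|sp_grad s p r z| `^ p)%:E) \_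
      (cube (0 : X) L `*` cube (0 : X) L)) z)%E.
    by rewrite patchE; case: ifPn => // _; rewrite lee_fin powR_ge0.
  rewrite -ge0_integralZl//.
  apply: ge0_le_integral.
  - exact: measurableT.
  - by move=> z _; rewrite lee_fin powR_ge0.
  - exact/measurable_EFinP/measurable_norm_powR.
  - by apply: emeasurable_funM; [exact: measurable_cst|exact: mrp].
  case=> x y _; rewrite patchE; case: ifPn => [xyL|/negP xyL].
    rewrite -EFinM lee_fin normrM powRM// ler_wpM2r ?powR_ge0//.
    by apply: ge0_ler_powR; rewrite ?nnegrE ?psiC// ltW.
  have -> : psi (x, y) = 0.
    apply: contra_notP xyL => /eqP /psiL [? ?]; apply/mem_set.
    by split; exact/in_cube0.
  by rewrite mul0r normr0 powR0 ?mule0 ?gt_eqF.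
apply: (@le_trans _ _ (K%:E * I2)%E); last first.
  by apply: lee_wpmul2l => //; rewrite leeDr.
by under eq_integral do rewrite normrN; exact: KP.
Qed.

Lemma sobolev_cutoff d : sobolev s p d -> sobolev s p (fun x => g x * d x).
Proof.
move=> /sobolevP [//|Ld Lgd]; apply/sobolevP => //.
have md := Lfun_measurable _ _ _ Ld.
have fin_le (c : R) (I : \bar R) (I' : \bar R) : (I <= c%:E * I')%E -> (0 <= I')%E ->
    (I' < +oo)%E -> (I < +oo)%E.
  move=> II' I0 Ioo; apply: (le_lt_trans II').
  by rewrite ltey_eq fin_numM// ge0_fin_numE.
have dB : (\int[mu]_(x in cube (0 : X) L) (`|d x| `^ p)%:E < +oo)%E.
  have [_] := (LfunP_int _ _ _ p0).1 Ld; apply: le_lt_trans.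
  apply: ge0_subset_integral => //.
  exact/measurable_EFinP/measurable_norm_powR.
have dB0 : (0 <= \int[mu]_(x in cube (0 : X) L) (`|d x| `^ p)%:E)%E.
  by apply: integral_ge0 => z _; rewrite lee_fin powR_ge0.
split.
  apply/(LfunP_int _ _ _ p0); split; first exact: measurable_funM.
  by apply: fin_le (cutoff_int_le d md) _ _.
apply/(LfunP_int _ _ _ p0); split.
  by apply: measurable_sp_grad; exact: measurable_funM.
have [K K0 KP] := cutoff_grad_le.
apply: fin_le (KP d md) _ _.
  by apply: adde_ge0 => //; apply: integral_ge0 => z _; rewrite lee_fin powR_ge0.
rewrite lte_add_pinfty//.
have [_] := (LfunP_int _ _ _ p0).1 Lgd; apply: le_lt_trans.
apply: ge0_subset_integral => //.
apply/measurable_EFinP/measurable_norm_powR; exact: measurable_sp_grad.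
Qed.

Lemma sobolev_norm_powE (u : X -> R) : (sobolev_norm s p u =
  (\int[mu]_x (`|u x| `^ p)%:E + \int[mu2]_z (`|sp_grad s p u z| `^ p)%:E) `^ p^-1)%E.
Proof. by rewrite /sobolev_norm gagliardo_powE// Lnorm_powE. Qed.

(** The approximant is [g] times the interpolant of [d]: smooth, with the support of [g]. The error
    is [g] times the interpolation error, whose local bounds vanish with the near energy of [d]. *)
Lemma sobolev0_cutoff d : sobolev s p d ->
  sobolev0 s p (ball 0 (L + 1)) (fun x => g x * d x).
Proof.
move=> Sd; split; first exact: sobolev_cutoff.
move=> e e0; have [Ld _] := (sobolevP s p p1 d).1 Sd.
have [K K0 KP] := cutoff_grad_le.
have [Cq Cq0 CqP] := @quasi_interpolation R N s p q s0 s1 p1 q0 pq L L0.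
have Cp0 : 0 < C `^ p by rewrite powR_gt0.
(* The L^p part of the error costs C^p Cq, the gradient part K times the sum of two errors, each at
   most Cq times the near energy. *)
pose A := (C `^ p + K) * Cq + K * Cq.
have A0 : 0 < A by rewrite addr_gt0 ?mulr_gt0 ?addr_gt0.
have [h /andP[h0 h1] hT] := near_energy_small s p p1 d (e `^ p / A) Sd
  (divr_gt0 (powR_gt0 p e0) A0).
have [J [Q [a [Ca _ _]]]] := CqP h h0.
move=> /(_ d Ld) /=; set r := fun x => d x - _ => -[E1 E2].
pose I x := \sum_j cell_mean h d (Q j) * a j x.
have CI k : Ck k I.
  apply: (Ck_sum k _ _ (fun j x => cell_mean h d (Q j) * a j x)) => j.
  by apply: CkZ; exact: Ca.
exists (fun x => g x * I x).
  by apply: test_functionM CI; exact: test_function_diagonal.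
have -> : (fun x => (g x * d x - g x * I x)%R) = (fun x => g x * r x).
  by apply/funext => x; rewrite /r mulrBr.
have mr : measurable_fun setT r.
  apply: measurable_funB; first exact: Lfun_measurable Ld.
  by apply: continuous_measurable_rV; exact: (Ck_continuous 0 _ (CI 0)).
rewrite sobolev_norm_powE.
set T := near_energy _ _ _ _ in hT E1 E2.
have T0 : (0 <= T)%E by apply: integral_ge0 => z _; rewrite lee_fin powR_ge0.
have hsp : h `^ (s * p) <= 1.
  have -> : (1 : R) = 1 `^ (s * p) by rewrite powR1.
  by apply: ge0_ler_powR; rewrite ?nnegrE ?(ltW h0)// mulr_ge0 ?ltW.
have E1' : (\int[mu]_(x in cube (0 : X) L) (`|r x| `^ p)%:E <= Cq%:E * T)%E.
  apply: le_trans E1 _; apply: lee_wpmul2r => //.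
  by rewrite lee_fin ler_piMr// ltW.
have TE : T = (fine T)%:E.
  rewrite fineK// ge0_fin_numE//; apply: lt_trans hT _; exact: ltry.
have S : (\int[mu]_x (`|g x * r x| `^ p)%:E +
    \int[mu2]_z (`|sp_grad s p (fun x => g x * r x) z| `^ p)%:E <= (A * fine T)%:E)%E.
  have K0' : (0 <= K%:E)%E by rewrite lee_fin ltW.
  have Cp0' : (0 <= (C `^ p)%:E)%E by rewrite lee_fin ltW.
  have B1 := le_trans (cutoff_int_le r mr) (lee_wpmul2l Cp0' E1').
  have B2 := le_trans (KP r mr) (lee_wpmul2l K0' (leeD E2 E1')).
  apply: le_trans (leeD B1 B2) _.
  rewrite TE -!EFinM -!EFinD lee_fin /A le_eqVlt; apply/orP; left; apply/eqP.
  ring.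
set Y := (_ + _)%E in S *.
have Y0 : (0 <= Y)%E.
  by apply: adde_ge0; apply: integral_ge0 => z _; rewrite lee_fin powR_ge0.
have YE : Y = (fine Y)%:E.
  by rewrite fineK// ge0_fin_numE//; apply: le_lt_trans S _; exact: ltry.
rewrite YE poweR_EFin lte_fin.
have -> : e = (e `^ p) `^ p^-1 by rewrite -powRrM mulfV ?gt_eqF// powRr1// ltW.
apply: gt0_ltr_powR; rewrite ?nnegrE ?invr_gt0 ?powR_ge0//.
  by rewrite -lee_fin -YE.
move: hT S; rewrite TE YE lte_fin lee_fin => hT S; apply: le_lt_trans S _.
by rewrite mulrC -ltr_pdivlMr.
Qed.

End cutoff.

Lemma bounded_mul_Lfun {d} {T : measurableType d} {R : realType}
    (nu : {measure set T -> \bar R}) (p C : R) (f g : T -> R) : 0 < p -> 0 <= C ->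
  measurable_fun setT g -> (forall x, `|g x| <= C) -> f \in Lfun nu p%:E ->
  (fun x => g x * f x) \in Lfun nu p%:E.
Proof.
move=> p0 C0 mg gC Lf; have mf := Lfun_measurable nu p f Lf.
apply: (LfunP_int nu p _ p0).2; split; first exact: measurable_funM.
have [_ foo] := (LfunP_int nu p f p0).1 Lf.
have Cp0 : (0 <= (C `^ p)%:E :> \bar R)%E by rewrite lee_fin powR_ge0.
have mfp : measurable_fun setT (fun x => (`|f x| `^ p)%:E).
  exact/measurable_EFinP/measurable_norm_powR.
have f0 x : (0 <= (`|f x| `^ p)%:E)%E by rewrite lee_fin powR_ge0.
apply: (@le_lt_trans _ _ ((C `^ p)%:E * \int[nu]_x (`|f x| `^ p)%:E)%E); last first.
  by rewrite ltey_eq fin_numM// ge0_fin_numE// integral_ge0.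
rewrite -ge0_integralZl//; apply: ge0_le_integral.
- exact: measurableT.
- by move=> x _; rewrite lee_fin powR_ge0.
- exact/measurable_EFinP/measurable_norm_powR/measurable_funM.
- by apply: emeasurable_funM; [exact: measurable_cst|exact: mfp].
move=> x _; rewrite -EFinM lee_fin normrM powRM// ler_wpM2r ?powR_ge0//.
by apply: ge0_ler_powR; rewrite ?nnegrE ?gC// ltW.
Qed.

Lemma Lnorm_le_of_pow {d} {T : measurableType d} {R : realType}
    (nu : {measure set T -> \bar R}) (p b : R) (f : T -> R) : 0 < p -> 0 <= b ->
  (\int[nu]_x (`|f x| `^ p)%:E <= (b `^ p)%:E)%E ->
  ('N[nu]_p%:E[EFin \o f] <= b%:E)%E.
Proof.
move=> p0 b0 fb; rewrite unlock.
have -> : (b%:E = (b `^ p)%:E `^ p^-1)%E.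
  by rewrite poweR_EFin -powRrM mulfV ?gt_eqF// powRr1.
apply: gt0_ler_poweR => //.
- by rewrite invr_ge0 ltW.
- by rewrite in_itv/= leey andbT; apply: integral_ge0 => x _; rewrite lee_fin powR_ge0.
- by rewrite in_itv/= leey lee_fin powR_ge0.
Qed.

(** * Local compactness *)

Section compactness.
Context {R : realType} {N : nat}.
Local Notation X := ('rV[R]_N).
Local Notation mu := (lebesgue_rV N : {measure set X -> \bar R}).
Local Notation mu2 := (lebesgue_rV2 N).
Variables (s p q : R).
Hypotheses (s0 : 0 < s) (s1 : s < 1) (p1 : 1 < p) (q0 : 0 < q)
  (pq : p^-1 + q^-1 = 1).

Let p0 : 0 < p. Proof. exact: lt_trans p1. Qed.

(** No subsequence is extracted. At a fixed scale the interpolation error is small uniformly in [n]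
    by the energy bound, and the interpolant has finitely many coefficients, each an average tending
    to 0. *)
Lemma rellich (d : nat -> X -> R) (G : R) :
  (forall n, sobolev s p (d n)) -> (forall n, (gagliardo s p (d n) <= G%:E)%E) ->
  (forall A, measurable A -> (mu A < +oo)%E ->
    (\int[mu]_(x in A) d n x) @[n --> \oo] --> (0 : R)) ->
  forall L e : R, 0 < L -> 0 < e ->
  \forall n \near \oo, (\int[mu]_(x in cube (0 : X) L) (`|d n x| `^ p)%:E < e%:E)%E.
Proof.
move=> Sd Gd wd L e L0 e0.
have G0 : 0 <= G.
  by rewrite -lee_fin; apply: le_trans (Gd 0%N); exact: poweR_ge0.
have [Cq Cq0 CqP] := @quasi_interpolation R N s p q s0 s1 p1 q0 pq L L0.
have sp0 : 0 < s * p by rewrite mulr_gt0.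
(* The scale makes the interpolation error at most e / 4 / 2^p. Adding 1 to the energy bound keeps
   [A] positive when the bound is 0. *)
pose A := 2 `^ p * Cq * (G `^ p + 1) : R.
have A0 : 0 < A by rewrite !mulr_gt0 ?powR_gt0// ltr_wpDl ?powR_ge0.
pose h := (e / 4 / A) `^ (s * p)^-1.
have h0 : 0 < h by rewrite powR_gt0// !divr_gt0.
have hE : h `^ (s * p) = e / 4 / A.
  by rewrite /h -powRrM mulVf ?gt_eqF// powRr1// !divr_ge0// ltW.
have [J [Q [a [Ca a1 mQ ]]]] := CqP h h0.
move=> /(_ (d _) ((sobolevP s p p1 (d _)).1 (Sd _)).1) /= E12.
have mB : measurable (cube (0 : X) L) by exact: measurable_cube.
(* A function bounded by [t] has p-th power integral at most e / 4 / 2^p over the cube; both halves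
   together, times 2^p, give e / 2. *)
pose B := 2 `^ p * (2 * L) ^+ N : R.
have B0 : 0 < B by rewrite mulr_gt0 ?powR_gt0// exprn_gt0// mulr_gt0.
pose t := (e / 4 / B) `^ p^-1.
have t0 : 0 < t by rewrite powR_gt0// !divr_gt0.
have tE : t `^ p = e / 4 / B.
  by rewrite /t -powRrM mulVf ?gt_eqF// powRr1// !divr_ge0// ltW.
(* The bound [t] is shared among the coefficients; the successor keeps the denominator nonzero. *)
pose tJ := t / (#|J|.+1%:R).
have tJ0 : 0 < tJ by rewrite divr_gt0.
have near_c : \forall n \near \oo, forall j, `|cell_mean h (d n) (Q j)| <= tJ.
  apply: filter_forall => j.
  have [mQj muQj] := mQ j.
  have c0 : cell_mean h (d n) (Q j) @[n --> \oo] --> (0 : R).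
    rewrite -(mulr0 (h ^+ N)^-1); apply: cvgM; first exact: cvg_cst.
    by apply: wd => //; rewrite muQj ltry.
  exact: (cvgr0Pnorm_le _).1 c0 _ tJ0.
near=> n.
have cn : forall j, `|cell_mean h (d n) (Q j)| <= tJ by near: n.
have md : measurable_fun setT (d n).
  by have [Ld _] := Sd n; exact: Lfun_measurable Ld.
pose I x := \sum_j cell_mean h (d n) (Q j) * a j x.
have mI : measurable_fun setT I.
  apply: continuous_measurable_rV; apply: (Ck_continuous 0).
  apply: (Ck_sum 0 _ _ (fun j x => cell_mean h (d n) (Q j) * a j x)) => j.
  by apply: CkZ; exact: Ca.
have It x : `|I x| <= t.
  apply: le_trans (ler_norm_sum _ _ _) _.
  apply: (@le_trans _ _ (\sum_(j : J) tJ)).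
    apply: ler_sum => j _; rewrite normrM -[leRHS]mulr1.
    by apply: ler_pM; rewrite ?cn ?a1.
  rewrite sumr_const -[leLHS]mulr_natl /tJ mulrCA ler_piMr ?(ltW t0)//.
  by rewrite ler_pdivrMr// mul1r ler_nat.
have [E1 _] := E12 n.
pose r x := d n x - I x.
have mr : measurable_fun setT r by exact: measurable_funB.
have := integral_powD_le p p1 _ _ mu (cube (0 : X) L) r I mB mr mI.
under eq_integral do rewrite subrK.
have p20 : (0 <= (2 `^ p)%:E :> \bar R)%E by rewrite lee_fin powR_ge0.
have E1' : (\int[mu]_(x in cube (0 : X) L) (`|r x| `^ p)%:E <= (e / 4 / (2 `^ p))%:E)%E.
  apply: le_trans E1 _.
  have : (near_energy s p (3 * h) (d n) <= (G `^ p)%:E)%E.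
    apply: le_trans (near_energy_le s p p1 _ _ md) _.
    rewrite -poweR_EFin; apply: gt0_ler_poweR => //.
    - exact: ltW.
    - by rewrite in_itv/= leey poweR_ge0.
    - by rewrite in_itv/= leey lee_fin G0.
  have Ch0 : (0 <= (Cq * h `^ (s * p))%:E)%E by rewrite lee_fin mulr_ge0 ?powR_ge0// ltW.
  move=> /(lee_wpmul2l Ch0) h'; apply: le_trans h' _.
  rewrite -EFinM lee_fin hE /A.
  have Gp0 : 0 <= G `^ p by exact: powR_ge0.
  have P2 : 0 < 2 `^ p :> R by rewrite powR_gt0.
  move: (G `^ p) (2 `^ p) Gp0 P2 => g P g0 P0.
  have g1 : 0 < g + 1 by rewrite ltr_wpDl.
  rewrite (_ : _ * g = e / 4 / P * (g / (g + 1))); last first.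
    by field; rewrite !gt_eqF.
  by rewrite ler_piMr ?ler_pdivrMr ?mul1r ?lerDl// !divr_ge0// ltW.
have E2' : (\int[mu]_(x in cube (0 : X) L) (`|I x| `^ p)%:E <= (e / 4 / (2 `^ p))%:E)%E.
  apply: (@le_trans _ _ (\int[mu]_(x in cube (0 : X) L) (t `^ p)%:E)%E).
    apply: ge0_le_integral => //.
    - by apply/measurable_funTS/measurable_EFinP/measurable_norm_powR.
    - move=> x _; rewrite lee_fin; apply: ge0_ler_powR; rewrite ?nnegrE//; exact: ltW.
  rewrite integral_cst// lebesgue_rV_cube// -EFinM lee_fin tE /B.
  have P2 : 2 `^ p != 0 :> R by rewrite gt_eqF// powR_gt0.
  have LN : (2 * L) ^+ N != 0 by rewrite gt_eqF// exprn_gt0// mulr_gt0.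
  move: (2 `^ p) ((2 * L) ^+ N) P2 LN => P V P2 LN.
  by rewrite le_eqVlt; apply/orP; left; apply/eqP; field; rewrite P2 LN.
move=> H; apply: le_lt_trans H _.
apply: le_lt_trans (lee_wpmul2l p20 (leeD E1' E2')) _.
rewrite -EFinD -EFinM lte_fin.
have P2 : 2 `^ p != 0 :> R by rewrite gt_eqF// powR_gt0.
have -> : 2 `^ p * (e / 4 / 2 `^ p + e / 4 / 2 `^ p) = e / 2.
  by move: (2 `^ p) P2 => P P2; field.
by rewrite ltr_pdivrMr// ltr_pMr// ltr1n.
Unshelve. all: by end_near. Qed.

End compactness.

(** * Consequences of weak convergence *)

Section weak_limits.
Context {R : realType} {N : nat}.
Local Notation X := ('rV[R]_N).
Local Notation mu := (lebesgue_rV N : {measure set X -> \bar R}).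
Local Notation mu2 := (lebesgue_rV2 N).
Variables (s p q : R).
Hypotheses (p1 : 1 < p) (q0 : 0 < q) (pq : p^-1 + q^-1 = 1).

Let p0 : 0 < p. Proof. exact: lt_trans p1. Qed.

Lemma sp_grad_lin (a : R) (u v : X -> R) :
  sp_grad s p (fun x => a * u x + v x) = (fun z => a * sp_grad s p u z + sp_grad s p v z).
Proof. by apply/funext => z; rewrite /sp_grad; ring. Qed.

Lemma sobolev_lin (a : R) (u v : X -> R) : sobolev s p u -> sobolev s p v ->
  sobolev s p (fun x => a * u x + v x).
Proof.
move=> /(sobolevP s p p1)[Lu Gu] /(sobolevP s p p1)[Lv Gv]; apply/(sobolevP s p p1).
by split; [|rewrite sp_grad_lin]; apply: Lfun_lin => //; exact: ltW.
Qed.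

Lemma subfunE (u v : X -> R) : (fun x => u x - v x) = (fun x => (-1) * v x + u x).
Proof. by apply/funext => x; rewrite mulN1r addrC. Qed.

Lemma sobolevB (u v : X -> R) : sobolev s p u -> sobolev s p v ->
  sobolev s p (fun x => u x - v x).
Proof. by move=> Su Sv; rewrite subfunE; exact: sobolev_lin. Qed.

Lemma Lnorm_le_sobolev_norm (u : X -> R) :
  ('N[mu]_p%:E[EFin \o u] <= sobolev_norm s p u)%E.
Proof.
rewrite -[leLHS]poweRe1 ?Lnorm_ge0// -(mulfV (lt0r_neq0 p0)) poweRrM.
apply: gt0_ler_poweR.
- by rewrite invr_ge0 ltW.
- by rewrite in_itv/= leey poweR_ge0.
- by rewrite in_itv/= leey adde_ge0 ?poweR_ge0.
- by rewrite leeDl ?poweR_ge0.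
Qed.

Variables (v_ : nat -> X -> R) (v0 : X -> R).
Hypotheses (v_W : forall n, sobolev s p (v_ n)) (v0_W : sobolev s p v0)
  (v_cvg : sobolev_weak_cvg s p v_ v0).

(** A functional on L^p of the product space, composed with the gradient, is continuous on the
    Sobolev space because the seminorm is at most the norm. *)
Lemma weak_cvg_sp_grad F :
  continuous_dual [set f | f \in Lfun mu2 p%:E] (fun f => 'N[mu2]_p%:E[EFin \o f])%E F ->
  F (sp_grad s p (fun x => v_ n x - v0 x)) @[n --> \oo] --> (0 : R).
Proof.
move=> [Flin [C FC]].
have grad u : sobolev s p u -> sp_grad s p u \in Lfun mu2 p%:E.
  by move=> /(sobolevP s p p1)[].
have C0 : 0 <= `|C| by [].
have D : continuous_dual (sobolev s p) (sobolev_norm s p) (fun u => F (sp_grad s p u)).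
  split; first by move=> a u v Su Sv; rewrite sp_grad_lin Flin//; exact: grad.
  exists `|C| => u Su; apply: le_trans (FC _ (grad _ Su)) _.
  apply: (@le_trans _ _ (`|C|%:E * 'N[mu2]_p%:E[EFin \o sp_grad s p u])%E).
    by apply: lee_wpmul2r; [exact: Lnorm_ge0|rewrite lee_fin ler_norm].
  apply: lee_wpmul2l; first by rewrite lee_fin.
  by rewrite Lnorm_sp_grad//; exact: gagliardo_le_norm.
have FE n : F (sp_grad s p (fun x => v_ n x - v0 x)) =
    F (sp_grad s p (v_ n)) - F (sp_grad s p v0).
  by rewrite subfunE sp_grad_lin Flin ?mulN1r 1?addrC//; exact: grad.
under eq_fun do rewrite FE.
by rewrite -(subrr (F (sp_grad s p v0))); apply: cvgB; [exact: v_cvg D|exact: cvg_cst].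
Qed.

(** Integration over a set of finite measure is the pairing with an indicator in L^q; this supplies
    the averages needed for compactness. *)
Lemma weak_cvg_integral_set A : measurable A -> (mu A < +oo)%E ->
  (\int[mu]_(x in A) (v_ n x - v0 x)) @[n --> \oo] --> (0 : R).
Proof.
move=> mA Aoo.
have [LA _] := indic_Lfun mu A q q0 mA Aoo.
have [Flin [C FC]] := Lfun_pairing_dual mu p q _ p1 pq q0 LA.
pose F (u : X -> R) := \int[mu]_x (u x * \1_A x).
have Lu u : sobolev s p u -> u \in Lfun mu p%:E by case.
have D : continuous_dual (sobolev s p) (sobolev_norm s p) F.
  split; first by move=> a u v Su Sv; apply: Flin; exact: Lu.
  exists `|C| => u Su; apply: le_trans (FC _ (Lu _ Su)) _.
  apply: (@le_trans _ _ (`|C|%:E * 'N[mu]_p%:E[EFin \o u])%E).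
    by apply: lee_wpmul2r; [exact: Lnorm_ge0|rewrite lee_fin ler_norm].
  by apply: lee_wpmul2l; [rewrite lee_fin|exact: Lnorm_le_sobolev_norm].
have FE n : \int[mu]_(x in A) (v_ n x - v0 x) = F (v_ n) - F v0.
  have -> : F (v_ n) - F v0 = F (fun x => (-1) * v0 x + v_ n x).
    by rewrite [RHS]Flin ?mulN1r 1?addrC//; exact: Lu.
  rewrite -subfunE Rintegral_mkcond /F; apply: eq_Rintegral => x _.
  by rewrite patchE indicE; case: ifPn => _; rewrite ?mulr1 ?mulr0.
under eq_fun do rewrite FE.
by rewrite -(subrr (F v0)); apply: cvgB; [exact: v_cvg D|exact: cvg_cst].
Qed.

End weak_limits.

(** * The dual norm and the divergence *)

(** Normalisation of [u] by its seminorm, with both signs. Homogeneity and membership in [sobolev0]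
    are required along the line of [u] only, where they are directly available. When the seminorm is
    0 no multiple is admissible in the supremum, so vanishing of [F u] is asked separately. *)
Lemma sobolev_dual_norm_bound {R : realType} {N : nat} (s p : R)
    (Omega : set 'rV[R]_N) (F : ('rV[R]_N -> R) -> R) (u : 'rV[R]_N -> R) : 1 < p ->
  sobolev s p u ->
  (forall c : R, sobolev0 s p Omega (fun x => c * u x)) ->
  (forall c : R, F (fun x => c * u x) = c * F u) ->
  (gagliardo s p u = 0%E -> F u = 0) ->
  (`|F u|%:E <= sobolev_dual_norm s p Omega F * gagliardo s p u)%E.
Proof.
move=> p1 Su S0u FZ Fnull; have p0 : 0 < p by exact: lt_trans p1.
have gfin := gagliardo_fin s p u Su.
have N0 : (0 <= sobolev_dual_norm s p Omega F)%E by rewrite /sobolev_dual_norm le_max lexx.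
have g0 : (0 <= gagliardo s p u)%E by exact: poweR_ge0.
have [/Fnull ->|gn0] := eqVneq (gagliardo s p u) 0%E; first by rewrite normr0 mule_ge0.
have mu_ : measurable_fun setT u by have [Lu _] := Su; exact: Lfun_measurable Lu.
pose G := fine (gagliardo s p u).
have GE : gagliardo s p u = G%:E by rewrite fineK.
have G0 : 0 < G by rewrite -lte_fin -GE lt0e gn0.
have key (c : R) : `|c| = 1 -> ((c * F u)%:E <= sobolev_dual_norm s p Omega F * G%:E)%E.
  move=> c1; rewrite -lee_pdivrMr// -EFinM.
  rewrite (_ : c * F u / G = F (fun x => c / G * u x)); last by rewrite FZ; ring.
  rewrite /sobolev_dual_norm le_max; apply/orP; right; apply: ereal_sup_ubound.
  exists (fun x => c / G * u x) => //; split => //.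
  rewrite gagliardoZ// GE -EFinM normrM c1 mul1r gtr0_norm ?invr_gt0// mulVf//.
  by rewrite gt_eqF.
rewrite GE; have [Fu|Fu] := leP 0 (F u).
  by have := key 1 (normr1 _); rewrite mul1r ger0_norm.
by have := key (-1) (normrN1 _); rewrite mulN1r ltr0_norm.
Qed.

Lemma sobolevZ {R : realType} {N : nat} (s p c : R) (u : 'rV[R]_N -> R) : 1 < p ->
  sobolev s p u -> sobolev s p (fun x => c * u x).
Proof.
move=> p1 Su; have -> : (fun x => c * u x) = (fun x => (c - 1) * u x + u x).
  by apply/funext => x; ring.
exact: (sobolev_lin s p p1 _ _ _ Su Su).
Qed.

Lemma sp_div_sub_le {R : realType} {N : nat} (s p q : R) (Omega : set 'rV[R]_N)
    (phi phi0 : 'rV[R]_N * 'rV[R]_N -> R) (w : 'rV[R]_N -> R) :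
  1 < p -> 0 < q -> q^-1 + p^-1 = 1 ->
  phi \in Lfun (lebesgue_rV2 N) q%:E -> phi0 \in Lfun (lebesgue_rV2 N) q%:E ->
  sobolev s p w -> (forall c : R, sobolev0 s p Omega (fun x => c * w x)) ->
  (`|\int[lebesgue_rV2 N]_z ((phi z - phi0 z) * sp_grad s p w z)|%:E <=
   sobolev_dual_norm s p Omega (fun u => (sp_div s p phi u - sp_div s p phi0 u)%R) *
   gagliardo s p w)%E.
Proof.
move=> p1 q0 qp Lphi Lphi0 Sw S0w; have p0 : 0 < p by exact: lt_trans p1.
have q1 : 1 <= q.
  by move: qp => /eqP; rewrite eq_sym -subr_eq => /eqP/esym e;
     rewrite -[q]invrK invf_ge1 ?invr_gt0// e gerBl invr_ge0 ltW.
have grad u : sobolev s p u -> sp_grad s p u \in Lfun (lebesgue_rV2 N) p%:E.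
  by move=> /(sobolevP s p p1)[].
have LD : (fun z => phi z - phi0 z) \in Lfun (lebesgue_rV2 N) q%:E by exact: LfunB.
pose F u := sp_div s p phi u - sp_div s p phi0 u; rewrite -/F.
have Fint u : sobolev s p u ->
    F u = \int[lebesgue_rV2 N]_z ((phi z - phi0 z) * sp_grad s p u z).
  move=> Su.
  have [I1 _] := Lfun_hoelder _ _ _ _ _ q0 p0 qp Lphi (grad _ Su).
  have [I2 _] := Lfun_hoelder _ _ _ _ _ q0 p0 qp Lphi0 (grad _ Su).
  rewrite /F /sp_div -(RintegralB measurableT I1 I2); apply: eq_Rintegral => z _.
  by rewrite mulrBl.
have [I1 Ile] := Lfun_hoelder _ _ _ _ _ q0 p0 qp LD (grad _ Sw).
rewrite -(Fint w Sw); apply: (sobolev_dual_norm_bound s p Omega F w p1 Sw S0w).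
- move=> c; rewrite (Fint _ (sobolevZ s p c w p1 Sw)) (Fint w Sw).
  rewrite -(RintegralZl c measurableT I1); apply: eq_Rintegral => z _.
  by rewrite /sp_grad; ring.
(* Hölder's inequality bounds the integral by a multiple of the seminorm, which settles the
   degenerate case. *)
- move=> g0; rewrite (Fint w Sw); move: Ile.
  by rewrite (Lnorm_sp_grad s w p0) g0 mule0 lee_fin normr_le0 => /eqP.
Qed.

(** * Passage to the limit in the product *)

Theorem lemma3p3 (R : realType) (N : nat) (s p p' : R)
    (phi_ : nat -> 'rV[R]_N * 'rV[R]_N -> R) (phi0 : 'rV[R]_N * 'rV[R]_N -> R)
    (v_ : nat -> 'rV[R]_N -> R) (v0 : 'rV[R]_N -> R)
    (N_gt0 : (0 < N)%N) (s_gt0 : 0 < s) (s_lt1 : s < 1) (p_gt1 : 1 < p)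
    (pp' : p^-1 + p'^-1 = 1)
    (phi_Lp' : forall n, phi_ n \in Lfun (lebesgue_rV2 N) p'%:E)
    (phi0_Lp' : phi0 \in Lfun (lebesgue_rV2 N) p'%:E)
    (v_W : forall n, sobolev s p (v_ n)) (v0_W : sobolev s p v0)
    (v_cvg : sobolev_weak_cvg s p v_ v0)
    (phi_cvg : Lp_weak_cvg (lebesgue_rV2 N) p' phi_ phi0)
    (div_cvg : sobolev_dual_loc_cvg s p
                 (fun n => sp_div s p (phi_ n)) (sp_div s p phi0)) :
  distribution_cvg (fun n z => phi_ n z * sp_grad s p (v_ n) z)
                   (fun z => phi0 z * sp_grad s p v0 z).
Proof.
move=> psi tpsi.
have p0 : 0 < p by exact: lt_trans p_gt1.
have q1 : 1 < p'.
  have : p'^-1 = 1 - p^-1 by rewrite -pp' addrC addKr.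
  have : 0 < p^-1 < 1 by rewrite invr_gt0 p0 invf_lt1.
  move=> /andP[a b] e.
  by rewrite -[p']invrK invf_gt1 e ?subr_gt0// gtrBl.
have q0 : 0 < p' by exact: lt_trans q1.
have qp : p'^-1 + p^-1 = 1 by rewrite addrC.
have [L [C [/andP[L0 C0] psiL psiC psi2 psi1]]] := test_function_pair_bounds psi tpsi.
pose g (x : 'rV[R]_N) := psi (x, x).
pose d n (x : 'rV[R]_N) := v_ n x - v0 x.
have mpsi : measurable_fun setT psi.
  by apply: continuous_measurable_rV2; exact: (test_function_continuous _ _ tpsi).
have Sd n : sobolev s p (d n) by exact: (sobolevB s p p_gt1 _ _ (v_W n) v0_W).
have grad u : sobolev s p u -> sp_grad s p u \in Lfun (lebesgue_rV2 N) p%:E.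
  by move=> /(sobolevP s p p_gt1)[].
have weak_d := weak_cvg_sp_grad s p p_gt1 v_ v0 v_W v0_W v_cvg.
(* The gradients converge weakly in L^p, so they are bounded there, and their norms are the
   seminorms. *)
have [Gd GdP] : exists G : R, forall n, (gagliardo s p (d n) <= G%:E)%E.
  have [|G GP] := Lp_weak_bounded (lebesgue_rV2 N) p p' (fun n => sp_grad s p (d n)) p_gt1 pp' q0
    (fun n => grad _ (Sd n)).
    by move=> F DF; apply/cvg_ex; exists 0; exact: weak_d.
  by exists G => n; rewrite -Lnorm_sp_grad//; exact: GP.
pose D n z := phi_ n z - phi0 z.
have LD n : D n \in Lfun (lebesgue_rV2 N) p'%:E by apply: LfunB => //; exact: ltW.
have DE n F : continuous_dual [set f | f \in Lfun (lebesgue_rV2 N) p'%:E]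
    (fun f => 'N[lebesgue_rV2 N]_p'%:E[EFin \o f])%E F -> F (D n) = F (phi_ n) - F phi0.
  move=> [Flin _]; have -> : D n = (fun z => (-1) * phi0 z + phi_ n z).
    by apply/funext => z; rewrite mulN1r addrC.
  by rewrite (Flin _ _ _ phi0_Lp' (phi_Lp' n)) mulN1r addrC.
have weak_D F : continuous_dual [set f | f \in Lfun (lebesgue_rV2 N) p'%:E]
    (fun f => 'N[lebesgue_rV2 N]_p'%:E[EFin \o f])%E F ->
    F (D n) @[n --> \oo] --> (0 : R).
  move=> DF; under eq_fun do rewrite (DE _ _ DF).
  by rewrite -(subrr (F phi0)); apply: cvgB; [exact: phi_cvg|exact: cvg_cst].
have [CD CDP] : exists C : R, forall n, ('N[lebesgue_rV2 N]_p'%:E[EFin \o D n] <= C%:E)%E.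
  apply: (Lp_weak_bounded (lebesgue_rV2 N) p' p D q1 qp p0 LD) => F DF.
  by apply/cvg_ex; exists 0; exact: weak_D.
have CD0 : 0 <= CD by rewrite -lee_fin; apply: le_trans (CDP 0%N); exact: Lnorm_ge0.
have compact_d := rellich s p p' s_gt0 s_lt1 p_gt1 q0 pp' d Gd Sd GdP
  (weak_cvg_integral_set s p p' p_gt1 q0 pp' v_ v0 v_W v0_W v_cvg) L _ L0.
have Sgd w : sobolev s p w -> sobolev s p (fun x => g x * w x).
  exact: (sobolev_cutoff s p s_gt0 s_lt1 p_gt1 psi L C tpsi C0 psiL psiC psi2 psi1).
have C0' := ltW C0.
have Lrem n : cutoff_remainder s p psi (d n) \in Lfun (lebesgue_rV2 N) p%:E.
  have -> : cutoff_remainder s p psi (d n) =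
      (fun z => psi z * sp_grad s p (d n) z - sp_grad s p (fun x => g x * d n x) z).
    by apply/funext => z; rewrite cutoff_split [in RHS]addrC addKr.
  apply: LfunB; [exact: ltW| |exact: grad (Sgd _ (Sd n))].
  exact: (bounded_mul_Lfun _ p C _ _ p0 C0' mpsi psiC (grad _ (Sd n))).
have Lpv0 : (fun z => psi z * sp_grad s p v0 z) \in Lfun (lebesgue_rV2 N) p%:E.
  exact: (bounded_mul_Lfun _ p C _ _ p0 C0' mpsi psiC (grad _ v0_W)).
have Lpphi0 : (fun z => psi z * phi0 z) \in Lfun (lebesgue_rV2 N) p'%:E.
  exact: (bounded_mul_Lfun _ p' C _ _ q0 C0' mpsi psiC phi0_Lp').
(* With differences D phi and d, the product minus its limit is (D phi)(D d) + (D phi)(D v0) + phi0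
   (D d). The last two are [T4] and [T3] in reverse order; the first, multiplied by [psi], is cut
   into [T1] and [T2] by the splitting identity. *)
pose T1 n := \int[lebesgue_rV2 N]_z (D n z * sp_grad s p (fun x => g x * d n x) z).
pose T2 n := \int[lebesgue_rV2 N]_z (D n z * cutoff_remainder s p psi (d n) z).
pose T3 n := \int[lebesgue_rV2 N]_z (D n z * (psi z * sp_grad s p v0 z)).
pose T4 n := \int[lebesgue_rV2 N]_z (sp_grad s p (d n) z * (psi z * phi0 z)).
have split n : \int[lebesgue_rV2 N]_z (phi_ n z * sp_grad s p (v_ n) z * psi z) =
    T1 n + T2 n + T3 n + T4 n + \int[lebesgue_rV2 N]_z (phi0 z * sp_grad s p v0 z * psi z).
  have [I1 _] := Lfun_hoelder _ _ _ _ _ q0 p0 qp (LD n) (grad _ (Sgd _ (Sd n))).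
  have [I2 _] := Lfun_hoelder _ _ _ _ _ q0 p0 qp (LD n) (Lrem n).
  have [I3 _] := Lfun_hoelder _ _ _ _ _ q0 p0 qp (LD n) Lpv0.
  have [I4 _] := Lfun_hoelder _ _ _ _ _ p0 q0 pp' (grad _ (Sd n)) Lpphi0.
  have [I5 _] := Lfun_hoelder _ _ _ _ _ q0 p0 qp phi0_Lp' Lpv0.
  have I12 := integrableD measurableT I1 I2.
  have I123 := integrableD measurableT I12 I3.
  have I1234 := integrableD measurableT I123 I4.
  have -> : \int[lebesgue_rV2 N]_z (phi0 z * sp_grad s p v0 z * psi z) =
      \int[lebesgue_rV2 N]_z (phi0 z * (psi z * sp_grad s p v0 z)).
    by apply: eq_Rintegral => z _; ring.
  rewrite -[T1 n + T2 n]RintegralD// -RintegralD// -RintegralD// -RintegralD//.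
  apply: eq_Rintegral => z _.
  have gE : sp_grad s p (v_ n) z = sp_grad s p (d n) z + sp_grad s p v0 z.
    by rewrite /d sp_gradB subrK.
  rewrite gE -mulrDr -cutoff_split /D; ring.
have T4_0 : T4 n @[n --> \oo] --> (0 : R).
  exact: (weak_d _ (Lfun_pairing_dual _ _ _ _ p_gt1 pp' q0 Lpphi0)).
have T3_0 : T3 n @[n --> \oo] --> (0 : R).
  exact: (weak_D _ (Lfun_pairing_dual _ _ _ _ q1 qp p0 Lpv0)).
(* Bounded times strongly convergent, by Hölder's inequality. The bound [CD] may be 0, hence the
   division by [CD + 1]. *)
have T2_0 : T2 n @[n --> \oo] --> (0 : R).
  have [K K0 KP] := cutoff_remainder_le s p s_gt0 s_lt1 p_gt1 psi L C tpsi C0 psiL psi2 psi1.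
  apply/cvgr0Pnorm_le => e e0.
  pose b := e / (CD + 1).
  have CD1 : 0 < CD + 1 by rewrite ltr_wpDl.
  have b0 : 0 < b by rewrite divr_gt0.
  have := compact_d (b `^ p / K) (divr_gt0 (powR_gt0 _ b0) K0).
  apply: filterS => n dn.
  have [_ H] := Lfun_hoelder _ _ _ _ _ q0 p0 qp (LD n) (Lrem n).
  rewrite -lee_fin; apply: le_trans H _.
  have Nb : ('N[lebesgue_rV2 N]_p%:E[EFin \o cutoff_remainder s p psi (d n)] <= b%:E)%E.
    apply: Lnorm_le_of_pow => //; first exact: ltW.
    have md : measurable_fun setT (d n) by have [Ld _] := Sd n; exact: Lfun_measurable Ld.
    apply: le_trans (KP _ md) _.
    have K0' : (0 <= K%:E)%E by rewrite lee_fin ltW.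
    apply: le_trans (lee_wpmul2l K0' (ltW dn)) _.
    by rewrite -EFinM lee_fin mulrC divfK// gt_eqF.
  apply: (@le_trans _ _ (CD%:E * b%:E)%E).
    by apply: lee_pmul; rewrite ?Lnorm_ge0//; exact: CDP.
  rewrite -EFinM lee_fin /b mulrCA ler_piMr ?(ltW e0)//.
  by rewrite ler_pdivrMr// mul1r lerDl.
have T1_0 : T1 n @[n --> \oo] --> (0 : R).
  pose Omega := ball (0 : 'rV[R]_N) (L + 1).
  (* Multiples are absorbed into the factor [d n], so that the cutoff lemma covers the whole
     line. *)
  have S0gd n c : sobolev0 s p Omega (fun x => c * (g x * d n x)).
    have -> : (fun x => c * (g x * d n x)) = (fun x => g x * (c * d n x)).
      by apply/funext => x; rewrite mulrCA.
    exact: (sobolev0_cutoff s p p' s_gt0 s_lt1 p_gt1 q0 pp' psi L C tpsi L0 C0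
      psiL psiC psi2 psi1 _ (sobolevZ s p c _ p_gt1 (Sd n))).
  have bO : bounded_set Omega.
    exists (L + 1); split; first exact: num_real.
    move=> M LM x; rewrite /Omega -ball_normE/= sub0r normrN => xL.
    exact: ltW (lt_trans xL LM).
  (* Convergence to 0 in the extended reals makes the dual norms finite only from some index on. *)
  have := div_cvg Omega (ball_open _ _) bO; move=> /fine_cvgP[Nfin Ncvg].
  have bound n := sp_div_sub_le s p p' Omega (phi_ n) phi0 _ p_gt1 q0 qp
    (phi_Lp' n) phi0_Lp' (Sgd _ (Sd n)) (S0gd n).
  have [K K0 KP] := cutoff_grad_le s p s_gt0 s_lt1 p_gt1 psi L C tpsi C0 psiL psiC psi2 psi1.
  have Gd0 : 0 <= Gd.
    by rewrite -lee_fin; apply: le_trans (GdP 0%N); exact: poweR_ge0.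
  (* Bound on the seminorm of the cut-off difference: [Gd] accounts for the energy on cube times
     cube, and 1 for its p-th power integral on the cube, which is below 1 for large [n] by
     compactness. *)
  pose b := (K * (Gd `^ p + 1)) `^ p^-1.
  have b0 : 0 <= b by exact: powR_ge0.
  have bp : b `^ p = K * (Gd `^ p + 1).
    by rewrite /b -powRrM mulVf ?gt_eqF// powRr1// mulr_ge0 ?addr_ge0 ?powR_ge0// ltW.
  apply/cvgr0Pnorm_le => e e0.
  have b1 : 0 < b + 1 by rewrite ltr_wpDl.
  have eb : 0 < e / (b + 1) by rewrite divr_gt0.
  have smallN := (cvgr0Pnorm_le _).1 Ncvg _ eb.
  near=> n.
  have nfin : sobolev_dual_norm s p Omega
      (fun u => (sp_div s p (phi_ n) u - sp_div s p phi0 u)%R) \is a fin_num.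
    by near: n; exact: Nfin.
  have nle : `|fine (sobolev_dual_norm s p Omega
      (fun u => (sp_div s p (phi_ n) u - sp_div s p phi0 u)%R))| <= e / (b + 1).
    by near: n; exact: smallN.
  have dn : (\int[lebesgue_rV N]_(x in cube (0%R : 'rV[R]_N) L) (`|d n x| `^ p)%:E < 1%:E)%E.
    by near: n; exact: compact_d.
  have md : measurable_fun setT (d n) by have [Ld _] := Sd n; exact: Lfun_measurable Ld.
  have gb : (gagliardo s p (fun x => (g x * d n x)%R) <= b%:E)%E.
    rewrite -Lnorm_sp_grad//; apply: Lnorm_le_of_pow => //.
    apply: le_trans (KP _ md) _; rewrite bp EFinM.
    apply: lee_wpmul2l; first by rewrite lee_fin ltW.
    rewrite EFinD; apply: leeD; last exact: ltW.
    apply: (@le_trans _ _ (gagliardo s p (d n) `^ p)%E).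
      rewrite gagliardo_powE//; apply: ge0_subset_integral => //.
      - by apply: measurableX; exact: measurable_cube.
      - by apply/measurable_EFinP/measurable_norm_powR; exact: measurable_sp_grad.
    rewrite -poweR_EFin; apply: gt0_ler_poweR => //.
    - exact: ltW.
    - by rewrite in_itv/= leey poweR_ge0.
    - by rewrite in_itv/= leey lee_fin Gd0.
  rewrite -lee_fin; apply: le_trans (bound n) _.
  have N0 : (0 <= sobolev_dual_norm s p Omega
      (fun u => (sp_div s p (phi_ n) u - sp_div s p phi0 u)%R))%E.
    by rewrite /sobolev_dual_norm le_max lexx.
  apply: (@le_trans _ _ ((e / (b + 1))%:E * b%:E)%E).
    apply: lee_pmul => //; first exact: poweR_ge0.
    by rewrite -(fineK nfin) lee_fin; apply: le_trans (ler_norm _) nle.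
  rewrite -EFinM lee_fin -mulrA ler_piMr ?(ltW e0)//.
  by rewrite mulrC ler_pdivrMr// mul1r lerDl.
under eq_fun do rewrite split.
set I := Rintegral _ _ _; have E0 : 0 + 0 + 0 + 0 + I = I by rewrite !addr0 add0r.
have := cvgD (cvgD (cvgD (cvgD T1_0 T2_0) T3_0) T4_0) (cvg_cst I).
by rewrite E0; exact.
Unshelve. all: by end_near. Qed.
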